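(* Let $\mathcal{F}_{\mathsf{SecODT}}$ be the ideal functionality for outsourced decision tree inference and let $\Pi$ be the four-party protocol (provider $\mathcal{P}$, client $\mathcal{U}$, non-colluding cloud servers $\mathcal{C}_0,\mathcal{C}_1$), both as specified in the context. Then $\Pi$ securely realizes $\mathcal{F}_{\mathsf{SecODT}}$ in the semi-honest adversary setting with static corruption. That is, writing $\mathsf{View}^{\Pi}_{X}$ for the view of party $X$ in the real-world execution of $\Pi$ on decision tree $\mathcal{T}$ (input of $\mathcal{P}$) and feature vector $\mathbf{x}$ (input of $\mathcal{U}$), and $\stackrel{c}{\approx}$ for computational indistinguishability, all of the following hold: 1. (Corrupted provider) there is a probabilistic polynomial time (PPT) simulator $\mathsf{Sim}_{\mathcal{P}}$ with $\mathsf{View}^{\Pi}_{\mathcal{P}} \stackrel{c}{\approx} \mathsf{Sim}_{\mathcal{P}}(\mathcal{T})$; 2. (Corrupted cloud server) for each $m\in\{0,1\}$ there is a PPT simulator $\mathsf{Sim}_{\mathcal{C}_m}$, receiving no private input or output of any party, with $\mathsf{View}^{\Pi}_{\mathcal{C}_m} \stackrel{c}{\approx} \mathsf{Sim}_{\mathcal{C}_m}$; 3. (Corrupted client) there is a PPT simulator $\mathsf{Sim}_{\mathcal{U}}$ with $\mathsf{View}^{\Pi}_{\mathcal{U}} \stackrel{c}{\approx} \mathsf{Sim}_{\mathcal{U}}(\mathbf{x},\mathcal{T}(\mathbf{x}))$.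
   Context: **Decision trees.** A complete binary decision tree $\mathcal{T}$ of depth $d$ has $J$ decision (internal) nodes $\mathcal{D}_j$ with thresholds $\mathbf{y}=(y_0,\dots,y_{J-1})$, $Z$ leaf nodes $\mathcal{L}_z$ with prediction values $\mathbf{u}=(u_0,\dots,u_{Z-1})$, and a selection map $\sigma:\{0,\dots,J-1\}\to\{0,\dots,I-1\}$. The input is a feature vector $\mathbf{x}=(x_0,\dots,x_{I-1})$. All values are $l$-bit values in $\mathbb{Z}_{2^l}$. At $\mathcal{D}_j$ the bit $v_j$ of the comparison $x_{\sigma(j)}<y_j$ is computed. As in the paper's approach, this comparison is identified with the most significant bit (MSB) of the difference in $\mathbb{Z}_{2^l}$ (two's complement). Starting at the root, go left if $v_j=0$ and right if $v_j=1$. $\mathcal{T}(\mathbf{x})$ is the prediction value $u^*$ of the leaf reached. The parameters $d$, $I$, $l$ (generic meta-parameters) are public. **Ideal functionality $\mathcal{F}_{\mathsf{SecODT}}$.** Input: $\mathcal{T}$ from the provider and $\mathbf{x}$ from the client; the cloud servers provide no input. Computation: $\mathcal{T}(\mathbf{x})$. Output: $\mathcal{T}(\mathbf{x})$ to the client, nothing to the provider and the cloud servers. **Adversary.** Semi-honest, static corruption of a single entity; $\mathcal{C}_0$ and $\mathcal{C}_1$ are never corrupted at the same time. A party's view consists of its input, its randomness and the messages it receives. **Secret sharing.** A sharing $[\alpha]$ of $\alpha\in\mathbb{Z}_{2^l}$ is $[\alpha]_0=\alpha-r$, $[\alpha]_1=r$ with $r$ uniform in $\mathbb{Z}_{2^l}$;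 $\mathcal{C}_m$ holds $[\alpha]_m$. $\langle\cdot\rangle$ denotes the same with ring $\mathbb{Z}_2$. Addition, subtraction and multiplication by public constants are local. Multiplication of $[\alpha]$ and $[\beta]$ uses a fresh shared random triple $(t_1,t_2,t_3)$, $t_3=t_1t_2$, pre-generated and made available to the servers (e.g. by a semi-honest third party): $\mathcal{C}_m$ computes and sends $[e]_m=[\alpha]_m-[t_1]_m$ and $[f]_m=[\beta]_m-[t_2]_m$; both recover $e,f$; $\mathcal{C}_m$ sets $[\alpha\beta]_m=m\,e f+[t_1]_m f+[t_2]_m e+[t_3]_m$. Multiplication in $\mathbb{Z}_2$ is done the same way. OT denotes a 1-out-of-$I$ oblivious transfer protocol secure against semi-honest adversaries. **Protocol $\Pi$.** Arithmetic is in $\mathbb{Z}_{2^l}$ unless stated otherwise. *Phase 1 (input preparation).* The client shares $\mathbf{x}$ entrywise and sends $[\mathbf{x}]_m$ to $\mathcal{C}_m$. The provider forms the index vector $\mathcal{I}=(\mathcal{I}_0,\dots,\mathcal{I}_{J-1})$ with $\mathcal{I}_j=\sigma(j)\in[0,I-1]$, shares $\mathbf{y},\mathbf{u},\mathcal{I}$ entrywise, and sends $[\mathbf{y}]_m,[\mathbf{u}]_m,[\mathcal{I}]_m$ to $\mathcal{C}_m$. The provider receives no messages. *Phase 2 (feature selection), for each $j$.* Let $\mathbf{p}_m=[\mathbf{x}]_m$. (1) $\mathcal{C}_m$ picks fresh uniform $s_m,r_m\in\mathbb{Z}_{2^l}$ and creates an array $\mathbf{p}'_m$ with $\mathbf{p}'_m[i^*_m]=\mathbf{p}_m[i]+r_m$,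 where $i^*_m=((i+s_m)\bmod 2^l)\bmod I$, for each $i$. (2) $\mathcal{C}_0$ picks uniform $r\in\mathbb{Z}_{2^l}$ and sends $[\mathcal{I}_j]_0+r$ to $\mathcal{C}_1$. (3) $\mathcal{C}_1$ adds $[\mathcal{I}_j]_1+s_1$ and sends the result $\mathcal{I}_j+r+s_1$ to $\mathcal{C}_0$. (4) $\mathcal{C}_0$ removes $r$ and sets $i'_1=((\mathcal{I}_j+s_1)\bmod 2^l)\bmod I$. (5) $\mathcal{C}_0$, as OT receiver with input $i'_1$, obtains $\mathbf{p}'_1[i'_1]$ from $\mathcal{C}_1$. (6) Symmetrically to (2)–(5), $\mathcal{C}_1$ obtains $\mathbf{p}'_0[i'_0]$ with $i'_0=((\mathcal{I}_j+s_0)\bmod 2^l)\bmod I$. (7) $\mathcal{C}_1$ picks uniform $r'\in\mathbb{Z}_{2^l}$, sends $\mathbf{p}^*_0[i'_0]=\mathbf{p}'_0[i'_0]-r_1-r'$ to $\mathcal{C}_0$, and sets $[x_{\mathcal{I}_j}]_1=r'$. (8) $\mathcal{C}_0$ sets $[x_{\mathcal{I}_j}]_0=\mathbf{p}^*_0[i'_0]+\mathbf{p}'_1[i'_1]-r_0$. *Phase 3 (decision node evaluation), for each $j$.* (Described for $l$ a power of two; the paper's setting is $l=64$.) $\mathcal{C}_m$ computes $[\Delta]_m=[x_{\mathcal{I}_j}]_m-[y_j]_m$. Let $a_{l-1}\cdots a_0$ and $b_{l-1}\cdots b_0$ be the bit strings of $[\Delta]_0$ and $[\Delta]_1$. Set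 $\langle a_q\rangle=(a_q,0)$, $\langle b_q\rangle=(0,b_q)$, $\langle w_q\rangle=(a_q,b_q)$ (shares of $\mathcal{C}_0,\mathcal{C}_1$). Compute over $\mathbb{Z}_2$: $\langle G_q\rangle=\langle a_q\rangle\cdot\langle b_q\rangle$ and $\langle P_q\rangle=\langle a_q\rangle+\langle b_q\rangle$ for all $q$. Let $(G'',P'')\diamond(G',P')=(G''+G'P'',\,P''P')$, evaluated on shares with two secret-shared multiplications. Round 1: $(G^1_0,P^1_0)=(G_0,P_0)$ and $(G^1_k,P^1_k)=(G_{2k},P_{2k})\diamond(G_{2k-1},P_{2k-1})$ for $1\le k\le l/2-1$. Round $t\ge2$, while more than one pair remains: $(G^t_k,P^t_k)=(G^{t-1}_{2k+1},P^{t-1}_{2k+1})\diamond(G^{t-1}_{2k},P^{t-1}_{2k})$ for all $0\le k\le l/2^t-1$. In the last round ($t=\log_2 l$) only $\langle G^t_0\rangle=\langle c_{l-1}\rangle$ is computed. Output $\langle v_j\rangle=\langle w_{l-1}\rangle+\langle c_{l-1}\rangle$. *Phase 4 (inference generation).* For each $j$, with $\langle v_j\rangle=(t_1,t_2)$, put $[t_1]=(t_1,0)$, $[t_2]=(0,t_2)$ over $\mathbb{Z}_{2^l}$ and compute $[v_j]=[t_1]+[t_2]-2[t_1][t_2]$. Assign to the left outgoing edge of $\mathcal{D}_j$ the sharing of $1-v_j$ given by $[E^L_j]_0=1-[v_j]_0$, $[E^L_j]_1=-[v_j]_1$, and to the right outgoing edge $[E^R_j]=[v_j]$. For each leaf $\mathcal{L}_z$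 compute $[g_z]$ as the secret-shared product of all edge values on the path from the root to $\mathcal{L}_z$, then $[u^*]=\sum_z[g_z]\cdot[u_z]$. The client receives $[u^*]_0,[u^*]_1$ from the servers and outputs $u^*=[u^*]_0+[u^*]_1$; it receives no other messages.
   Formalization: Added: I divides 2^l, or 2^{-l} is negligible in the security parameter; else index wrap-around modulo 2^l selects wrong features with non-negligible probability and the client's view cannot be simulated. Also l+I+2^d is polynomially bounded and l≥2 is a power of two. *)

(* Defs.v *)
(* Library: Mathematical Components. *)
From HB Require Import structures.
From mathcomp Require Import all_boot all_order all_algebra.

Set Implicit Arguments.
Unset Strict Implicit.
Unset Printing Implicit Defensive.

Import Order.TTheory GRing.Theory Num.Theory.
Local Open Scope ring_scope.

(** * Bit strings; [Zw w] is the ring Z_(2^w), meaningful for w >= 1 only *)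

Definition bits := seq bool.

(* All bit strings are little-endian. *)
Fixpoint num (s : bits) : nat :=
  if s is b :: s' then (b + (num s').*2)%N else 0%N.

Definition encn (w n : nat) : bits := mkseq (fun q => odd (n %/ 2 ^ q)) w.

Notation Zw w := 'Z_(2 ^ w).

Definition enc (w : nat) (a : Zw w) : bits := encn w a.
Definition dec (w : nat) (s : bits) : Zw w := (num s)%:R.
Arguments enc w a : clear implicits.
Arguments dec w s : clear implicits.

Definition bit (w : nat) (a : Zw w) (q : nat) : bool := nth false (enc w a) q.
Definition msb (w : nat) (a : Zw w) : bool := bit a w.-1.

Definition vsize (v : seq bits) : nat := sumn [seq (size s).+1 | s <- v].

(** * Finite randomized experiments: every random choice is a fair coin *)

Inductive dist (A : Type) : Type :=
| Ret of A
| Toss of (bool -> dist A).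

Fixpoint pr (A : Type) (m : dist A) (E : pred A) : rat :=
  match m with
  | Ret a => (E a)%:R
  | Toss f => (pr (f true) E + pr (f false) E) / 2
  end.

Fixpoint bind (A B : Type) (m : dist A) (f : A -> dist B) : dist B :=
  match m with
  | Ret a => f a
  | Toss g => Toss (fun b => bind (g b) f)
  end.

Fixpoint tosses (n : nat) : dist bits :=
  if n is n'.+1
  then Toss (fun b => bind (tosses n') (fun s => Ret (b :: s)))
  else Ret [::].

Definition unif (w : nat) : dist (Zw w) :=
  bind (tosses w) (fun s => Ret (dec w s)).

(** * Probabilistic polynomial time *)

(* A randomized WHILE language.  A register holds a list of bit strings; the
   operations on strings and on numbers act on the first entry of the list. *)

Inductive op1 := OHead | OBehead | OCount | OLength.
Inductive op2 := OCat | OTakeL | ODropL | OJoin | OTakeB | ODropB | OToBits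
               | OAdd | OSub | OMul | ODiv | OMod | OLeq.

Inductive expr :=
| EVar of nat
| ELit of seq bits
| EApp1 of op1 & expr
| EApp2 of op2 & expr & expr.

Inductive cmd :=
| CAssign of nat & expr
| CFlip of nat
| CSeq of cmd & cmd
| CIf of expr & cmd & cmd
| CWhile of expr & cmd
| CCall of nat & cmd & expr.

Definition str (v : seq bits) : bits := head [::] v.
Definition numv (v : seq bits) : nat := num (str v).
Definition bin (n : nat) : seq bits := [:: encn (trunc_log 2 n).+1 n].

Definition sem1 (o : op1) (v : seq bits) : seq bits :=
  match o with
  | OHead => [:: str v]
  | OBehead => behead v
  | OCount => bin (size v)
  | OLength => bin (size (str v))
  end.

Definition sem2 (o : op2) (u v : seq bits) : seq bits :=
  match o with
  | OCat => u ++ v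
  | OTakeL => take (numv u) v
  | ODropL => drop (numv u) v
  | OJoin => [:: str u ++ str v]
  | OTakeB => [:: take (numv u) (str v)]
  | ODropB => [:: drop (numv u) (str v)]
  | OToBits => [:: encn (numv u) (numv v)]
  | OAdd => bin (numv u + numv v)
  | OSub => bin (numv u - numv v)
  | OMul => bin (numv u * numv v)
  | ODiv => bin (numv u %/ numv v)
  | OMod => bin (numv u %% numv v)
  | OLeq => [:: [:: (numv u <= numv v)%N]]
  end.

Definition store := nat -> seq bits.
Definition load (v : seq bits) : store := fun r => if r == 0%N then v else [::].
Definition upd (st : store) (r : nat) (v : seq bits) : store :=
  fun r' => if r' == r then v else st r'.

(* The value of an expression together with its cost.  Operand and result
   lengths are charged, so a polynomially bounded cost bounds all intermediate
   lengths, and each operation is polynomial-time in the lengths charged. *)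
Fixpoint eval (st : store) (e : expr) : seq bits * nat :=
  match e with
  | EVar r => (st r, (vsize (st r)).+1)
  | ELit v => (v, (vsize v).+1)
  | EApp1 o e1 =>
      let r1 := eval st e1 in
      let v := sem1 o r1.1 in (v, (r1.2 + vsize v).+1)
  | EApp2 o e1 e2 =>
      let r1 := eval st e1 in let r2 := eval st e2 in
      let v := sem2 o r1.1 r2.1 in (v, (r1.2 + r2.2 + vsize v).+1)
  end.

(* Final store and total cost; [None] when the fuel, which bounds the recursion
   depth of the interpreter, is exhausted. *)
Fixpoint exec (fuel : nat) (c : cmd) (st : store) : dist (option (store * nat)) :=
  if fuel is n.+1 then
    let seqc t m f :=
      bind m (fun o : option (store * nat) =>
        if o is Some (st1, t1) then
          bind (f st1) (fun o' : option (store * nat) =>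
            if o' is Some (st2, t2) then Ret (Some (st2, (t + t1 + t2)%N))
            else Ret None)
        else Ret None) in
    let done st1 := Ret (Some (st1, 0%N)) in
    match c with
    | CAssign r e =>
        let v := eval st e in Ret (Some (upd st r v.1, v.2.+1))
    | CFlip r => Toss (fun b => Ret (Some (upd st r [:: [:: b]], 1%N)))
    | CSeq c1 c2 => seqc 1%N (exec n c1 st) (exec n c2)
    | CIf e c1 c2 =>
        let v := eval st e in
        seqc v.2.+1 (if numv v.1 == 0%N then exec n c2 st else exec n c1 st) done
    | CWhile e c1 =>
        let v := eval st e in
        if numv v.1 == 0%N then Ret (Some (st, v.2.+1))
        else seqc v.2.+1 (exec n c1 st) (exec n c)
    | CCall r c1 e =>
        let v := eval st e in
        seqc v.2.+1 (exec n c1 (load v.1))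
          (fun st1 => Ret (Some (upd st r (st1 0%N), (vsize (st1 0%N)).+1)))
    end
  else Ret None.

(* Some program, started with its argument in register 0, always halts within
   polynomial cost and leaves in register 0 a result distributed as [S]. *)
Definition ppt (S : seq bits -> dist (seq bits)) : Prop :=
  exists (c : cmd) (a : nat), forall v : seq bits, exists fuel : nat,
    let o := exec fuel c (load v) in
    pr o (fun r => if r is Some (_, t) then (t <= vsize v ^ a + a)%N else false)
      = 1
    /\ forall E : pred (seq bits),
         pr o (fun r => if r is Some (st, _) then E (st 0%N) else false)
           = pr (S v) E.

Definition polytime (f : seq bits -> bits) : Prop := ppt (fun v => Ret [:: f v]).

(** * Computational indistinguishability *)

Definition poly_bounded (f : nat -> nat) : Prop :=
  exists c : nat, forall k, (f k <= k ^ c + c)%N.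

Definition negligible (mu : nat -> rat) : Prop :=
  forall c : nat, exists N : nat, forall k, (N < k)%N -> `|mu k| < (k%:R ^+ c)^-1.

Definition accepts (v : seq bits) : bool := v == [:: [:: true]].

(* Ensembles indexed by the security parameter k and an input; distinguishers
   are non-uniform: they also get k in unary and an advice of polynomial size. *)
Definition cind (Inp : nat -> Type) (X Y : forall k, Inp k -> dist (seq bits))
    : Prop :=
  forall (D : seq bits -> dist (seq bits)) (adv : nat -> seq bits),
    ppt D -> poly_bounded (fun k => vsize (adv k)) ->
    exists2 mu : nat -> rat, negligible mu &
      forall k (a : Inp k),
        let run Z := pr (bind Z (fun s => D (nseq k true :: adv k ++ s))) accepts in
        `|run (X k a) - run (Y k a)| <= mu k.

(** * Meta-parameters, decision trees, the functionality *)

(* The bit length is l = 2 ^ plog. *)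
Record params := Params { plog : nat; pfeat : nat; pdepth : nat }.
Definition plen (p : params) : nat := (2 ^ plog p)%N.
Definition pnode (p : params) : nat := (2 ^ pdepth p).-1.
Definition pleaf (p : params) : nat := (2 ^ pdepth p)%N.

(* The last condition says that feature indices are l-bit values. *)
Definition valid_params (p : params) : bool :=
  [&& 0 < plog p, 0 < pfeat p & pfeat p <= 2 ^ plen p]%N.

Definition features (p : params) := (pfeat p).-tuple (Zw (plen p)).

(* Complete binary tree in heap order: the root is node 0, the children of node
   j are nodes 2j+1 (left) and 2j+2 (right), and leaf z is node J + z. *)
Record dtree (p : params) := DTree {
  thr : (pnode p).-tuple (Zw (plen p));
  leafval : (pleaf p).-tuple (Zw (plen p));
  sel : (pnode p).-tuple 'I_(pfeat p) }.

Definition node_bit (p : params) (T : dtree p) (x : features p) (j : nat) : bool :=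
  msb (nth 0 x (nth 0%N [seq nat_of_ord i | i <- sel T] j) - nth 0 (thr T) j).

Fixpoint descend (v : nat -> bool) (d j : nat) : nat :=
  if d is d'.+1 then descend v d' (j.*2.+1 + v j)%N else j.

Definition dt_eval (p : params) (T : dtree p) (x : features p) : Zw (plen p) :=
  nth 0 (leafval T) (descend (node_bit T x) (pdepth p) 0 - pnode p)%N.

Definition enc_features (p : params) (x : features p) : seq bits :=
  [seq enc (plen p) a | a <- x].

Definition enc_dtree (p : params) (T : dtree p) : seq bits :=
  [seq enc (plen p) a | a <- thr T] ++ [seq enc (plen p) a | a <- leafval T]
  ++ [seq encn (plen p) (nat_of_ord i) | i <- sel T].

Definition public (k : nat) (p : params) : seq bits :=
  [:: nseq k true; nseq (plen p) true; nseq (pfeat p) true; nseq (pleaf p) true].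

(** * 1-out-of-n oblivious transfer of w-bit messages *)

(* Roles: [true] is the receiver, [false] the sender.  A party computes its next
   message from the public values, its input, its random tape and the messages
   received so far.  In each round the sender speaks first; messages may be
   empty, so any alternation is covered. *)
Record ot_protocol := OTProtocol {
  ot_rounds : nat -> nat -> nat -> nat;
  ot_coins : bool -> nat -> nat -> nat -> nat;
  ot_msg : bool -> seq bits -> bits;
  ot_out : seq bits -> bits }.

Definition ot_public (k w n : nat) : seq bits :=
  [:: nseq k true; nseq w true; nseq n true].

Definition ot_inS (w : nat) (arr : seq (Zw w)) : seq bits :=
  [seq enc w a | a <- arr].
Definition ot_inR (w i : nat) : seq bits := [:: encn w i].

(* [toS] and [toR] are the messages received by the sender and the receiver;
   [argS] and [argR] are public values, input and tape. *)
Fixpoint ot_talk (ot : ot_protocol) (rounds : nat) (argS argR toS toR : seq bits)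
    : seq bits * seq bits :=
  if rounds is n.+1 then
    let toR' := rcons toR (ot_msg ot false (argS ++ toS)) in
    let toS' := rcons toS (ot_msg ot true (argR ++ toR')) in
    ot_talk ot n argS argR toS' toR'
  else (toS, toR).

(* Receiver output, and (tape, received messages) of the sender and of the
   receiver. *)
Definition ot_exec (ot : ot_protocol) (k w n : nat) (arr : seq (Zw w)) (i : nat)
    : dist (Zw w * (seq bits * seq bits)) :=
  bind (tosses (ot_coins ot false k w n)) (fun tapeS =>
  bind (tosses (ot_coins ot true k w n)) (fun tapeR =>
    let argS := rcons (ot_public k w n ++ ot_inS arr) tapeS in
    let argR := rcons (ot_public k w n ++ ot_inR w i) tapeR in
    let t := ot_talk ot (ot_rounds ot k w n) argS argR [::] [::] in
    Ret (dec w (ot_out ot (argR ++ t.2)), (tapeS :: t.1, tapeR :: t.2)))).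

Definition ot_input (p : params) : Type :=
  ((pfeat p).-tuple (Zw (plen p)) * 'I_(pfeat p))%type.

Definition ot_run (ot : ot_protocol) (k : nat) (p : params) (a : ot_input p) :=
  ot_exec ot k (pfeat p) a.1 a.2.

Definition ot_viewS (ot : ot_protocol) (k : nat) (p : params) (a : ot_input p) :=
  bind (ot_run ot k a) (fun o => Ret (ot_inS a.1 ++ o.2.1)).
Definition ot_viewR (ot : ot_protocol) (k : nat) (p : params) (a : ot_input p) :=
  bind (ot_run ot k a) (fun o => Ret (ot_inR (plen p) a.2 ++ o.2.2)).

Definition ot_efficient (ot : ot_protocol) (par : nat -> params) : Prop :=
  [/\ forall role, polytime (ot_msg ot role), polytime (ot_out ot) &
      exists c : nat, forall k (a : ot_input (par k)),
        pr (ot_run ot k a)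
           (fun o => vsize o.2.1 + vsize o.2.2 <= k ^ c + c)%N = 1].

Definition ot_correct (ot : ot_protocol) (par : nat -> params) : Prop :=
  exists2 mu, negligible mu &
    forall k (a : ot_input (par k)),
      pr (ot_run ot k a) (fun o => o.1 != tnth a.1 a.2) <= mu k.

Definition ot_private_sender (ot : ot_protocol) (par : nat -> params) : Prop :=
  exists2 Sim, ppt Sim &
    cind (fun k (a : ot_input (par k)) => ot_viewS ot k a)
         (fun k (a : ot_input (par k)) =>
            Sim (ot_public k (plen (par k)) (pfeat (par k)) ++ ot_inS a.1)).

Definition ot_private_receiver (ot : ot_protocol) (par : nat -> params) : Prop :=
  exists2 Sim, ppt Sim &
    cind (fun k (a : ot_input (par k)) => ot_viewR ot k a)
         (fun k (a : ot_input (par k)) =>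
            Sim (ot_public k (plen (par k)) (pfeat (par k))
                 ++ ot_inR (plen (par k)) a.2
                 ++ [:: enc (plen (par k)) (tnth a.1 a.2)])).

Definition ot_secure (ot : ot_protocol) (par : nat -> params) : Prop :=
  [/\ ot_efficient ot par, ot_correct ot par,
      ot_private_sender ot par & ot_private_receiver ot par].

(** * Protocol executions with recorded views *)

(* [Server false] is C_0 and [Server true] is C_1. *)
Inductive party := Provider | Client | Server of bool.

Definition party_code (P : party) : option (option bool) :=
  match P with Provider => None | Client => Some None | Server m => Some (Some m) end.
Definition party_decode (o : option (option bool)) : party :=
  match o with None => Provider | Some None => Client | Some (Some m) => Server m end.
Fact party_codeK : cancel party_code party_decode. Proof. by case. Qed.
HB.instance Definition _ := Equality.copy party (can_type party_codeK).

(* An entry (P, s) records a random choice made, or a message received, by P. *)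
Definition log := seq (party * bits).
Definition proto (A : Type) := dist (A * log).

Definition pret (A : Type) (a : A) : proto A := Ret (a, [::]).
Definition pbind (A B : Type) (m : proto A) (f : A -> proto B) : proto B :=
  bind m (fun r => bind (f r.1) (fun q => Ret (q.1, r.2 ++ q.2))).

Notation "'let*' x := m 'in' f" := (pbind m (fun x => f))
  (at level 200, x name, m at level 100, f at level 200).

Fixpoint pmapM (A B : Type) (f : A -> proto B) (s : seq A) : proto (seq B) :=
  if s is a :: s' then
    let* b := f a in let* bs := pmapM f s' in pret (b :: bs)
  else pret [::].

Definition dealer (w : nat) : proto (Zw w) :=
  bind (unif w) (fun a => pret a).
Definition rand (w : nat) (P : party) : proto (Zw w) :=
  bind (unif w) (fun a => Ret (a, [:: (P, enc w a)])).
Definition send (w : nat) (P : party) (a : Zw w) : proto unit :=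
  Ret (tt, [:: (P, enc w a)]).
Arguments dealer w : clear implicits.
Arguments rand w P : clear implicits.
Arguments send w P a : clear implicits.

Definition view_of (A : Type) (P : party) (input : seq bits) (m : proto A)
    : dist (seq bits) :=
  bind m (fun r => Ret (input ++ [seq e.2 | e <- r.2 & e.1 == P])).

(** * Secret sharing *)

Definition share (w : nat) := (Zw w * Zw w)%type.
Definition part (w : nat) (m : bool) (a : share w) : Zw w := if m then a.2 else a.1.
Definition addsh (w : nat) (a b : share w) : share w := (a.1 + b.1, a.2 + b.2).
Definition subsh (w : nat) (a b : share w) : share w := (a.1 - b.1, a.2 - b.2).
Definition scalesh (w : nat) (c : Zw w) (a : share w) : share w := (c * a.1, c * a.2).

Definition give (w : nat) (P : party) (a : Zw w) : proto (share w) :=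
  let* r := rand w P in
  let* _ := send w (Server false) (a - r) in
  let* _ := send w (Server true) r in
  pret (a - r, r).

(* The randomness of the third party is in nobody's view. *)
Definition deal (w : nat) (a : Zw w) : proto (share w) :=
  let* r := dealer w in
  let* _ := send w (Server false) (a - r) in
  let* _ := send w (Server true) r in
  pret (a - r, r).

Definition mulsh (w : nat) (a b : share w) : proto (share w) :=
  let* v1 := dealer w in
  let* v2 := dealer w in
  let* t1 := deal v1 in
  let* t2 := deal v2 in
  let* t3 := deal (v1 * v2) in
  let es := subsh a t1 in
  let fs := subsh b t2 in
  let* _ := send w (Server true) (part false es) in
  let* _ := send w (Server true) (part false fs) in
  let* _ := send w (Server false) (part true es) in
  let* _ := send w (Server false) (part true fs) in
  let e := es.1 + es.2 in
  let f := fs.1 + fs.2 in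
  let res (m : bool) : Zw w :=
    m%:R * (e * f) + part m t1 * f + part m t2 * e + part m t3 in
  pret (res false, res true).

(** * Feature selection *)

(* (a mod 2^l) mod I *)
Definition slot (w n : nat) (a : Zw w) : nat := (a %% n)%N.

(* Entries are written for i = 0, 1, ..., I-1 in this order into an array of
   zeros, so that a later entry overwrites an earlier one in the same slot. *)
Definition scatter (w n : nat) (arr : seq (Zw w)) (s r : Zw w) : seq (Zw w) :=
  foldl (fun acc i => set_nth 0 acc (slot n (i%:R + s)) (nth 0 arr i + r))
        (nseq n 0) (iota 0 n).

Definition ot_step (ot : ot_protocol) (k w n : nat) (m : bool)
    (arr : seq (Zw w)) (i : nat) : proto (Zw w) :=
  bind (ot_exec ot k n arr i) (fun o =>
    Ret (o.1, [seq (Server (~~ m), s) | s <- o.2.1]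
              ++ [seq (Server m, s) | s <- o.2.2])).

(* C_m obtains from the other server, whose array is [arr] and whose rotation
   is [s], the entry for the shared index [idx]. *)
Definition fetch (ot : ot_protocol) (k w n : nat) (m : bool) (idx : share w)
    (arr : seq (Zw w)) (s : Zw w) : proto (Zw w) :=
  let* r := rand w (Server m) in
  let a := part m idx + r in
  let* _ := send w (Server (~~ m)) a in
  let b := a + (part (~~ m) idx + s) in
  let* _ := send w (Server m) b in
  ot_step ot k n m arr (slot n (b - r)).

Definition select (ot : ot_protocol) (k w n : nat) (xs : seq (share w))
    (idx : share w) : proto (share w) :=
  let* s0 := rand w (Server false) in
  let* r0 := rand w (Server false) in
  let* s1 := rand w (Server true) in
  let* r1 := rand w (Server true) in
  let arr0 := scatter n [seq part false a | a <- xs] s0 r0 in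
  let arr1 := scatter n [seq part true a | a <- xs] s1 r1 in
  let* q1 := fetch ot k n false idx arr1 s1 in
  let* q0 := fetch ot k n true idx arr0 s0 in
  let* r' := rand w (Server true) in
  let p0 := q0 - r1 - r' in
  let* _ := send w (Server false) p0 in
  pret (p0 + q1 - r0, r').

(** * Decision node evaluation *)

(* Pairs (G, P) of shared bits; [hi] and [lo] are the left and right operands. *)
Definition gp := (share 1 * share 1)%type.
Definition gp0 : gp := ((0, 0), (0, 0)).

Definition diamond_G (hi lo : gp) : proto (share 1) :=
  let* g := mulsh lo.1 hi.2 in pret (addsh hi.1 g).

Definition diamond (hi lo : gp) : proto gp :=
  let* g := diamond_G hi lo in
  let* pp := mulsh hi.2 lo.2 in
  pret (g, pp).

(* [n] rounds remain; the last one computes only G. *)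
Fixpoint carry_rounds (n : nat) (s : seq gp) : proto (share 1) :=
  match n with
  | 0 => pret (nth gp0 s 0).1
  | 1 => diamond_G (nth gp0 s 1) (nth gp0 s 0)
  | n'.+1 =>
      let* s' := pmapM (fun k => diamond (nth gp0 s k.*2.+1) (nth gp0 s k.*2))
                       (iota 0 (size s)./2) in
      carry_rounds n' s'
  end.

Definition bitZ2 (b : bool) : Zw 1 := b%:R.

(* Here l = 2 ^ e. *)
Definition msb_share (e : nat) (delta : share (2 ^ e)) : proto (share 1) :=
  let l := (2 ^ e)%N in
  let sa q : share 1 := (bitZ2 (bit delta.1 q), 0) in
  let sb q : share 1 := (0, bitZ2 (bit delta.2 q)) in
  let sw q : share 1 := (bitZ2 (bit delta.1 q), bitZ2 (bit delta.2 q)) in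
  let* s := pmapM (fun q => let* g := mulsh (sa q) (sb q) in
                            pret (g, addsh (sa q) (sb q))) (iota 0 l) in
  let* s1 := pmapM (fun k => diamond (nth gp0 s k.*2) (nth gp0 s k.*2.-1))
                   (iota 1 (l./2).-1) in
  let* c := carry_rounds e.-1 (nth gp0 s 0 :: s1) in
  pret (addsh (sw l.-1) c).

(** * Inference generation *)

Definition lift_share (w : nat) (v : share 1) : proto (share w) :=
  let t1 : share w := ((v.1 : nat)%:R, 0) in
  let t2 : share w := (0, (v.2 : nat)%:R) in
  let* t := mulsh t1 t2 in
  pret (subsh (addsh t1 t2) (scalesh 2 t)).

(* Edges, as (decision node, goes right?), from the root to the node n of the
   given depth. *)
Fixpoint path_to (depth n : nat) : seq (nat * bool) :=
  if depth is d.+1 then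
    let j := n.-1./2 in rcons (path_to d j) (j, ~~ odd n)
  else [::].

Definition edge (w : nat) (vs : seq (share w)) (jb : nat * bool) : share w :=
  let v := nth (0, 0) vs jb.1 in
  if jb.2 then v else (1 - v.1, - v.2).

Fixpoint prod_from (w : nat) (a : share w) (s : seq (share w)) : proto (share w) :=
  if s is b :: s' then let* c := mulsh a b in prod_from c s' else pret a.

(* The empty product (a tree of depth 0) is the public constant 1. *)
Definition prodsh (w : nat) (s : seq (share w)) : proto (share w) :=
  if s is a :: s' then prod_from a s' else pret (1, 0).

(** * The protocol; the returned value is the output of the client *)

Definition protocol (ot : ot_protocol) (k : nat) (p : params) (T : dtree p)
    (x : features p) : proto (Zw (plen p)) :=
  let l := plen p in
  let* xs := pmapM (give Client) (tval x) in
  let* ys := pmapM (give Provider) (tval (thr T)) in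
  let* us := pmapM (give Provider) (tval (leafval T)) in
  let* ids := pmapM (fun i : 'I_(pfeat p) => give Provider ((i : nat)%:R : Zw l))
                    (tval (sel T)) in
  let* sx := pmapM (select ot k (pfeat p) xs) ids in
  let* bs := pmapM (fun a => msb_share (e := plog p) (subsh a.1 a.2))
                   (zip sx ys) in
  let* vs := pmapM (lift_share l) bs in
  let* gs := pmapM (fun z => prodsh [seq edge vs e
                                    | e <- path_to (pdepth p) (pnode p + z)])
                   (iota 0 (pleaf p)) in
  let* gus := pmapM (fun a => mulsh a.1 a.2) (zip gs us) in
  let u := foldl (@addsh l) (0, 0) gus in
  let* _ := send l Client u.1 in
  let* _ := send l Client u.2 in
  pret (u.1 + u.2).

(* The servers have no input of their own. *)
Definition party_input (p : params) (P : party) (T : dtree p) (x : features p)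
    : seq bits :=
  match P with
  | Provider => enc_dtree T
  | Client => enc_features x
  | Server _ => [::]
  end.

Definition view (ot : ot_protocol) (k : nat) (p : params) (P : party)
    (a : dtree p * features p) : dist (seq bits) :=
  view_of P (party_input P a.1 a.2) (protocol ot k a.1 a.2).

(* Main.v *)
(** The provider receives nothing, so its view is its input and its sharing coins.

    In the view of a server every opened value of a multiplication is masked by the
    triple, whatever the operands; the phases after feature selection therefore
    contribute uniform strings only.  In a feature selection the index is masked by
    the rotation of the other server and the entry obtained by OT by the additive
    mask of the other server, so that the inputs and the outputs of the two OTs seen
    by a server can be sampled without secrets.  The OT transcripts are replaced by
    simulated ones one after the other: the rest of the view does not depend on a
    transcript given the inputs of that OT, so by averaging it can be hardwired into
    a non-uniform distinguisher for OT.  There are polynomially many OTs.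

    The two messages of the client are a fresh sharing of the result, since the last
    multiplications re-randomize the shares.  The result is T(x) unless an OT fails or
    an index wraps around modulo 2^l, which happens with negligible probability.

    The simulators are WHILE programs assembled from straight-line blocks with calls
    and from bounded loops, for which polynomial cost is shown once and for all. *)

Require Import Defs.
From mathcomp Require Import all_boot all_order all_algebra.
From mathcomp Require Import zify ring lra.
From Stdlib Require Import Classical ClassicalEpsilon FunctionalExtensionality.

Set Implicit Arguments.
Unset Strict Implicit.
Unset Printing Implicit Defensive.

Import Order.TTheory GRing.Theory Num.Theory.
Local Open Scope ring_scope.

(** * Expectations over coin-tossing trees *)

(** The order of quantifiers in [cind] shapes the server case: the negligible bound is chosen after
    the advice, whereas a hybrid argument meets, for every [k], many contexts around the transcript
    being replaced. Hence indistinguishability is first strengthened to one bound valid for all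
    contexts of polynomial size, and every size involved (transcripts, outputs of simulators, whole
    views) has to be bounded for certain, not merely on average.

    All distributions are compared through expectations of rational-valued tests. A one-time pad is
    then a bijective change of variable in an average, independent draws commute as nested averages
    do, and a hybrid step exchanges one factor of a nested average while the other draws are held
    fixed. The simulation of the provider is exact. A server loses two terms per decision node, one
    for each OT it takes part in. The client loses only through failure events, so there a union
    bound takes the place of the hybrids. *)

Fixpoint ex (A : Type) (m : dist A) (f : A -> rat) : rat :=
  match m with
  | Ret a => f a
  | Toss g => (ex (g true) f + ex (g false) f) / 2
  end.

Fixpoint sure (A : Type) (m : dist A) (P : A -> Prop) : Prop :=
  match m with
  | Ret a => P a
  | Toss g => sure (g true) P /\ sure (g false) P
  end.

(** Testing with rational-valued functions makes sense on types without decidable equality too, such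
    as stores. *)
Definition deq (A : Type) (m m' : dist A) : Prop := forall f, ex m f = ex m' f.

Lemma prE (A : Type) (m : dist A) (E : pred A) : pr m E = ex m (fun a => (E a)%:R).
Proof. by elim: m => //= g IH; rewrite !IH. Qed.

Lemma ex_bind (A B : Type) (m : dist A) (f : A -> dist B) (h : B -> rat) :
  ex (bind m f) h = ex m (fun a => ex (f a) h).
Proof. by elim: m => //= g IH; rewrite !IH. Qed.

Lemma eq_ex (A : Type) (m : dist A) (f g : A -> rat) : f =1 g -> ex m f = ex m g.
Proof. by move=> e; elim: m => //= h IH; rewrite !IH. Qed.

Lemma ex_const (A : Type) (m : dist A) (c : rat) : ex m (fun => c) = c.
Proof. by elim: m => //= g IH; rewrite !IH; field. Qed.

Lemma exB (A : Type) (m : dist A) (f g : A -> rat) :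
  ex m f - ex m g = ex m (fun a => f a - g a).
Proof. by elim: m => //= h IH; rewrite -!IH; field. Qed.

Lemma exD (A : Type) (m : dist A) (f g : A -> rat) :
  ex m (fun a => f a + g a) = ex m f + ex m g.
Proof. by elim: m => //= h IH; rewrite !IH; field. Qed.

Lemma ex_le_sure (A : Type) (m : dist A) (f g : A -> rat) :
  sure m (fun a => f a <= g a) -> ex m f <= ex m g.
Proof.
elim: m => //= h IH [/IH h1 /IH h2].
by apply: ler_wpM2r; [rewrite invr_ge0 | apply: lerD].
Qed.

Lemma sureT (A : Type) (m : dist A) (P : A -> Prop) : (forall a, P a) -> sure m P.
Proof. by move=> e; elim: m => //= h IH; split. Qed.

Lemma sure_mp (A : Type) (m : dist A) (P Q : A -> Prop) :
  sure m (fun a => P a -> Q a) -> sure m P -> sure m Q.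
Proof. elim: m => [a|h IH] /=; first by auto. by move=> [p q] [/(IH _ p) ? /(IH _ q)]. Qed.

Lemma sure_imp (A : Type) (m : dist A) (P Q : A -> Prop) :
  (forall a, P a -> Q a) -> sure m P -> sure m Q.
Proof. by move=> e; apply: sure_mp; apply: sureT. Qed.

Lemma sure_and (A : Type) (m : dist A) (P Q : A -> Prop) :
  sure m P -> sure m Q -> sure m (fun a => P a /\ Q a).
Proof.
move=> p; apply: sure_mp; move: p; apply: sure_imp => a; by split.
Qed.

Lemma sure_bind (A B : Type) (m : dist A) (f : A -> dist B) (P : B -> Prop) :
  sure (bind m f) P <-> sure m (fun a => sure (f a) P).
Proof. by elim: m => //= g IH; split => -[/IH ? /IH]. Qed.

Lemma eq_ex_sure (A : Type) (m : dist A) (f g : A -> rat) :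
  sure m (fun a => f a = g a) -> ex m f = ex m g.
Proof. by elim: m => //= h IH [/IH -> /IH ->]. Qed.

Lemma ex_le (A : Type) (m : dist A) (f g : A -> rat) :
  (forall a, f a <= g a) -> ex m f <= ex m g.
Proof. by move=> e; apply: ex_le_sure; apply: sureT. Qed.

Lemma ex_abs (A : Type) (m : dist A) (f : A -> rat) :
  `|ex m f| <= ex m (fun a => `|f a|).
Proof.
elim: m => //= h IH; rewrite normrM (@ger0_norm _ 2^-1) ?invr_ge0 //.
apply: ler_wpM2r; first by rewrite invr_ge0.
by apply: (le_trans (ler_normD _ _)); apply: lerD.
Qed.

Lemma ex_dist_le (A : Type) (m : dist A) (f g : A -> rat) (e : rat) :
  sure m (fun a => `|f a - g a| <= e) -> `|ex m f - ex m g| <= e.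
Proof.
move=> h; rewrite exB; apply: (le_trans (ex_abs _ _)).
by rewrite -[leRHS](ex_const m); apply: ex_le_sure.
Qed.

Lemma exMr (A : Type) (m : dist A) (f : A -> rat) (c : rat) :
  ex m (fun a => f a * c) = ex m f * c.
Proof. by elim: m => //= h IH; rewrite !IH; field. Qed.

Lemma exC (A B : Type) (m : dist A) (m' : dist B) (f : A -> B -> rat) :
  ex m (fun a => ex m' (fun b => f a b)) = ex m' (fun b => ex m (fun a => f a b)).
Proof. by elim: m => //= g IH; rewrite !IH -exD -exMr. Qed.

Lemma ex01 (A : Type) (m : dist A) (f : A -> rat) :
  (forall a, 0 <= f a <= 1) -> 0 <= ex m f <= 1.
Proof.
move=> h; apply/andP; split.
  by rewrite -[leLHS](ex_const m); apply: ex_le => a; case/andP: (h a).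
by rewrite -[leRHS](ex_const m); apply: ex_le => a; case/andP: (h a).
Qed.

Lemma pr01 (A : Type) (m : dist A) (E : pred A) : 0 <= pr m E <= 1.
Proof. by rewrite prE; apply: ex01 => a; case: (E a). Qed.

Lemma sure_pr (A : Type) (m : dist A) (E : pred A) : pr m E = 1 <-> sure m E.
Proof.
elim: m => [a|h IH] /=; first by case: (E a); split.
have /andP[a0 a1] := pr01 (h true) E; have /andP[b0 b1] := pr01 (h false) E.
split; last by case=> /IH -> /IH ->.
by move=> e; split; apply/IH; lra.
Qed.

Definition ind (P : Prop) : rat := if excluded_middle_informative P then 1 else 0.

Lemma indT (P : Prop) : P -> ind P = 1.
Proof. by rewrite /ind; case: excluded_middle_informative. Qed.

Lemma indF (P : Prop) : ~ P -> ind P = 0.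
Proof. by rewrite /ind; case: excluded_middle_informative. Qed.

Lemma ind01 (P : Prop) : 0 <= ind P <= 1.
Proof. by rewrite /ind; case: excluded_middle_informative. Qed.

(** An average of values at most 1 equals 1 only if every value does. Written as an expectation,
    [sure] becomes invariant under [deq]. *)
Lemma sure_ex (A : Type) (m : dist A) (P : A -> Prop) :
  sure m P <-> ex m (fun a => ind (P a)) = 1.
Proof.
elim: m => [a|h IH] /=.
  by rewrite /ind; case: excluded_middle_informative => p; split.
have /andP[a0 a1] := ex01 (h true) (fun a => ind01 (P a)).
have /andP[b0 b1] := ex01 (h false) (fun a => ind01 (P a)).
split; first by case=> /IH -> /IH ->.
by move=> e; split; apply/IH; lra.
Qed.

Lemma sure_deq (A : Type) (m m' : dist A) (P : A -> Prop) :
  deq m m' -> sure m P -> sure m' P.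
Proof. by move=> e /sure_ex h; apply/sure_ex; rewrite -e. Qed.

(** The tree has finitely many leaves, so the largest witness works at all of them. *)
Lemma sure_exists_nat (A : Type) (m : dist A) (P : A -> nat -> Prop) :
  sure m (fun a => exists n, P a n) -> (forall a n n', (n <= n')%N -> P a n -> P a n') ->
  exists n, sure m (fun a => P a n).
Proof.
move=> + mono; elim: m => [a|h IH] //= [/IH[n1 h1] /IH[n2 h2]].
exists (maxn n1 n2); split; [move: h1|move: h2]; apply: sure_imp => a; apply: mono.
  exact: leq_maxl.
exact: leq_maxr.
Qed.

Fixpoint outcomes (A : Type) (m : dist A) : seq A :=
  match m with Ret a => [:: a] | Toss g => outcomes (g true) ++ outcomes (g false) end.

Lemma sure_outcomes (A : eqType) (m : dist A) (s : seq A) :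
  {subset outcomes m <= s} -> sure m (fun a => a \in s).
Proof.
elim: m => [a|h IH] /= sub; first by apply: sub; rewrite inE.
by split; apply: IH => a ha; apply: sub; rewrite mem_cat ha ?orbT.
Qed.

Lemma ex_pr1 (A : eqType) (m : dist A) (s : seq A) (f : A -> rat) :
  uniq s -> sure m (fun a => a \in s) ->
  ex m f = \sum_(x <- s) f x * pr m (pred1 x).
Proof.
move=> us; elim: m => [a ha|h IH [h1 h2]] /=.
  rewrite (bigD1_seq a) //= eqxx mulr1 big1 ?addr0 // => b ba.
  by rewrite eq_sym (negPf ba) mulr0.
rewrite IH // IH // -big_split /= mulr_suml; apply: eq_bigr => x _.
by rewrite -mulrDr mulrA.
Qed.

(** [ppt] speaks of events only; as supports are finite, an expectation is a finite sum over point
    probabilities. *)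
Lemma pr_deq (A : eqType) (m m' : dist A) :
  (forall E : pred A, pr m E = pr m' E) -> deq m m'.
Proof.
move=> e f; set s := undup (outcomes m ++ outcomes m').
have us : uniq s by apply: undup_uniq.
have h : sure m (fun a => a \in s).
  by apply: sure_outcomes => a ha; rewrite mem_undup mem_cat ha.
have h' : sure m' (fun a => a \in s).
  by apply: sure_outcomes => a ha; rewrite mem_undup mem_cat ha orbT.
by rewrite (ex_pr1 _ us h) (ex_pr1 _ us h'); apply: eq_bigr => x _; rewrite e.
Qed.

Lemma bind_eq_sure (A B : Type) (m : dist A) (f g : A -> dist B) :
  sure m (fun a => f a = g a) -> bind m f = bind m g.
Proof.
elim: m => //= h IH [/IH h1 /IH h2]; congr Toss.
by apply: functional_extensionality => -[].
Qed.

Lemma bind_ret (A : Type) (m : dist A) : bind m (@Ret A) = m.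
Proof. by elim: m => //= h IH; congr Toss; apply: functional_extensionality. Qed.

Lemma bindA (A B C : Type) (m : dist A) (f : A -> dist B) (g : B -> dist C) :
  bind (bind m f) g = bind m (fun a => bind (f a) g).
Proof. by elim: m => //= h IH; congr Toss; apply: functional_extensionality. Qed.

(** * Polynomial bounds *)

Lemma pb_le (f g : nat -> nat) :
  (forall n, f n <= g n)%N -> poly_bounded g -> poly_bounded f.
Proof. by move=> h [c hc]; exists c => k; apply: leq_trans (hc k). Qed.

Lemma pb_pow (f : nat -> nat) :
  (exists a b c, forall n, f n <= a * n ^ b + c)%N -> poly_bounded f.
Proof.
move=> [a [b [c h]]]; exists (a + b + c + a * 2 ^ b)%N => -[|[|n]].
- apply: (leq_trans (h 0%N)); case: b {h} => [|b]; first by rewrite !expn0; lia.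
  by rewrite exp0n // muln0; lia.
- by apply: (leq_trans (h 1%N)); rewrite !exp1n; nia.
- apply: (leq_trans (h n.+2)).
  (* For a base of at least 2 the leading coefficient is absorbed into the exponent. *)
  have h1 : (a <= n.+2 ^ a)%N by apply: ltnW; apply: ltn_expl.
  have h2 : (a * n.+2 ^ b <= n.+2 ^ (a + b))%N by rewrite expnD leq_mul2r h1 orbT.
  have h3 : (n.+2 ^ (a + b) <= n.+2 ^ (a + b + c + a * 2 ^ b))%N.
    by rewrite leq_exp2l //; lia.
  lia.
Qed.

Lemma pb_const (c : nat) : poly_bounded (fun => c).
Proof. by exists c => n; lia. Qed.

Lemma pb_id : poly_bounded id.
Proof. by exists 1%N => n; lia. Qed.

(** With base [n.+1] every power is positive, so sums and products of such bounds need no case on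
    [n = 0]. *)
Lemma pb_form (f : nat -> nat) :
  poly_bounded f -> exists c, forall n, (f n <= (n.+1 ^ c) * c.+1)%N.
Proof.
move=> [c h]; exists c => n; apply: (leq_trans (h n)).
have h1 : (n ^ c <= n.+1 ^ c)%N by case: c {h} => // c; rewrite leq_exp2r.
have h2 : (0 < n.+1 ^ c)%N by rewrite expn_gt0.
nia.
Qed.

Lemma pb_of_form (f : nat -> nat) (a c : nat) :
  (forall n, f n <= (n.+1 ^ c) * a)%N -> poly_bounded f.
Proof.
move=> h; apply: pb_pow; exists (2 ^ c * a)%N, c, a => -[|n].
  by apply: (leq_trans (h 0%N)); rewrite exp1n; lia.
apply: (leq_trans (h n.+1)); rewrite [(2 ^ c * a * _)%N]mulnAC -expnMn.
apply: leq_trans (leq_addr _ _); rewrite leq_mul2r; apply/orP; right.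
by case: c {h} => // c; rewrite leq_exp2r; lia.
Qed.

Lemma pb_mul (f g : nat -> nat) :
  poly_bounded f -> poly_bounded g -> poly_bounded (fun n => f n * g n)%N.
Proof.
move=> /pb_form[a ha] /pb_form[b hb]; apply: (@pb_of_form _ (a.+1 * b.+1) (a + b)) => n.
by rewrite expnD mulnACA; apply: leq_mul.
Qed.

Lemma pb_add (f g : nat -> nat) :
  poly_bounded f -> poly_bounded g -> poly_bounded (fun n => f n + g n)%N.
Proof.
move=> /pb_form[a ha] /pb_form[b hb]; apply: (@pb_of_form _ (a.+1 + b.+1) (a + b)) => n.
rewrite mulnDr; apply: leq_add.
  apply: (leq_trans (ha n)); rewrite leq_mul2r; apply/orP; right.
  by rewrite leq_pexp2l ?leq_addr.
apply: (leq_trans (hb n)); rewrite leq_mul2r; apply/orP; right.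
by rewrite leq_pexp2l ?leq_addl.
Qed.

Lemma pb_exp (f : nat -> nat) (c : nat) :
  poly_bounded f -> poly_bounded (fun n => f n ^ c)%N.
Proof.
move=> h; elim: c => [|c IH]; first exact: pb_const.
by apply: (@pb_le _ (fun n => f n * f n ^ c)%N); [move=> n; rewrite expnS|apply: pb_mul].
Qed.

Lemma pb_comp (f g : nat -> nat) :
  poly_bounded f -> poly_bounded g -> poly_bounded (fun n => f (g n)).
Proof.
move=> [c h] hg; apply: (@pb_le _ (fun n => g n ^ c + c)%N) => //.
by apply: pb_add; [apply: pb_exp|apply: pb_const].
Qed.

Definition mono (f : nat -> nat) := forall m n, (m <= n -> f m <= f n)%N.

Lemma pb_mono (f : nat -> nat) : poly_bounded f ->
  exists g, [/\ poly_bounded g, mono g & forall n, (f n <= g n)%N].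
Proof.
move=> [c h]; exists (fun n => n ^ c + c)%N; split => //; first by exists c.
by move=> m n mn; rewrite leq_add2r; case: c {h} => // c; rewrite leq_exp2r.
Qed.

(** * Program logic for the WHILE language *)

Definition seqc (t : nat) (m : dist (option (store * nat)))
    (f : store -> dist (option (store * nat))) : dist (option (store * nat)) :=
  bind m (fun o : option (store * nat) =>
    if o is Some (st1, t1) then
      bind (f st1) (fun o' : option (store * nat) =>
        if o' is Some (st2, t2) then Ret (Some (st2, (t + t1 + t2)%N))
        else Ret None)
    else Ret None).

Definition skip (st : store) : dist (option (store * nat)) := Ret (Some (st, 0%N)).

Lemma exec_S (n : nat) (c : cmd) (st : store) : exec n.+1 c st =
  match c with
  | CAssign r e => Ret (Some (upd st r (eval st e).1, (eval st e).2.+1))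
  | CFlip r => Toss (fun b => Ret (Some (upd st r [:: [:: b]], 1%N)))
  | CSeq c1 c2 => seqc 1%N (exec n c1 st) (exec n c2)
  | CIf e c1 c2 =>
      seqc (eval st e).2.+1
        (if numv (eval st e).1 == 0%N then exec n c2 st else exec n c1 st) skip
  | CWhile e c1 =>
      if numv (eval st e).1 == 0%N then Ret (Some (st, (eval st e).2.+1))
      else seqc (eval st e).2.+1 (exec n c1 st) (exec n c)
  | CCall r c1 e =>
      seqc (eval st e).2.+1 (exec n c1 (load (eval st e).1))
        (fun st1 => Ret (Some (upd st r (st1 0%N), (vsize (st1 0%N)).+1)))
  end.
Proof. by case: c. Qed.

Definition finished (o : option (store * nat)) : Prop := o <> None.

Lemma seqc_finished t m f : sure (seqc t m f) finished ->
  sure m (fun o => if o is Some (st, _) then sure (f st) finished else False).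
Proof.
move/sure_bind; apply: sure_imp => -[[st u]|] /=; last by case.
by move/sure_bind; apply: sure_imp => -[[st2 t2]|] //=.
Qed.

Lemma seqc_eq t m f m' f' : sure (seqc t m f) finished ->
  (sure m finished -> m' = m) -> (forall st, sure (f st) finished -> f' st = f st) ->
  seqc t m' f' = seqc t m f.
Proof.
move=> /seqc_finished h em ef; rewrite /seqc em; last first.
  by move: h; apply: sure_imp => -[].
by apply: bind_eq_sure; move: h; apply: sure_imp => -[[st u] /ef ->|].
Qed.

(** Fuel only limits recursion: once all branches have finished, more of it leaves even the tree
    unchanged. *)
Lemma exec_mono n c st : sure (exec n c st) finished -> exec n.+1 c st = exec n c st.
Proof.
elim: n c st => [|n IH] c st //; rewrite (exec_S n) (exec_S n.+1).
case: c => // [c1 c2|e c1 c2|e c1|r c1 e] h.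
- by apply: seqc_eq h _ _; [apply: IH|move=> st1; apply: IH].
- by apply: seqc_eq h _ _ => //; case: ifP => _; apply: IH.
- by move: h; case: ifP => // _ h; apply: seqc_eq h _ _; [apply: IH|move=> st1; apply: IH].
- by apply: seqc_eq h _ _ => //; apply: IH.
Qed.

Lemma exec_leq n n' c st :
  (n <= n')%N -> sure (exec n c st) finished -> exec n' c st = exec n c st.
Proof.
move=> /subnKC <-; elim: (n' - n)%N => [|d IH] h; first by rewrite addn0.
by rewrite addnS exec_mono IH.
Qed.

Definition halts (T : nat) (o : option (store * nat)) : Prop :=
  if o is Some (_, t) then (t <= T)%N else False.

Definition outv (f : store -> rat) (o : option (store * nat)) : rat :=
  if o is Some (st, _) then f st else 0.

Definition res (m : dist (option (store * nat))) (D : dist store) (T : nat) : Prop :=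
  sure m (halts T) /\ forall f, ex m (outv f) = ex D f.

(** Asking for all sufficiently large amounts of fuel lets subprograms be run with a common one. *)
Definition runs (c : cmd) (st : store) (D : dist store) (T : nat) : Prop :=
  exists n0, forall n, (n0 <= n)%N -> res (exec n c st) D T.

Lemma res_leq m D T T' : (T <= T')%N -> res m D T -> res m D T'.
Proof.
move=> l [h e]; split => //; move: h; apply: sure_imp => -[[st t]|] //= h.
exact: leq_trans l.
Qed.

Lemma runs_leq c st D T T' : (T <= T')%N -> runs c st D T -> runs c st D T'.
Proof. by move=> l [n0 h]; exists n0 => n /h; apply: res_leq. Qed.

Lemma res_sure m D T (P : store -> Prop) : res m D T -> sure D P ->
  sure m (fun o => if o is Some (st, t) then P st /\ (t <= T)%N else False).
Proof.
move=> [h e] /sure_ex; rewrite -e => hp.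
suff : sure m (fun o => if o is Some (st, t) then P st else True).
  by move/(sure_and h); apply: sure_imp => -[[st t]|] [].
apply/sure_ex; rewrite -hp; apply: eq_ex_sure; move: h.
by apply: sure_imp => -[[st t]|].
Qed.

Lemma res_seqc t m f D1 D2 T1 T2 : res m D1 T1 ->
  sure D1 (fun st => res (f st) (D2 st) T2) ->
  res (seqc t m f) (bind D1 D2) (t + T1 + T2).
Proof.
move=> h1 h2; have h := res_sure h1 h2; split.
  apply/sure_bind; move: h; apply: sure_imp => -[[st u]|] //= [[h _] hu].
  apply/sure_bind; move: h; apply: sure_imp => -[[st2 u2]|] //= hu2.
  by rewrite -!addnA leq_add2l leq_add.
move=> g; rewrite /seqc !ex_bind -h1.2; apply: eq_ex_sure.
move: h; apply: sure_imp => -[[st u]|] //= [[_ e] _].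
rewrite -e ex_bind; apply: eq_ex => -[[st2 u2]|] //=.
Qed.

(** Each outcome of [D1] comes with its own fuel, and there are finitely many outcomes. *)
Lemma runs_unif D1 c D2 T : sure D1 (fun st => runs c st (D2 st) T) ->
  exists n0, sure D1 (fun st => forall n, (n0 <= n)%N -> res (exec n c st) (D2 st) T).
Proof.
move=> h; apply: sure_exists_nat => // st n n' l h' k hk.
by apply: h'; apply: leq_trans hk.
Qed.

Lemma res_ret st t : res (Ret (Some (st, t))) (Ret st) t.
Proof. by split=> //=. Qed.

Lemma runs_assign r e st :
  runs (CAssign r e) st (Ret (upd st r (eval st e).1)) (eval st e).2.+1.
Proof. by exists 1%N => -[|n] // _; rewrite exec_S; apply: res_ret. Qed.

Lemma runs_flip r st :
  runs (CFlip r) st (Toss (fun b => Ret (upd st r [:: [:: b]]))) 1.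
Proof. by exists 1%N => -[|n] // _; rewrite exec_S; split => //=. Qed.

Lemma runs_seq c1 c2 st D1 D2 T1 T2 : runs c1 st D1 T1 ->
  sure D1 (fun st1 => runs c2 st1 (D2 st1) T2) ->
  runs (CSeq c1 c2) st (bind D1 D2) (1 + T1 + T2).
Proof.
move=> [n1 h1] /runs_unif[n2 h2]; exists (n1 + n2).+1 => -[|n] // l.
rewrite exec_S; apply: res_seqc; first by apply: h1; lia.
by move: h2; apply: sure_imp => st1; apply; lia.
Qed.

Lemma runs_while_end e c st : numv (eval st e).1 = 0%N ->
  runs (CWhile e c) st (Ret st) (eval st e).2.+1.
Proof. by move=> h; exists 1%N => -[|n] // _; rewrite exec_S h; apply: res_ret. Qed.

Lemma runs_while_step e c st D1 D2 T1 T2 : numv (eval st e).1 <> 0%N ->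
  runs c st D1 T1 -> sure D1 (fun st1 => runs (CWhile e c) st1 (D2 st1) T2) ->
  runs (CWhile e c) st (bind D1 D2) ((eval st e).2.+1 + T1 + T2).
Proof.
move=> /eqP/negPf h [n1 h1] /runs_unif[n2 h2]; exists (n1 + n2).+1 => -[|n] // l.
rewrite exec_S h; apply: res_seqc; first by apply: h1; lia.
by move: h2; apply: sure_imp => st1; apply; lia.
Qed.

Lemma runs_call r c e st D T Z : runs c (load (eval st e).1) D T ->
  sure D (fun st1 => vsize (st1 0%N) <= Z)%N ->
  runs (CCall r c e) st (bind D (fun st1 => Ret (upd st r (st1 0%N))))
    ((eval st e).2.+1 + T + Z.+1).
Proof.
move=> [n1 h1] hz; exists n1.+1 => -[|n] // l.
rewrite exec_S; apply: res_seqc; first exact: h1.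
by move: hz; apply: sure_imp => st1 h; apply: res_leq (res_ret _ _).
Qed.

Lemma vsize_cat u v : vsize (u ++ v) = (vsize u + vsize v)%N.
Proof. by rewrite /vsize map_cat sumn_cat. Qed.

Lemma eval_size st e : (vsize (eval st e).1 <= (eval st e).2)%N.
Proof. by case: e => //= *; lia. Qed.

(* A step of cost 1 can create an entry of size 2 (a coin), hence the factor 2. *)
Lemma exec_size n c st X : (forall r, vsize (st r) <= X)%N ->
  sure (exec n c st) (fun o => if o is Some (st', t)
                               then forall r, (vsize (st' r) <= X + t.*2)%N else True).
Proof.
elim: n c st X => [|n IH] c st X hX //; rewrite exec_S.
have hupd r (v : seq bits) Y : (vsize v <= Y)%N -> (X <= Y)%N ->
    forall r', (vsize (upd st r v r') <= Y)%N.
  by move=> hv hY r'; rewrite /upd; case: ifP => // _; apply: leq_trans (hX _) hY.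
have hs t m f : sure m (fun o => if o is Some (st', t)
       then forall r, (vsize (st' r) <= X + t.*2)%N else True) ->
     (forall st1 X1, (forall r, vsize (st1 r) <= X1)%N ->
        sure (f st1) (fun o => if o is Some (st', t)
                               then forall r, (vsize (st' r) <= X1 + t.*2)%N else True)) ->
     sure (seqc t m f) (fun o => if o is Some (st', t)
                               then forall r, (vsize (st' r) <= X + t.*2)%N else True).
  move=> hm hf; apply/sure_bind; move: hm; apply: sure_imp => -[[st1 t1]|] // h1.
  apply/sure_bind; move: (hf _ _ h1); apply: sure_imp => -[[st2 t2]|] //= h2 r.
  by apply: leq_trans (h2 r) _; lia.
case: c => [r e|r|c1 c2|e c1 c2|e c1|r c1 e].
- move=> /=; apply: hupd; last by lia.
  by apply: leq_trans (eval_size _ _) _; lia.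
- by split => /=; apply: hupd; rewrite /vsize /=; lia.
- by apply: hs => [|st1 X1 h1]; apply: IH.
- apply: hs => [|st1 X1 h1]; first by case: ifP => _; apply: IH.
  by move=> r /=; rewrite addn0.
- case: ifP => _; first by move=> r /=; apply: leq_trans (hX r) _; lia.
  by apply: hs => [|st1 X1 h1]; apply: IH.
- apply/sure_bind; have h := IH c1 (load (eval st e).1) (vsize (eval st e).1) _.
  apply: sure_imp (h _) => [[[st1 t1]|] //= h1|].
    by apply: hupd => //; lia.
  by move=> r'; rewrite /load; case: ifP.
Qed.

(** * Closure properties of [ppt] *)

Lemma runs_ppt c p S : poly_bounded p ->
  (forall v, exists2 D, runs c (load v) D (p (vsize v)) &
                        deq (bind D (fun st => Ret (st 0%N))) (S v)) -> ppt S.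
Proof.
move=> [a pa] h; exists c, a => v; have [D [n hn] e] := h v.
exists n; have [h1 h2] := hn n (leqnn _); split.
  apply/sure_pr; move: h1; apply: sure_imp => -[[st t]|] //= ht.
  exact: leq_trans (pa _).
by move=> E; rewrite !prE -e ex_bind -h2; apply: eq_ex => -[[st t]|].
Qed.

(** The bound [q] on the output comes from the cost: by [exec_size] a store grows by at most twice
    the cost. *)
Lemma ppt_runs S : ppt S -> exists c p q,
  [/\ poly_bounded p, mono p, poly_bounded q & mono q] /\
  forall v, exists2 D, runs c (load v) D (p (vsize v)) &
    deq (bind D (fun st => Ret (st 0%N))) (S v) /\
    sure (S v) (fun w => vsize w <= q (vsize v))%N.
Proof.
move=> [c [a h]].
have hp : poly_bounded (fun n => n ^ a + a)%N by exists a.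
have [p [pb_p mono_p le_p]] := pb_mono hp.
have hq : poly_bounded (fun n => n + (p n).*2)%N.
  apply: pb_add; first exact: pb_id.
  by apply: (@pb_le _ (fun n => p n + p n)%N); [move=> n; lia|apply: pb_add].
have [q [pb_q mono_q le_q]] := pb_mono hq.
exists c, p, q; split => // v.
have [n /= [h1 h2]] := h v; have {}h1 := (sure_pr _ _).1 h1.
have fin : sure (exec n c (load v)) finished.
  by move: h1; apply: sure_imp => -[[]|].
(* The default [load v] is never taken, since every branch finishes. *)
pose D := bind (exec n c (load v)) (fun o => Ret (if o is Some (st, _) then st else load v)).
have resD : res (exec n c (load v)) D (p (vsize v)).
  split; first by move: h1; apply: sure_imp => -[[st t]|] //= ht; apply: leq_trans (le_p _).
  move=> f; rewrite ex_bind; apply: eq_ex_sure; move: fin; by apply: sure_imp => -[[]|].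
have eD : deq (bind D (fun st => Ret (st 0%N))) (S v).
  apply: pr_deq => E; rewrite -h2 !prE ex_bind -resD.2.
  by apply: eq_ex => -[[]|].
exists D; first by exists n => n' l; rewrite (exec_leq l fin).
split => //; apply: sure_deq eD _; apply/sure_bind; apply/sure_bind.
have hs := @exec_size n c (load v) (vsize v) _.
have {hs} : sure (exec n c (load v)) (fun o => if o is Some (st', t)
   then forall r, (vsize (st' r) <= vsize v + t.*2)%N else True).
  by apply: hs => r; rewrite /load; case: ifP.
move/(sure_and resD.1); apply: sure_imp => -[[st t]|] /= [] // ht hst.
by apply: leq_trans (hst _) _; apply: leq_trans (le_q _); lia.
Qed.

Lemma ppt_size S : ppt S -> exists q, [/\ poly_bounded q, mono q &
  forall v, sure (S v) (fun w => vsize w <= q (vsize v))%N].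
Proof. by case/ppt_runs => c [p [q [[_ _ pb mq] h]]]; exists q; split=> // v; case: (h v) => D _ []. Qed.

Lemma ppt_ext S S' : (forall v, deq (S v) (S' v)) -> ppt S -> ppt S'.
Proof.
move=> e [c [a h]]; exists c, a => v; have [n [h1 h2]] := h v; exists n.
by split => // E; rewrite h2 !prE e.
Qed.

(* Encodings of numbers, and sizes of the values of expressions *)
Local Close Scope ring_scope.

Arguments encn : simpl never.
Arguments bin : simpl never.

Lemma size_encn w n : size (encn w n) = w.
Proof. by rewrite size_mkseq. Qed.

Lemma encnS w n : encn w.+1 n = odd n :: encn w n./2.
Proof.
rewrite /encn /mkseq /= expn0 divn1; congr cons.
rewrite -[1%N]addn0 iotaDl -map_comp; apply: eq_map => q /=.
by rewrite expnS divnMA divn2.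
Qed.

Lemma num_encn w n : num (encn w n) = (n %% 2 ^ w)%N.
Proof.
elim: w n => [|w IH] n; first by rewrite modn1.
rewrite encnS /= IH; set r := (n./2 %% 2 ^ w)%N.
have hr : (r < 2 ^ w)%N by rewrite ltn_mod expn_gt0.
have -> : n = (n./2 %/ 2 ^ w * 2 ^ w.+1 + (odd n + r.*2))%N.
  rewrite -{1}(odd_double_half n) {1}(divn_eq n./2 (2 ^ w)) -/r expnS; lia.
rewrite modnMDl modn_small; last by rewrite expnS; case: (odd n) => /=; lia.
by rewrite !oddD oddM expnS oddM /= andbF odd_double addbF; case: (odd n).
Qed.

Lemma num_lt s : (num s < 2 ^ size s)%N.
Proof. by elim: s => //= b s IH; rewrite expnS; case: b; lia. Qed.

Lemma encn_num s : encn (size s) (num s) = s.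
Proof.
elim: s => //= b s IH; rewrite encnS oddD odd_double addbF.
by rewrite halfD odd_double andbF add0n doubleK; case: b; rewrite /= add0n IH.
Qed.

Lemma num_bin n : numv (bin n) = n.
Proof. by rewrite -[numv _]/(num (encn _ n)) num_encn modn_small // trunc_log_ltn. Qed.

Lemma encn_mod w n : encn w (n %% 2 ^ w) = encn w n.
Proof. by have := encn_num (encn w n); rewrite size_encn num_encn. Qed.

Lemma encn0 w : encn w 0 = nseq w false.
Proof. by elim: w => // w IH; rewrite encnS /= IH. Qed.

Lemma vsize1 s : vsize [:: s] = (size s).+1.
Proof. by rewrite /vsize /= addn0. Qed.

Lemma vsize_bin n s : (n < 2 ^ s)%N -> (vsize (bin n) <= s + 2)%N.
Proof.
move=> h; rewrite vsize1 size_encn.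
case: n h => [|n] h; first by rewrite trunc_log0; lia.
suff : (trunc_log 2 n.+1 < s)%N by lia.
by rewrite -(@ltn_exp2l 2) //; apply: leq_ltn_trans h; apply: trunc_logP.
Qed.

Lemma bin_cat n v : bin n ++ v = str (bin n) :: v.
Proof. by []. Qed.

#[local] Opaque bin.

Lemma vsize_bin_le n : (vsize (bin n) <= n + 2)%N.
Proof. by apply: vsize_bin; apply: ltn_expl. Qed.

Lemma size_str v : (size (str v) <= vsize v)%N.
Proof. by case: v => //= s v; rewrite /vsize /=; lia. Qed.

Lemma size_vsize v : (size v <= vsize v)%N.
Proof. by elim: v => //= s v IH; rewrite /vsize /= -/(vsize v); lia. Qed.

Lemma vsize_take n v : (vsize (take n v) <= vsize v)%N.
Proof. by rewrite -{2}(cat_take_drop n v) vsize_cat leq_addr. Qed.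

Lemma vsize_drop n v : (vsize (drop n v) <= vsize v)%N.
Proof. by rewrite -{2}(cat_take_drop n v) vsize_cat leq_addl. Qed.

Lemma vsize_behead v : (vsize (behead v) <= vsize v)%N.
Proof. by rewrite -drop1 vsize_drop. Qed.

Lemma sem1_size o v : (vsize (sem1 o v) <= vsize v + 2)%N.
Proof.
case: o; rewrite [sem1 _ _]/=.
- by rewrite vsize1; have := size_str v; lia.
- by have := vsize_behead v; lia.
- by apply: leq_trans (vsize_bin_le _) _; have := size_vsize v; lia.
- by apply: leq_trans (vsize_bin_le _) _; have := size_str v; lia.
Qed.

Lemma numv_lt v : (numv v < 2 ^ vsize v)%N.
Proof. by apply: leq_trans (num_lt _) _; rewrite leq_exp2l // size_str. Qed.

Definition is_tobits (o : op2) : bool := if o is OToBits then true else false.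

(** Arithmetic results are measured through their values: an operand of size [s] is below [2 ^ s],
    so even a product has a length additive in the operands. *)
Lemma sem2_size o u v :
  (vsize (sem2 o u v) <= numv u * is_tobits o + vsize u + vsize v + 4)%N.
Proof.
have su := size_str u; have sv := size_str v.
have nu := numv_lt u; have nv := numv_lt v.
have le_u n : (n <= numv u -> vsize (bin n) <= vsize u + 2)%N.
  by move=> h; apply: vsize_bin; apply: leq_ltn_trans nu.
have le_v n : (n <= numv v -> vsize (bin n) <= vsize v + 2)%N.
  by move=> h; apply: vsize_bin; apply: leq_ltn_trans nv.
have du : (2 ^ vsize u > 0)%N by rewrite expn_gt0.
have dv : (2 ^ vsize v > 0)%N by rewrite expn_gt0.
case: o; rewrite [sem2 _ _ _]/= [is_tobits _]/= ?muln0 ?muln1 ?add0n.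
- by rewrite vsize_cat; lia.
- by have := vsize_take (numv u) v; lia.
- by have := vsize_drop (numv u) v; lia.
- by rewrite vsize1 size_cat; lia.
- by rewrite vsize1; have := size_take_min (numv u) (str v); lia.
- by rewrite vsize1 size_drop; lia.
- by rewrite vsize1 size_encn; lia.
- apply: (leq_trans (@vsize_bin _ (vsize u + vsize v + 1) _)); last by lia.
  by rewrite !expnD; nia.
- by apply: leq_trans (le_u _ (leq_subr _ _)) _; lia.
- apply: (leq_trans (@vsize_bin _ (vsize u + vsize v) _)); last by lia.
  by rewrite !expnD; nia.
- by apply: leq_trans (le_u _ (leq_div _ _)) _; lia.
- by apply: leq_trans (le_u _ (leq_mod _ _)) _; lia.
- by rewrite vsize1 /=; lia.
Qed.

(* [OToBits] is the only operation whose result can be exponentially longer than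
   its operands; [small] guards its first argument. *)
Fixpoint small (e : expr) : bool :=
  match e with
  | ELit _ | EApp1 OCount _ | EApp1 OLength _ => true
  | EApp2 (OAdd | OSub | OMul | ODiv | OMod) a b => small a && small b
  | _ => false
  end.

Fixpoint poly_expr (e : expr) : bool :=
  match e with
  | EVar _ | ELit _ => true
  | EApp1 _ a => poly_expr a
  | EApp2 o a b => [&& poly_expr a, poly_expr b & is_tobits o ==> small a]
  end.

Definition bounded (X : nat) (st : store) := forall r, (vsize (st r) <= X)%N.

(** Such an expression combines lengths, counts and literals arithmetically, so its value, and not
    just its length, is polynomial in the size of the store. *)
Lemma small_bound e p : small e ->
  (forall st X, bounded X st -> (eval st e).2 <= p X)%N ->
  poly_bounded p -> exists2 q, poly_bounded q &
  forall st X, bounded X st -> (numv (eval st e).1 <= q X)%N.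
Proof.
elim: e p => [r|v|o a IHa|o a IHa b IHb] p //=.
- by move=> _ _ _; exists (fun=> numv v) => //; apply: pb_const.
- move=> so h pb; exists p => // st X hX; apply: leq_trans (h _ _ hX).
  have h1 := eval_size st a.
  case: o so {h} => // _ /=; rewrite num_bin.
    by have := size_vsize (eval st a).1; lia.
  by have := size_str (eval st a).1; lia.
- move=> so h pb.
  have {so} so : small a && small b /\
      match o with OAdd | OSub | OMul | ODiv | OMod => True | _ => False end.
    by case: o so {h}.
  case: so => /andP[sa sb] ho.
  have [|q1 pb1 h1] := IHa p sa _ pb.
    by move=> st X hX; apply: leq_trans (h _ _ hX); lia.
  have [|q2 pb2 h2] := IHb p sb _ pb.
    by move=> st X hX; apply: leq_trans (h _ _ hX); lia.
  exists (fun n => q1 n + q2 n + q1 n * q2 n)%N.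
    by apply: pb_add; [apply: pb_add|apply: pb_mul].
  move=> st X hX; have {h1} := h1 _ _ hX; have {h2} := h2 _ _ hX.
  set u := eval st a; set v := eval st b => hv hu.
  case: o ho {h} => // _ /=; rewrite num_bin.
  + by lia.
  + by lia.
  + by have := leq_mul hu hv; lia.
  + by have := leq_div (numv u.1) (numv v.1); lia.
  + by have := leq_mod (numv u.1) (numv v.1); lia.
Qed.

Lemma eval_bound e : poly_expr e -> exists p, [/\ poly_bounded p, mono p &
  forall st X, bounded X st -> ((eval st e).2 <= p X)%N].
Proof.
move=> h; suff [p pb hp] : exists2 p, poly_bounded p &
    forall st X, bounded X st -> ((eval st e).2 <= p X)%N.
  have [q [pbq mq le]] := pb_mono pb; exists q; split=> // st X hX.
  exact: leq_trans (hp _ _ hX) (le _).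
elim: e h => [r|v|o a IHa|o a IHa b IHb] /=.
- move=> _; exists (fun n => n + 1)%N; first by apply: pb_add; [apply: pb_id|apply: pb_const].
  by move=> st X hX; have := hX r; lia.
- by move=> _; exists (fun=> (vsize v).+1) => //; apply: pb_const.
- move=> /IHa[p pb hp]; exists (fun n => p n + p n + 3)%N.
    by apply: pb_add; [apply: pb_add|apply: pb_const].
  move=> st X hX; have := hp _ _ hX; have := sem1_size o (eval st a).1.
  by have := eval_size st a; lia.
- move=> /and3P[/IHa[p pb hp] /IHb[q pbq hq] ho].
  have [s pbs hs] : exists2 s, poly_bounded s & forall st X, bounded X st ->
      (numv (eval st a).1 * is_tobits o <= s X)%N.
    case: (is_tobits o) ho => /= [sa|_].
      have [s pbs hs] := small_bound sa hp pb; exists s => // st X hX.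
      by rewrite muln1; apply: hs.
    by exists (fun=> 0%N); [apply: pb_const|move=> *; rewrite muln0].
  exists (fun n => s n + p n + p n + q n + q n + 5)%N.
    by do ![apply: pb_add|apply: pb_const|done].
  move=> st X hX; have := hp _ _ hX; have := hq _ _ hX; have := hs _ _ hX.
  have := sem2_size o (eval st a).1 (eval st b).1.
  have := eval_size st a; have := eval_size st b.
  lia.
Qed.

(** * Straight-line blocks with calls *)

Inductive stmt :=
| SLet of nat & expr
| SCall of nat & (seq bits -> dist (seq bits)) & expr.

Fixpoint block (ss : seq stmt) (st : store) : dist store :=
  match ss with
  | [::] => Ret st
  | SLet r e :: ss' => block ss' (upd st r (eval st e).1)
  | SCall r f e :: ss' => bind (f (eval st e).1) (fun w => block ss' (upd st r w))
  end.

Fixpoint block_ok (ss : seq stmt) : Prop :=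
  match ss with
  | [::] => True
  | SLet _ e :: ss' => poly_expr e /\ block_ok ss'
  | SCall _ f e :: ss' => [/\ poly_expr e, ppt f & block_ok ss']
  end.

Lemma runs_deq c st D D' T : deq D D' -> runs c st D T -> runs c st D' T.
Proof.
move=> e [n0 h]; exists n0 => n /h [h1 h2]; split => // f.
by rewrite h2 e.
Qed.

Lemma bounded_upd X Y st r v :
  bounded X st -> (X <= Y)%N -> (vsize v <= Y)%N -> bounded Y (upd st r v).
Proof.
move=> hX l hv r'; rewrite /upd; case: ifP => // _; exact: leq_trans l.
Qed.

Lemma deq_bind (A B : Type) (m m' : dist A) (f : A -> dist B) :
  deq m m' -> deq (bind m f) (bind m' f).
Proof. by move=> e h; rewrite !ex_bind e. Qed.

Lemma ppt_call S : ppt S -> exists c p q,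
  [/\ poly_bounded p, mono p, poly_bounded q & mono q] /\
  forall st r e X, ((eval st e).2 <= X)%N ->
    runs (CCall r c e) st (bind (S (eval st e).1) (fun w => Ret (upd st r w))) (p X)
    /\ sure (S (eval st e).1) (fun w => vsize w <= q X)%N.
Proof.
case/ppt_runs => c [p [q [[pbp mp pbq mq] h]]].
exists c, (fun n => n + 1 + p n + (q n + 1))%N, q; split.
  split => //.
    by do ![apply: pb_add|apply: pb_const|apply: pb_id|done].
  by move=> m n l; rewrite !leq_add ?mp ?mq.
move=> st r e X hX.
have hv : (vsize (eval st e).1 <= X)%N by apply: leq_trans (eval_size _ _) hX.
have [D hD [eD sD]] := h (eval st e).1.
have {}sD : sure (S (eval st e).1) (fun w => vsize w <= q X)%N.
  by move: sD; apply: sure_imp => w hw; apply: leq_trans (mq _ _ hv).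
split => //.
have sD' : sure D (fun st1 => vsize (st1 0%N) <= q X)%N.
  apply/(sure_bind D (fun st => Ret (st 0%N)) (fun w => vsize w <= q X)%N).
  by apply: sure_deq sD => f; rewrite eD.
apply: runs_deq (runs_leq _ (runs_call r hD sD')); last first.
  by have := mp _ _ hv; lia.
move=> f; rewrite -(deq_bind _ eD) bindA !ex_bind.
by apply: eq_ex => st1.
Qed.

Lemma block_runs ss : block_ok ss -> exists c p,
  [/\ poly_bounded p, mono p & forall st X, bounded X st -> runs c st (block ss st) (p X)].
Proof.
elim: ss => [_|[r e|r f e] ss IH] /=.
- have [p [pb mp hp]] := @eval_bound (EVar 0) isT.
  (* The language has no skip; copying a register onto itself replaces it. *)
  exists (CAssign 0 (EVar 0)), (fun n => p n + 1)%N; split.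
  + by apply: pb_add => //; apply: pb_const.
  + by move=> m n l; rewrite leq_add ?mp.
  + move=> st X hX; have := runs_assign 0 (EVar 0) st.
    have -> : upd st 0 (eval st (EVar 0)).1 = st.
      by apply: functional_extensionality => r; rewrite /upd; case: eqP => [->|].
    by apply: runs_leq; have := hp _ _ hX; lia.
- move=> [/eval_bound[q [pbq mq hq]] /IH[c [p [pb mp hp]]]].
  exists (CSeq (CAssign r e) c), (fun n => q n + 2 + p (n + q n))%N; split.
  + apply: pb_add; first by apply: pb_add => //; apply: pb_const.
    by apply: (pb_comp pb); apply: pb_add => //; apply: pb_id.
  + by move=> m n l; rewrite !leq_add ?mq ?mp // leq_add ?mq.
  + move=> st X hX.
    have h2 : runs c (upd st r (eval st e).1) (block ss (upd st r (eval st e).1))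
                (p (X + q X)%N).
      apply: hp. apply: (@bounded_upd X _ st _ _ hX); first by lia.
      by have := hq _ _ hX; have := eval_size st e; lia.
    have := runs_seq (runs_assign r e st) (D2 := block ss) (c2 := c) (T2 := p (X + q X)%N) h2.
    by apply: runs_leq; have := hq _ _ hX; lia.
- move=> [/eval_bound[q [pbq mq hq]] /ppt_call[c1 [p1 [q1 [[pb1 m1 pq1 mq1] h1]]]]].
  move=> /IH[c [p [pb mp hp]]].
  exists (CSeq (CCall r c1 e) c), (fun n => 1 + p1 (q n) + p (n + q1 (q n)))%N; split.
  + apply: pb_add; first by apply: pb_add; [apply: pb_const|apply: pb_comp].
    by apply: (pb_comp pb); apply: pb_add; [apply: pb_id|apply: pb_comp].
  + move=> m n l; have l' := mq _ _ l; apply: leq_add; first by rewrite leq_add2l m1.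
    by apply: mp; apply: leq_add => //; apply: mq1.
  + move=> st X hX; have [hr hs] := h1 st r e (q X) (hq _ _ hX).
    have -> : bind (f (eval st e).1) (fun w => block ss (upd st r w)) =
        bind (bind (f (eval st e).1) (fun w => Ret (upd st r w))) (block ss).
      by rewrite bindA.
    apply: runs_seq hr _; apply/sure_bind; move: hs; apply: sure_imp => w hw /=.
    by apply: hp; apply: (@bounded_upd X _ st _ _ hX); lia.
Qed.

Lemma bounded_load v : bounded (vsize v) (load v).
Proof. by move=> r; rewrite /load; case: ifP. Qed.

Lemma ppt_block ss : block_ok ss ->
  ppt (fun v => bind (block ss (load v)) (fun st => Ret (st 0%N))).
Proof.
move=> /block_runs[c [p [pb mp h]]]; apply: (runs_ppt pb) => v.
by exists (block ss (load v)) => //; apply: h; apply: bounded_load.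
Qed.

Lemma ppt_coin : ppt (fun=> Toss (fun b => Ret [:: [:: b]])).
Proof.
apply: (@runs_ppt (CFlip 0) (fun=> 1%N)); first exact: pb_const.
by move=> v; exists (Toss (fun b => Ret (upd (load v) 0 [:: [:: b]]))); first exact: runs_flip.
Qed.

(** * Bounded loops *)

(* [n] counts the remaining iterations; the size of [ctx] tells where to split
   [ctx ++ acc]. *)
Definition pack (n : nat) (ctx acc : seq bits) : seq bits :=
  bin n ++ bin (size ctx) ++ ctx ++ acc.

Fixpoint loop (f : seq bits -> dist (seq bits)) (ctx : seq bits) (n : nat)
    (acc : seq bits) : dist (seq bits) :=
  if n is n'.+1 then bind (f (pack n' ctx acc)) (loop f ctx n') else Ret acc.

(** A round may enlarge the accumulator only by an amount that does not depend on the accumulator; a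
    factor of two per round would already be exponential. *)
Lemma loop_size f g :
  (forall n ctx acc, sure (f (pack n ctx acc))
     (fun w => vsize w <= vsize acc + g (n + vsize ctx))%N) -> mono g ->
  forall ctx n acc N, (n <= N)%N -> sure (loop f ctx n acc)
     (fun w => vsize w <= vsize acc + n * g (N + vsize ctx))%N.
Proof.
move=> hf mg ctx; elim=> [|n IH] acc N hN /=; first by rewrite addn0.
apply/sure_bind; apply: sure_imp (hf n ctx acc) => w hw.
apply: sure_imp (IH w N _) => [w' hw'|]; last by lia.
apply: leq_trans hw' _; rewrite mulSn addnA leq_add2r; apply: leq_trans hw _.
by rewrite leq_add2l mg //; lia.
Qed.

(** Register 1 holds the context, 2 the counter and 3 the accumulator. *)
Definition loop_body (c : cmd) : cmd :=
  CSeq (CAssign 2 (EApp2 OSub (EVar 2) (ELit [:: [:: true]])))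
    (CCall 3 c (EApp2 OCat (EVar 2)
       (EApp2 OCat (EApp1 OCount (EVar 1)) (EApp2 OCat (EVar 1) (EVar 3))))).

Definition loop_cmd (c : cmd) : cmd :=
  CSeq (CAssign 1 (EApp1 OBehead (EVar 0)))
  (CSeq (CAssign 2 (EApp1 OLength (EVar 0)))
  (CSeq (CAssign 3 (ELit [::]))
  (CSeq (CWhile (EVar 2) (loop_body c)) (CAssign 0 (EVar 3))))).

Lemma ppt_loop f (h : nat -> nat) : ppt f -> poly_bounded h ->
  (forall n ctx acc, sure (f (pack n ctx acc))
     (fun w => vsize w <= vsize acc + h (n + vsize ctx))%N) ->
  ppt (fun v => loop f (behead v) (size (str v)) [::]).
Proof.
move=> /ppt_call[c [p [q [[pb mp _ _] hc]]]] /pb_mono[g [pbg mg le_g]] hf.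
have hfg n ctx acc : sure (f (pack n ctx acc))
     (fun w => vsize w <= vsize acc + g (n + vsize ctx))%N.
  by apply: sure_imp (hf n ctx acc) => w hw; apply: leq_trans hw _; rewrite leq_add2l.
have [body_t [pbb mb hb]] := @eval_bound (EApp2 OCat (EVar 2)
       (EApp2 OCat (EApp1 OCount (EVar 1)) (EApp2 OCat (EVar 1) (EVar 3)))) isT.
pose it Y := (Y + 3 + (3 + (Y + 10 + p (body_t (Y + 4)))))%N.
(* [M] caps the accumulator through all remaining rounds, so that one cost [it] is valid for each of
   them. *)
have while_runs N X : (N <= X)%N -> forall n st,
    st 2 = bin n -> (n <= N)%N -> (vsize (st 1) <= X)%N -> (vsize (st 0) <= X)%N ->
    (forall r, (3 < r)%N -> vsize (st r) <= X)%N ->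
    forall M, (vsize (st 3) + n * g (N + X) <= M)%N ->
    exists2 D, runs (CWhile (EVar 2) (loop_body c)) st D (n * it (M + X + N + 2) + (N + 4)) &
      deq (bind D (fun st' => Ret (st' 3%N))) (loop f (st 1%N) n (st 3%N)).
  move=> hNX; elim=> [|n IH] st h2 hn h1 h0 hr M hM.
    exists (Ret st) => //; apply: runs_leq (runs_while_end _ _).
      by rewrite /= h2; have := vsize_bin_le 0; lia.
    by rewrite /= h2 num_bin.
  pose st2 := upd st 2 (bin n).
  pose Y := (M + X + N + 2)%N.
  have Mn : (n * g (N + X) <= M)%N by rewrite mulSn in hM; lia.
  have bd : bounded (Y + 4) st2.
    move=> r; rewrite /st2 /upd; case: eqP => [_|r2].
      by apply: leq_trans (vsize_bin_le _) _; rewrite /Y; lia.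
    case: r r2 => [|[|[|[|r]]]] // _; rewrite /Y; [lia|lia|lia|].
    by have := hr r.+4 isT; lia.
  have hexp := hb _ _ bd; have [] := hc st2 3%N _ _ hexp.
  set ST := eval st2 _; have -> : ST.1 = pack n (st 1%N) (st 3%N).
    by rewrite /ST /= /st2 /upd /=.
  move=> run3 _; have hw := hfg n (st 1%N) (st 3%N).
  have run2 : runs (loop_body c) st
      (bind (f (pack n (st 1%N) (st 3%N))) (fun w => Ret (upd st2 3 w)))
      (3 + (Y + 10 + p (body_t (Y + 4)))).
    have hs2 : upd st 2 (eval st (EApp2 OSub (EVar 2) (ELit [:: [:: true]]))).1 = st2.
      rewrite /= h2; have := num_bin n.+1; rewrite /numv => ->.
      by rewrite /= subn1.
    have := runs_assign 2 (EApp2 OSub (EVar 2) (ELit [:: [:: true]])) st.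
    rewrite hs2 => hA; have := runs_seq hA (D2 := fun st2 => _) (c2 := CCall _ _ _) run3.
    apply: runs_leq; rewrite [eval _ _]/= h2.
    have -> : (numv (bin n.+1) - numv [:: [:: true]])%N = n.
      by rewrite num_bin /= subn1.
    have := vsize_bin_le n.+1; have := vsize_bin_le n.
    have -> : vsize [:: [:: true]] = 2 by [].
    rewrite /Y; move: (p _) => P.
    by rewrite [(_, _).2]/=; lia.
  pose good st' := [/\ st' 2%N = bin n, st' 1%N = st 1%N, st' 0%N = st 0%N,
    (forall r, (3 < r)%N -> st' r = st r) &
    (vsize (st' 3%N) <= vsize (st 3%N) + g (N + X))%N].
  have gd : sure (bind (f (pack n (st 1%N) (st 3%N))) (fun w => Ret (upd st2 3 w))) good.
    apply/sure_bind; move: hw; apply: sure_imp => w hw /=; split => //.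
    - by move=> [|[|[|[|r]]]].
    - rewrite /upd /=; apply: leq_trans hw _; rewrite leq_add2l; apply: mg; lia.
  have ihs st' : good st' -> exists D, runs (CWhile (EVar 2) (loop_body c)) st' D
        (n * it Y + (N + 4)) /\
      deq (bind D (fun st' => Ret (st' 3%N))) (loop f (st' 1%N) n (st' 3%N)).
    move=> [e2 e1 e0 er e3].
    have [|||r hr3||D hD eD] := IH st' e2 _ _ _ _ M.
    - by lia.
    - by rewrite e1.
    - by rewrite e0.
    - by rewrite er // hr.
    - by rewrite mulSn in hM; lia.
    - by exists D.
  (* The induction hypothesis gives a distribution for each good store separately; choice makes it a
     continuation for [bind]. *)
  pose D2 st' := if excluded_middle_informative (good st') is left hg
                 then proj1_sig (constructive_indefinite_description _ (ihs st' hg))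
                 else Ret st'.
  have hD2 st' : good st' -> runs (CWhile (EVar 2) (loop_body c)) st' (D2 st')
        (n * it Y + (N + 4)) /\
      deq (bind (D2 st') (fun st' => Ret (st' 3%N))) (loop f (st' 1%N) n (st' 3%N)).
    rewrite /D2; case: excluded_middle_informative => // hg _.
    by case: constructive_indefinite_description.
  exists (bind (bind (f (pack n (st 1%N) (st 3%N))) (fun w => Ret (upd st2 3 w))) D2).
    have nz : numv (eval st (EVar 2)).1 <> 0%N by rewrite /= h2 num_bin.
    apply: runs_leq (runs_while_step nz run2 (T2 := (n * it Y + (N + 4))%N) _).
      rewrite /= h2 -/Y mulSn /it; have := vsize_bin_le n.+1.
      by rewrite /Y; lia.
    by move: gd; apply: sure_imp => st' /hD2[].
  move=> k; rewrite !ex_bind; apply: eq_ex_sure.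
  move/sure_bind: gd; apply: sure_imp => w /= gw.
  by have [_ /(_ k)] := hD2 _ gw; rewrite ex_bind => ->.
(* The accumulator starts empty and at most [X] rounds add at most [g (X + X)] each. *)
pose Mb X := (X * g (X + X))%N.
apply: (@runs_ppt (loop_cmd c) (fun X => (X + X + 4) + (X + X + 10)
   + 10 + (X * it (Mb X + X + X + 2) + (X + 4)) + (Mb X + X + 10))%N).
  rewrite /it /Mb.
  have pbX2 : poly_bounded (fun X => X + X)%N by apply: pb_add; apply: pb_id.
  have pgX : poly_bounded (fun X => g (X + X)%N) by apply: pb_comp.
  have pM : poly_bounded (fun X => X * g (X + X))%N by apply: pb_mul => //; apply: pb_id.
  have pY : poly_bounded (fun X => X * g (X + X) + X + X + 2)%N.
    by do ![apply: pb_add|apply: pb_const|apply: pb_id|done].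
  have pp : poly_bounded (fun X => p (body_t (X * g (X + X) + X + X + 2 + 4)))%N.
    by apply: (pb_comp pb); apply: (pb_comp pbb); apply: pb_add => //; apply: pb_const.
  by do ![apply: pb_add|apply: pb_const|apply: pb_id|apply: pb_mul|done].
move=> v; set X := vsize v; set N := size (str v).
have NX : (N <= X)%N by apply: size_str.
pose st1 := upd (load v) 1 (behead v).
pose st2 := upd st1 2 (bin N).
pose st3 := upd st2 3 [::].
have [||||r hr||D hD eD] := while_runs X X (leqnn X) N st3 _ _ _ _ _ (Mb X).
- by [].
- by [].
- exact: vsize_behead.
- by [].
- by case: r hr => [|[|[|[|r]]]].
- rewrite /st3 /upd /= add0n /Mb; by apply: leq_mul.
have sD : sure D (fun st => vsize (st 3%N) <= Mb X)%N.
  apply/(sure_bind D (fun st => Ret (st 3%N)) (fun w => vsize w <= Mb X)%N).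
  apply: (sure_deq (m := loop f (behead v) N [::])); first by move=> k; rewrite eD.
  apply: sure_imp (@loop_size f g hfg mg (behead v) N [::] N (leqnn _)) => w hw.
  apply: leq_trans hw _; rewrite add0n; apply: leq_mul => //; apply: mg.
  by have := vsize_behead v; lia.
exists (bind D (fun st => Ret (upd st 0 (st 3%N)))); last first.
  by move=> k; rewrite -eD !ex_bind; apply: eq_ex.
apply: runs_leq; last first.
  apply: (runs_seq (runs_assign _ _ _) (D2 := fun=> _)).
  apply: (runs_seq (runs_assign _ _ _) (D2 := fun=> _)).
  apply: (runs_seq (runs_assign _ _ _) (D2 := fun=> _)).
  apply: (runs_seq hD (T2 := (Mb X + 2)%N)).
  move: sD; apply: sure_imp => st hst; apply: runs_leq (runs_assign _ _ _).
  by rewrite /=; lia.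
rewrite /= /load /upd /= -/N; have := vsize_bin_le N; have := vsize_behead v.
rewrite -/X; have -> : vsize [::] = 0 by [].
have := leq_mul NX (leqnn (it (Mb X + X + X + 2))); lia.
Qed.

#[local] Transparent bin.

(** * Building blocks of the simulators *)

Definition vcat (V W : dist (seq bits)) : dist (seq bits) :=
  bind V (fun s => bind W (fun t => Ret (s ++ t))).

Fixpoint rep (V : dist (seq bits)) (n : nat) : dist (seq bits) :=
  if n is n'.+1 then vcat V (rep V n') else Ret [::].

Definition coins (l : nat) : dist (seq bits) := bind (tosses l) (fun s => Ret [:: s]).

Notation hd e := (EApp1 OHead e).
Notation tl e := (EApp1 OBehead e).
Notation len e := (EApp1 OLength e).
Notation "e1 ';;' e2" := (EApp2 OCat e1 e2) (at level 60, right associativity).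
Notation lit1 := (ELit [:: [:: true]]).

(* The context and the accumulator inside [pack n ctx acc], held in register 0 *)
Notation ctx_expr := (EApp2 OTakeL (hd (tl (EVar 0))) (tl (tl (EVar 0)))).
Notation acc_expr := (EApp2 ODropL (hd (tl (EVar 0))) (tl (tl (EVar 0)))).

Lemma pack_ctx n ctx acc st : st 0 = pack n ctx acc -> (eval st ctx_expr).1 = ctx.
Proof.
move=> /= ->; rewrite /pack !bin_cat /= -[numv _]/(numv (bin (size ctx))) num_bin.
by rewrite take_size_cat.
Qed.

Lemma pack_acc n ctx acc st : st 0 = pack n ctx acc -> (eval st acc_expr).1 = acc.
Proof.
move=> /= ->; rewrite /pack !bin_cat /= -[numv _]/(numv (bin (size ctx))) num_bin.
by rewrite drop_size_cat.
Qed.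

Lemma ppt_coins : ppt (fun v => coins (size (str v))).
Proof.
pose body := [:: SCall 1 (fun=> Toss (fun b => Ret [:: [:: b]])) (EVar 0);
                 SLet 0 (EApp2 OJoin acc_expr (EVar 1))].
pose f v := bind (block body (load v)) (fun st => Ret (st 0)).
have pf : ppt f by apply: ppt_block; split => //; apply: ppt_coin.
have fE n ctx acc :
    f (pack n ctx acc) = Toss (fun b => Ret [:: rcons (str acc) b]).
  rewrite /f /body; cbn [block bind]; congr Toss.
  apply: functional_extensionality => b; cbn [block bind].
  rewrite -cats1; congr Ret; set st := upd (load _) _ _.
  have h : st 0 = pack n ctx acc by [].
  by rewrite -[in RHS](pack_acc h).
pose ss := [:: SCall 0 (fun v => loop f (behead v) (size (str v)) [::]) (EVar 0);
               SLet 0 (hd (EVar 0))].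
apply: (@ppt_ext (fun v => bind (block ss (load v)) (fun st => Ret (st 0)))); last first.
  apply: ppt_block; split => //; apply: (ppt_loop (h := fun=> 2) pf); first exact: pb_const.
  move=> n ctx acc; rewrite fE.
  have h b : vsize [:: rcons (str acc) b] <= vsize acc + 2.
    by rewrite vsize1 size_rcons; have := size_str acc; lia.
  by split; apply: h.
move=> v g; rewrite /ss /coins; cbn [block]; rewrite !ex_bind.
rewrite -[(eval (load v) (EVar 0)).1]/v.
(* The prefix tossed so far is generalized, and the test reads only the string being built. *)
suff h n acc (F : bits -> rat) :
    ex (loop f (behead v) n acc) (fun w => F (str w)) = ex (tosses n) (fun s => F (str acc ++ s)).
  by rewrite (h _ _ (fun s => g [:: s])) /=.
elim: n acc => [|n IH] acc; first by rewrite /= cats0.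
cbn [loop]; rewrite fE; cbn [bind ex tosses]; rewrite !IH !ex_bind /=.
by congr ((_ + _) / _)%R; apply: eq_ex => s; rewrite cat_rcons.
Qed.

Lemma ppt_rep g : ppt g -> ppt (fun v => rep (g (behead v)) (size (str v))).
Proof.
move=> pg.
pose body := [:: SLet 1 ctx_expr; SLet 2 acc_expr; SCall 3 g (EVar 1);
                 SLet 0 (EVar 2 ;; EVar 3)].
pose f v := bind (block body (load v)) (fun st => Ret (st 0)).
have pf : ppt f by apply: ppt_block.
have fE n ctx acc : f (pack n ctx acc) = bind (g ctx) (fun w => Ret (acc ++ w)).
  rewrite /f /body; cbn [block]; rewrite (@pack_ctx n ctx acc) //; set st := upd _ 1 _.
  have h : st 0 = pack n ctx acc by [].
  by rewrite (pack_acc h) bindA.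
have [q [pbq mq hq]] := ppt_size pg.
apply: ppt_ext (ppt_loop (h := q) pf pbq _); last first.
  move=> n ctx acc; rewrite fE; apply/sure_bind; apply: sure_imp (hq ctx) => w hw /=.
  by rewrite vsize_cat leq_add2l; apply: leq_trans hw _; apply: mq; lia.
move=> v F; move: (behead v) (size (str v)) => ctx n.
rewrite -[RHS]/(ex (rep (g ctx) n) (fun w => F ([::] ++ w))).
elim: n [::] => [|n IH] acc; first by rewrite /= cats0.
cbn [loop rep]; rewrite fE /vcat !ex_bind; apply: eq_ex => w; rewrite [RHS]ex_bind; cbn [ex]; rewrite IH.
by apply: eq_ex => w'; rewrite catA.
Qed.

Lemma ppt_ustrs : ppt (fun v => rep (coins (size (str (behead v)))) (size (str v))).
Proof. exact: (ppt_rep ppt_coins). Qed.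

Lemma ppt_zeros : ppt (fun v => Ret (nseq (size (str v)) (nseq (size (str (behead v))) false))).
Proof.
(* The empty string denotes 0, so [OToBits] pads it to any prescribed number of zeros; the
   simulators write numbers in unary in the same way. *)
pose ss := [:: SLet 0 (EApp2 OToBits (len (EVar 0)) (ELit [:: [::]]))].
have ps : ppt (fun v => bind (block ss (load v)) (fun st => Ret (st 0))) by apply: ppt_block.
apply: ppt_ext (ppt_rep ps) => v F; rewrite /ss; cbn [block bind].
rewrite /upd eqxx; rewrite [eval _ _]/= -/(numv _) num_bin encn0 /load /=.
by elim: (size (str v)) F => //= n IH F; rewrite /vcat /= ex_bind -(IH (fun w => F (_ :: w))).
Qed.

(** [ctx] lists the rotation, the mask, [l] and [I] in unary, then [I] zero strings and the [I]
    entries. As [n] rounds are still to come, the current index is [I - n.+1]. Appending the zero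
    strings and cutting to length [I] turns the empty accumulator into the zero array and leaves a
    full one unchanged. *)
Definition scatter_step (ctx : seq bits) (n : nat) (acc : seq bits) : seq bits :=
  let s := num (nth [::] ctx 0) in let r := num (nth [::] ctx 1) in
  let l := size (nth [::] ctx 2) in let I := size (nth [::] ctx 3) in
  let cur := take I (acc ++ take I (drop 4 ctx)) in
  let i := I - n.+1 in
  let t := (i + s) %% 2 ^ l %% I in
  take t cur ++ encn l (num (nth [::] ctx (4 + I + i)) + r) :: drop t.+1 cur.

Definition scatter_prog : seq stmt :=
  let s := hd (EVar 1) in let r := hd (tl (EVar 1)) in
  let L := len (hd (tl (tl (EVar 1)))) in
  let I := len (hd (tl (tl (tl (EVar 1))))) in
  let rest := tl (tl (tl (tl (EVar 1)))) in
  let t := EApp2 OMod (EApp2 OToBits L (EApp2 OAdd (EVar 4) s)) I in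
  [:: SLet 1 ctx_expr; SLet 2 acc_expr;
      SLet 3 (EApp2 OTakeL I (EVar 2 ;; EApp2 OTakeL I rest));
      SLet 4 (EApp2 OSub I (EApp2 OAdd (hd (EVar 0)) lit1));
      SLet 0 (EApp2 OTakeL t (EVar 3)
        ;; EApp2 OToBits L (EApp2 OAdd (hd (EApp2 ODropL (EVar 4) (EApp2 ODropL I rest))) r)
        ;; EApp2 ODropL (EApp2 OAdd t lit1) (EVar 3))].

Lemma scatter_progE n ctx acc :
  bind (block scatter_prog (load (pack n ctx acc))) (fun st => Ret (st 0)) =
  Ret (scatter_step ctx n acc).
Proof.
rewrite /scatter_prog; cbn [block bind]; rewrite (@pack_ctx n ctx acc) //.
set st1 := upd _ 1 _; have h : st1 0 = pack n ctx acc by [].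
rewrite (pack_acc h); congr Ret.
pose I := size (nth [::] ctx 3); pose cur := take I (acc ++ take I (drop 4 ctx)).
set st2 := upd st1 2 acc.
have n1 : numv [:: [:: true]] = 1 by [].
have str_drop k : str (drop k ctx) = nth [::] ctx k by rewrite /str -nth0 nth_drop addn0.
have -> : (eval st2 (EApp2 OTakeL (len (hd (tl (tl (tl (EVar 1))))))
   (EVar 2 ;; EApp2 OTakeL (len (hd (tl (tl (tl (EVar 1)))))) (tl (tl (tl (tl (EVar 1)))))))).1 = cur.
  by rewrite [LHS]/= num_bin /st2 /upd /= -!drop1 !drop_drop -[st1 1]/ctx !str_drop.
set st3 := upd st2 3 cur.
have -> : (eval st3 (EApp2 OSub (len (hd (tl (tl (tl (EVar 1))))))
             (EApp2 OAdd (hd (EVar 0)) lit1))).1 = bin (I - n.+1).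
  rewrite [LHS]/= !num_bin n1 addn1 /st3 /st2 /upd /= -!drop1 !drop_drop -[st1 1]/ctx !str_drop.
  by [].
set st4 := upd st3 4 _.
rewrite {1}/upd eqxx [LHS]/= !num_bin /st4 /upd !(n1, eqxx) /= -!drop1 !drop_drop.
rewrite -[st3 1]/ctx -[st3 3]/cur !str_drop /numv; cbn [str head].
have -> : str ctx = nth [::] ctx 0 by rewrite nth0.
rewrite num_encn addn1 /scatter_step.
have -> : I - n.+1 + size (nth [::] ctx (1 + (1 + 1))) + 1 + (1 + (1 + 1)) = 4 + I + (I - n.+1).
  by rewrite -[size _]/I; lia.
by rewrite addn1.
Qed.

Definition scatter_fun (v : seq bits) : dist (seq bits) :=
  loop (fun v => bind (block scatter_prog (load v)) (fun st => Ret (st 0)))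
       (behead v) (size (str v)) [::].

Lemma ppt_scatter : ppt scatter_fun.
Proof.
apply: (ppt_loop (h := fun n => n + n + 1)).
- exact: ppt_block.
- by do ![apply: pb_add|apply: pb_const|apply: pb_id].
move=> n ctx acc; rewrite scatter_progE; cbn [sure]; rewrite /scatter_step.
set I := size _; set cur := take I _.
have hc : vsize cur <= vsize acc + vsize ctx.
  apply: leq_trans (vsize_take _ _) _; rewrite vsize_cat leq_add2l.
  by apply: leq_trans (vsize_take _ _) _; apply: vsize_drop.
have hl : size (nth [::] ctx 2) <= vsize ctx.
  by rewrite -[2]addn0 -nth_drop nth0; apply: leq_trans (size_str _) (vsize_drop _ _).
move: (_ %% I) (num _ + num _) => t x.
rewrite vsize_cat -cat1s vsize_cat vsize1 size_encn.
have : vsize (take t cur) + vsize (drop t.+1 cur) <= vsize cur.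
  rewrite -{3}(cat_take_drop t cur) vsize_cat leq_add2l -add1n -drop_drop.
  exact: vsize_drop.
lia.
Qed.

(** * The ring Z_(2^w) *)

Section Zw.
Variable w : nat.
Hypothesis w_gt0 : 0 < w.

Lemma expw_gt1 : 1 < 2 ^ w.
Proof. by rewrite -{1}(expn0 2) ltn_exp2l. Qed.

Lemma Zw_lt (a : Zw w) : a < 2 ^ w.
Proof. by have := ltn_ord a; rewrite {2}Zp_cast ?expw_gt1. Qed.

Lemma Zw_natr n : ((n%:R)%R : Zw w) = n %% 2 ^ w :> nat.
Proof. by rewrite val_Zp_nat ?expw_gt1. Qed.

Lemma Zw_add (a b : Zw w) : ((a + b)%R : Zw w) = (a + b) %% 2 ^ w :> nat.
Proof. by rewrite -[in LHS](natr_Zp a) -[in LHS](natr_Zp b) -natrD Zw_natr. Qed.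

Lemma Zw_mod (a : Zw w) : a %% 2 ^ w = a.
Proof. by rewrite modn_small // Zw_lt. Qed.

Lemma num_enc (a : Zw w) : num (enc w a) = a.
Proof. by rewrite num_encn Zw_mod. Qed.

Lemma decK s : size s = w -> enc w (dec w s) = s.
Proof. by move=> h; rewrite /enc /dec Zw_natr encn_mod -{1}h encn_num. Qed.

Lemma enc_add (a b : Zw w) : enc w (a + b)%R = encn w (a + b).
Proof. by rewrite /enc Zw_add encn_mod. Qed.

Lemma enc_natr n : enc w (n%:R)%R = encn w n.
Proof. by rewrite /enc Zw_natr encn_mod. Qed.

Lemma size_enc (a : Zw w) : size (enc w a) = w.
Proof. exact: size_encn. Qed.

Lemma size_tosses n : sure (tosses n) (fun s => size s = n).
Proof.
elim: n => //= n IH; split; apply/sure_bind; move: IH; apply: sure_imp => s /= -> //.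
Qed.

(** By [decK] raw coins already are encodings of uniform ring elements: the simulators toss strings
    where the protocol draws elements. *)
Lemma coins_unif : deq (coins w) (bind (unif w) (fun a => Ret [:: enc w a])).
Proof.
move=> f; rewrite /coins /unif bindA !ex_bind; apply: eq_ex_sure.
by apply: sure_imp (size_tosses w) => s hs /=; rewrite decK.
Qed.

End Zw.

Section ScatterFun.
Variables (w n : nat) (xs : seq (Zw w)) (s r : Zw w).
Hypotheses (w_gt0 : 0 < w) (size_xs : size xs = n).

Let ctx : seq bits := [:: enc w s; enc w r; nseq w true; nseq n true]
  ++ nseq n (nseq w false) ++ [seq enc w a | a <- xs].

Let put (acc : seq (Zw w)) (i : nat) : seq (Zw w) :=
  set_nth 0%R acc (slot n (i%:R + s)%R) (nth 0%R xs i + r)%R.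

Lemma size_put acc i : size acc = n -> i < n -> size (put acc i) = n.
Proof.
move=> h hi; rewrite size_set_nth h; apply/maxn_idPr.
by rewrite /slot ltn_mod; apply: leq_ltn_trans hi.
Qed.

Lemma scatter_step_put m acc : size acc = n -> m < n ->
  scatter_step ctx m [seq enc w a | a <- acc] = [seq enc w a | a <- put acc (n - m.+1)].
Proof.
move=> h hm; rewrite /scatter_step /ctx [nth _ _ 0]/= [nth _ _ 1]/= [nth _ _ 2]/=.
rewrite [nth _ _ 3]/= !size_nseq take_size_cat ?size_map // num_enc // num_enc //.
have hi : n - m.+1 < n by lia.
rewrite [nth _ _ (4 + _ + _)]/= nth_cat size_nseq ltnNge leq_addr /= addKn.
rewrite (nth_map 0%R) ?size_xs // num_enc //.
have -> : ((n - m.+1 + s) %% 2 ^ w %% n) = slot n (((n - m.+1)%N%:R + s)%R : Zw w).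
  by rewrite /slot Zw_add // Zw_natr // modnDml.
rewrite /put -enc_add //; set t := slot _ _.
have ht : t < n by rewrite /t /slot ltn_mod; apply: leq_ltn_trans hi.
by rewrite set_nthE h ht map_cat map_cons map_take map_drop.
Qed.

Lemma scatter_loop m acc : size acc = n -> m <= n ->
  loop (fun v => bind (block scatter_prog (load v)) (fun st => Ret (st 0))) ctx m
       [seq enc w a | a <- acc] =
  Ret [seq enc w a | a <- foldl put acc (iota (n - m) m)].
Proof.
elim: m acc => [|m IH] acc h hm //; cbn [loop]; rewrite scatter_progE; cbn [bind].
rewrite scatter_step_put // IH; [|by rewrite size_put //; lia|by lia].
have -> : iota (n - m.+1) m.+1 = (n - m.+1) :: iota (n - m) m.
  by rewrite /=; congr (_ :: iota _ _); lia.
by [].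
Qed.

Lemma scatter_funE : scatter_fun (nseq n true :: ctx) = Ret (ot_inS (scatter n xs s r)).
Proof.
rewrite /scatter_fun [behead _]/= [str _]/= size_nseq /scatter /ot_inS.
have e0 : enc w 0%R = nseq w false by rewrite /enc encn0.
have zs : [seq enc w a | a <- nseq n 0%R] = nseq n (nseq w false) by rewrite map_nseq e0.
have [n0|n_gt0] := posnP n; first by rewrite n0.
(* [scatter_loop] starts from a full array; after one round the run from the empty accumulator
   agrees with the run from the zero array. *)
have := @scatter_loop n (nseq n 0%R) (size_nseq _ _) (leqnn _).
rewrite subnn => <-.
have loopn F c acc : loop F c n acc = bind (F (pack n.-1 c acc)) (loop F c n.-1).
  by case: n n_gt0.
rewrite !loopn !scatter_progE; cbn [bind]; congr loop.
rewrite zs /scatter_step.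
have hn : size (nth [::] ctx 3) = n by rewrite /= size_nseq.
have hz : take n (drop 4 ctx) = nseq n (nseq w false).
  by rewrite [drop 4 _]/= drop0 take_size_cat ?size_nseq.
rewrite hn hz.
have -> : take n ([::] ++ nseq n (nseq w false)) = nseq n (nseq w false).
  by rewrite cat0s take_oversize ?size_nseq.
by rewrite take_size_cat ?size_nseq.
Qed.

End ScatterFun.

(** * The simulators *)

Definition coins_fun (v : seq bits) : dist (seq bits) := coins (size (str v)).
Definition ustrs_fun (v : seq bits) : dist (seq bits) :=
  rep (coins (size (str (behead v)))) (size (str v)).
Definition zeros_fun (v : seq bits) : dist (seq bits) :=
  Ret (nseq (size (str v)) (nseq (size (str (behead v))) false)).

Lemma ex_coins w f : 0 < w ->
  ex (coins w) f = ex (unif w) (fun a => f [:: enc w a]).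
Proof. by move=> h; rewrite (coins_unif h) ex_bind. Qed.

Definition block_out (ss : seq stmt) (st : store) : dist (seq bits) :=
  bind (block ss st) (fun st => Ret (st 0)).

Lemma block_out_let r e ss st :
  block_out (SLet r e :: ss) st = block_out ss (upd st r (eval st e).1).
Proof. by []. Qed.

Lemma block_out_call r f e ss st :
  block_out (SCall r f e :: ss) st =
  bind (f (eval st e).1) (fun w => block_out ss (upd st r w)).
Proof. by rewrite /block_out /= bindA. Qed.

Lemma block_out_coins r e ss st g w : 0 < w -> size (str (eval st e).1) = w ->
  ex (block_out (SCall r coins_fun e :: ss) st) g =
  ex (unif w) (fun a => ex (block_out ss (upd st r [:: enc w a])) g).
Proof. by move=> w0 h; rewrite block_out_call ex_bind /coins_fun h ex_coins. Qed.

Lemma block_out_nil st : block_out [::] st = Ret (st 0).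
Proof. by []. Qed.

(** An OT view starts with the input of the OT, one string for the receiver and [n] for the sender,
    and this input is not recorded in the log of the protocol; hence the [drop] here and in
    [sent_part]. *)
Definition recv_part w (r' c : Zw w) (zR : seq bits) : seq bits :=
  [:: enc w r'; enc w (c + r')%R] ++ drop 1 zR.
Definition sent_part w n (a : Zw w) (zS : seq bits) : seq bits :=
  enc w a :: drop n zS.
(** [C_0] is the receiver of the first OT and the sender of the second, [C_1] conversely, whence the
    two orders. The last entry [p] is a message for [C_0] and an own coin for [C_1]. *)
Definition select_view w n (m : bool) (s r r' c a p : Zw w) (zR zS : seq bits) :=
  [:: enc w s; enc w r] ++
  (if m then sent_part n a zS ++ recv_part r' c zR
   else recv_part r' c zR ++ sent_part n a zS) ++ [:: enc w p].

(* What C_m sees in one feature selection, the index being hidden by the uniform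
   [c] and the entry obtained through OT by the uniform [val]. *)
Definition select_sim (SS SR : seq bits -> dist (seq bits)) (m : bool) (k w n : nat)
    (xs : seq (Zw w)) : dist (seq bits) :=
  bind (unif w) (fun s => bind (unif w) (fun r => bind (unif w) (fun r' =>
  bind (unif w) (fun c => bind (unif w) (fun val => bind (unif w) (fun a =>
  bind (unif w) (fun p =>
  bind (SR (ot_public k w n ++ ot_inR w (slot n c) ++ [:: enc w val])) (fun zR =>
  bind (SS (ot_public k w n ++ ot_inS (scatter n xs s r))) (fun zS =>
  Ret (select_view n m s r r' c a p zR zS)))))))))).

(** Registers 1 to 7 hold the uniform draws of [select_sim] in the same order; 8 holds [c + r'], 9
    the slot of [c], 10 the zero strings, 11 the array of [C_m], 12 and 13 the simulated OT views of
    receiver and sender. *)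
Definition select_prog (SS SR : seq bits -> dist (seq bits)) (m : bool) : seq stmt :=
  let K := hd (EVar 0) in let L := hd (tl (EVar 0)) in
  let I := hd (tl (tl (EVar 0))) in let pub := K ;; L ;; I in
  let recv := EVar 3 ;; EVar 8 ;; EApp2 ODropL lit1 (EVar 12) in
  let sent := EVar 6 ;; EApp2 ODropL (len I) (EVar 13) in
  [:: SCall 1 coins_fun L; SCall 2 coins_fun L; SCall 3 coins_fun L;
      SCall 4 coins_fun L; SCall 5 coins_fun L; SCall 6 coins_fun L;
      SCall 7 coins_fun L;
      SLet 8 (EApp2 OToBits (len L) (EApp2 OAdd (EVar 4) (EVar 3)));
      SLet 9 (EApp2 OToBits (len L) (EApp2 OMod (EVar 4) (len I)));
      SCall 10 zeros_fun (I ;; L);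
      SCall 11 scatter_fun (I ;; EVar 1 ;; EVar 2 ;; L ;; I ;; EVar 10 ;; tl (tl (tl (EVar 0))));
      SCall 12 SR (pub ;; EVar 9 ;; EVar 5);
      SCall 13 SS (pub ;; EVar 11);
      SLet 0 (EVar 1 ;; EVar 2 ;; (if m then sent ;; recv else recv ;; sent) ;; EVar 7)].

Definition select_fun SS SR m (v : seq bits) : dist (seq bits) :=
  block_out (select_prog SS SR m) (load v).

Lemma ppt_select SS SR m : ppt SS -> ppt SR -> ppt (select_fun SS SR m).
Proof.
move=> pS pR; apply: ppt_block; rewrite /select_prog /=.
do ![split => //]; try exact: ppt_coins; try exact: ppt_zeros; try exact: ppt_scatter.
by case: m.
Qed.

Lemma select_funE SS SR m k w n (xs : seq (Zw w)) : 0 < w -> size xs = n ->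
  deq (select_fun SS SR m (ot_public k w n ++ [seq enc w a | a <- xs]))
      (select_sim SS SR m k n xs).
Proof.
move=> w0 hxs f; rewrite /select_fun /select_prog /ot_public /select_sim; set v := _ ++ _.
have eL st : st 0 = v -> size (str (eval st (hd (tl (EVar 0)))).1) = w.
  by move=> /= ->; rewrite size_nseq.
rewrite (block_out_coins _ _ _ w0) ?eL // ex_bind; apply: eq_ex => s.
rewrite (block_out_coins _ _ _ w0) ?eL // ex_bind; apply: eq_ex => r.
rewrite (block_out_coins _ _ _ w0) ?eL // ex_bind; apply: eq_ex => r'.
rewrite (block_out_coins _ _ _ w0) ?eL // ex_bind; apply: eq_ex => c.
rewrite (block_out_coins _ _ _ w0) ?eL // ex_bind; apply: eq_ex => val.
rewrite (block_out_coins _ _ _ w0) ?eL // ex_bind; apply: eq_ex => a.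
rewrite (block_out_coins _ _ _ w0) ?eL // ex_bind; apply: eq_ex => p.
rewrite block_out_let; set st7 := upd _ 7 _; set ev := (eval _ _).1.
have -> : ev = [:: enc w (c + r')%R].
  by rewrite /ev [LHS]/= !num_bin /st7 /v /= size_nseq /numv /= !num_enc // enc_add.
rewrite block_out_let; set st8 := upd _ 8 _; set ev' := (eval _ _).1.
have -> : ev' = ot_inR w (slot n c).
  by rewrite /ev' [LHS]/= !num_bin /st8 /st7 /v /= !size_nseq /numv /= !num_enc.
rewrite block_out_call; set st9 := upd _ 9 _; set e10 := (eval _ _).1.
have -> : e10 = [:: nseq n true; nseq w true] by [].
rewrite /zeros_fun [str _]/= [str _]/= !size_nseq; cbn [bind].
rewrite block_out_call; set st10 := upd _ 10 _; set e11 := (eval _ _).1.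
have -> : e11 = nseq n true :: [:: enc w s; enc w r; nseq w true; nseq n true]
  ++ nseq n (nseq w false) ++ [seq enc w a | a <- xs] by [].
rewrite scatter_funE //; cbn [bind].
rewrite block_out_call; set st11 := upd _ 11 _; set e12 := (eval _ _).1.
have -> : e12 = ot_public k w n ++ ot_inR w (slot n c) ++ [:: enc w val] by [].
rewrite !ex_bind; apply: eq_ex => zR.
rewrite block_out_call; set st12 := upd _ 12 _; set e13 := (eval _ _).1.
have -> : e13 = ot_public k w n ++ ot_inS (scatter n xs s r) by [].
rewrite !ex_bind; apply: eq_ex => zS.
rewrite block_out_let block_out_nil; congr f; rewrite /upd eqxx.
have hn : numv (bin (size (str [:: nseq n true]))) = n by rewrite num_bin /= size_nseq.
by case: m; rewrite [LHS]/= -/(numv _) num_bin /= size_nseq ?catA.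
Qed.

Lemma ex_ustrs n w f : ex (ustrs_fun (nseq n false :: [:: nseq w true])) f =
  ex (rep (coins w) n) f.
Proof. by rewrite /ustrs_fun /= !size_nseq. Qed.

Definition provider_prog : seq stmt :=
  let Z := len (hd (tl (tl (tl (EVar 0))))) in let J := EApp2 OSub Z lit1 in
  [:: SCall 1 ustrs_fun (EApp2 OToBits (EApp2 OAdd J (EApp2 OAdd Z J)) (ELit [::])
                         ;; hd (tl (EVar 0)));
      SLet 0 (tl (tl (tl (tl (EVar 0)))) ;; EVar 1)].

Lemma ppt_provider : ppt (fun v => block_out provider_prog (load v)).
Proof. by apply: ppt_block; do ![split => //]; apply: ppt_ustrs. Qed.

Lemma encn_nil n v : numv v = 0 -> encn n (numv v) = nseq n false.
Proof. by move=> ->; rewrite encn0. Qed.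

Lemma provider_progE k p v : deq
  (block_out provider_prog (load (public k p ++ v)))
  (vcat (Ret v) (rep (coins (plen p)) ((pleaf p).-1 + (pleaf p + (pleaf p).-1)))).
Proof.
move=> f; rewrite block_out_call; set e := (eval _ _).1.
have -> : e = nseq ((pleaf p).-1 + (pleaf p + (pleaf p).-1)) false :: [:: nseq (plen p) true].
  by rewrite /e [LHS]/= !num_bin encn_nil // !size_nseq -subn1.
rewrite /vcat !ex_bind ex_ustrs; cbn [ex]; rewrite ex_bind; apply: eq_ex => s.
by rewrite block_out_let block_out_nil.
Qed.

(** [pow] is the number [2 ^ l], written as [l] zeros followed by a one. Adding it first keeps the
    truncated subtraction exact, and cutting to [l] bits removes it again. *)
Definition client_prog : seq stmt :=
  let L := hd (tl (EVar 0)) in let I := hd (tl (tl (EVar 0))) in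
  let arg := tl (tl (tl (tl (EVar 0)))) in
  let pow := EApp2 OJoin (EApp2 OToBits (len L) (ELit [::])) lit1 in
  [:: SCall 1 ustrs_fun (EApp2 OToBits (len I) (ELit [::]) ;; L);
      SCall 2 coins_fun L;
      SLet 3 (EApp2 OToBits (len L)
        (EApp2 OSub (EApp2 OAdd (hd (EApp2 ODropL (len I) arg)) pow) (EVar 2)));
      SLet 0 (EApp2 OTakeL (len I) arg ;; EVar 1 ;; EVar 2 ;; EVar 3)].

Lemma ppt_client : ppt (fun v => block_out client_prog (load v)).
Proof.
by apply: ppt_block; do ![split => //]; [apply: ppt_ustrs|apply: ppt_coins].
Qed.

Lemma num_pow w : num (nseq w false ++ [:: true]) = 2 ^ w.
Proof. by elim: w => //= w ->; rewrite expnS mul2n. Qed.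

Lemma client_progE k p (x : features p) u : 0 < plen p -> deq
  (block_out client_prog (load (public k p ++ enc_features x ++ [:: enc (plen p) u])))
  (bind (rep (coins (plen p)) (pfeat p)) (fun s => bind (unif (plen p)) (fun u0 =>
     Ret (enc_features x ++ s ++ [:: enc (plen p) u0; enc (plen p) (u - u0)%R])))).
Proof.
set w := plen p => w0 f; rewrite block_out_call; set e := (eval _ _).1.
have -> : e = nseq (pfeat p) false :: [:: nseq w true].
  by rewrite /e [LHS]/= !num_bin encn_nil // !size_nseq.
rewrite !ex_bind ex_ustrs; apply: eq_ex => s.
rewrite (block_out_coins _ _ _ w0); last by rewrite /= size_nseq.
rewrite ex_bind; apply: eq_ex => u0.
have sx : size (enc_features x) = pfeat p by rewrite size_map size_tuple.
rewrite block_out_let; set st2 := upd _ 2 _; set ev := (eval _ _).1.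
have -> : ev = [:: enc w (u - u0)%R].
  rewrite /ev [LHS]/= !num_bin /st2 /= !size_nseq drop_size_cat // encn_nil //.
  rewrite /numv /= num_pow !num_enc //; congr cons.
  have u0_lt := Zw_lt w0 u0.
  rewrite -enc_natr // natrB; last by apply: leq_trans (ltnW u0_lt) (leq_addl _ _).
  rewrite natrD !natr_Zp.
  have -> : ((2 ^ w)%N%:R = 0 :> Zw w)%R.
    by apply: val_inj; rewrite /= Zw_natr // modnn.
  by rewrite addr0.
rewrite block_out_let block_out_nil; congr f.
by rewrite /upd /= num_bin size_nseq take_size_cat // -catA.
Qed.

Definition select_rep SS SR m (v : seq bits) : dist (seq bits) :=
  rep (select_fun SS SR m (behead v)) (size (str v)).

(* [msb_share] spends l multiplications on the pairs (G, P), l - 2 on round 1 and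
   l - 3 on the remaining rounds (none of these if l = 2). *)
Definition muls_msb (l : nat) : nat := l + ((l - 2) + (l - 3)).

Definition count_in (p : params) : nat :=
  pfeat p + (pnode p + (pleaf p + pnode p)).
(** A multiplication shows a server five strings: its three triple shares and the other server's
    shares of the two opened values. In [count_out] a node costs one product for the lift, a leaf
    [d - 1] along its path and one with its prediction value. *)
Definition count_bits (p : params) : nat := 5 * (pnode p * muls_msb (plen p)).
Definition count_out (p : params) : nat :=
  5 * (pnode p + (pleaf p * (pdepth p - 1) + pleaf p)).

(** The number [Z = 2 ^ d] has [d + 1] binary digits, so subtracting 2 from that length gives the
    [d - 1] products along a path. *)
Definition server_prog SS SR (m : bool) : seq stmt :=
  let K := hd (EVar 0) in let L := hd (tl (EVar 0)) in
  let I := hd (tl (tl (EVar 0))) in let Z := len (hd (tl (tl (tl (EVar 0))))) in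
  let J := EApp2 OSub Z lit1 in
  let lit n := ELit [:: encn 4 n] in
  let muls := EApp2 OAdd (len L) (EApp2 OAdd (EApp2 OSub (len L) (lit 2))
                                             (EApp2 OSub (len L) (lit 3))) in
  let depth := len (EApp2 OAdd Z (ELit [::])) in
  let unary e := EApp2 OToBits e (ELit [::]) in
  [:: SCall 2 ustrs_fun (unary (EApp2 OAdd (len I) (EApp2 OAdd J (EApp2 OAdd Z J))) ;; L);
      SCall 3 (select_rep SS SR m) (unary J ;; K ;; L ;; I ;; EApp2 OTakeL (len I) (EVar 2));
      SCall 4 ustrs_fun (unary (EApp2 OMul (lit 5) (EApp2 OMul J muls)) ;; lit1);
      SCall 5 ustrs_fun (unary (EApp2 OMul (lit 5) (EApp2 OAdd J
        (EApp2 OAdd (EApp2 OMul Z (EApp2 OSub depth (lit 2))) Z))) ;; L);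
      SLet 0 (EVar 2 ;; EVar 3 ;; EVar 4 ;; EVar 5)].

Lemma ppt_server SS SR m : ppt SS -> ppt SR ->
  ppt (fun v => block_out (server_prog SS SR m) (load v)).
Proof.
move=> pS pR; apply: ppt_block; do ![split => //]; try exact: ppt_ustrs.
exact: (ppt_rep (ppt_select m pS pR)).
Qed.

(** The first [I] uniform strings play the shares of the features, and the selections are simulated
    on those same strings. *)
Definition server_sim SS SR m k p : dist (seq bits) :=
  bind (rep (coins (plen p)) (count_in p)) (fun s =>
  vcat (Ret s)
  (vcat (rep (select_fun SS SR m (ot_public k (plen p) (pfeat p) ++ take (pfeat p) s)) (pnode p))
  (vcat (rep (coins 1) (count_bits p)) (rep (coins (plen p)) (count_out p))))).

Lemma server_progE SS SR m k p :
  deq (block_out (server_prog SS SR m) (load (public k p))) (server_sim SS SR m k p).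
Proof.
move=> f; rewrite /server_sim /count_in /count_bits /count_out /pnode.
rewrite block_out_call; set e := (eval _ _).1.
have -> : e = nseq (pfeat p + ((pleaf p).-1 + (pleaf p + (pleaf p).-1))) false
              :: [:: nseq (plen p) true].
  by rewrite /e [LHS]/= !num_bin encn_nil // !size_nseq -subn1.
rewrite !ex_bind ex_ustrs; apply: eq_ex => s1.
rewrite block_out_call; set st2 := upd _ 2 _; set e3 := (eval _ _).1.
have -> : e3 = nseq (pleaf p).-1 false :: ot_public k (plen p) (pfeat p) ++ take (pfeat p) s1.
  by rewrite /e3 [LHS]/= !num_bin encn_nil // /st2 /= !size_nseq -subn1.
rewrite /vcat ex_bind [RHS]ex_bind; cbn [ex]; rewrite [RHS]ex_bind ex_bind.
rewrite /select_rep [behead _]/= [str _]/= size_nseq; apply: eq_ex => s2.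
rewrite block_out_call; set st3 := upd _ 3 _; set e4 := (eval _ _).1.
have nlit n : n < 16 -> numv [:: encn 4 n] = n.
  by move=> h; rewrite -[numv _]/(num (encn 4 n)) num_encn modn_small.
have -> : e4 = nseq (5 * ((pleaf p).-1 * muls_msb (plen p))) false :: [:: nseq 1 true].
  rewrite /e4 [LHS]/= !num_bin encn_nil // /st3 /st2 /= !size_nseq -subn1.
  by rewrite !nlit.
rewrite !ex_bind ex_ustrs; apply: eq_ex => s3.
rewrite block_out_call; set st4 := upd _ 4 _; set e5 := (eval _ _).1.
have -> : e5 = nseq (5 * ((pleaf p).-1 + (pleaf p * (pdepth p - 1) + pleaf p))) false
               :: [:: nseq (plen p) true].
  rewrite /e5 [LHS]/= !num_bin encn_nil // /st4 /st3 /st2 /= !size_nseq -subn1.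
  by rewrite !nlit // addn0 size_map size_iota trunc_expnK // subSS.
rewrite ex_bind ex_ustrs !ex_bind; apply: eq_ex => s4.
by rewrite block_out_let block_out_nil.
Qed.

Local Open Scope ring_scope.

(** * Uniform ring elements as averages *)

Lemma sum_double (n : nat) (F : nat -> rat) :
  \sum_(i < n.*2) F i = \sum_(i < n) (F i.*2.+1 + F i.*2).
Proof.
elim: n => [|n IH]; first by rewrite !big_ord0.
by rewrite doubleS !big_ord_recr /= IH -addrA [F _ + F _]addrC.
Qed.

Lemma ex_tosses (w : nat) (h : nat -> rat) :
  ex (tosses w) (fun s => h (num s)) = (\sum_(i < 2 ^ w) h i) / (2 ^ w)%N%:R.
Proof.
elim: w h => [|w IH] h; first by rewrite /= big_ord1 divr1.
rewrite [tosses _]/=; cbn [ex]; rewrite !ex_bind /=.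
rewrite (IH (fun n => h (true + n.*2)%N)) (IH (fun n => h (false + n.*2)%N)).
rewrite -mulrDl -big_split /= expnS mul2n (sum_double _ h) -mulrA -invfM.
by rewrite -muln2 natrM mulrC; congr (_ * _); rewrite mulrC.
Qed.

Lemma ex_unif (w : nat) (f : Zw w -> rat) : (0 < w)%N ->
  ex (unif w) f = (\sum_(a : Zw w) f a) / (2 ^ w)%N%:R.
Proof.
move=> w0; rewrite /unif ex_bind /= /dec (ex_tosses w (fun n => f n%:R)).
congr (_ / _); rewrite -(big_mkord xpredT (fun i => f i%:R)).
transitivity (\sum_(0 <= i < (Zp_trunc (2 ^ w)).+2) f i%:R).
  by apply: congr_big_nat => //; rewrite Zp_cast ?expw_gt1.
by rewrite big_mkord; apply: eq_bigr => a _; rewrite natr_Zp.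
Qed.

(** The one-time pad: an injection of a finite ring into itself permutes the terms of the
    average. *)
Lemma unif_inj (w : nat) (g : Zw w -> Zw w) (f : Zw w -> rat) : (0 < w)%N ->
  injective g -> ex (unif w) (fun a => f (g a)) = ex (unif w) f.
Proof.
by move=> w0 gi; rewrite !ex_unif // [in RHS](reindex_inj gi).
Qed.

Lemma unif_add w (c : Zw w) f : (0 < w)%N ->
  ex (unif w) (fun a => f (a + c)) = ex (unif w) f.
Proof. by move=> w0; apply: unif_inj => //; apply: addIr. Qed.

Lemma unif_add' w (c : Zw w) f : (0 < w)%N ->
  ex (unif w) (fun a => f (c + a)) = ex (unif w) f.
Proof. by move=> w0; apply: unif_inj => //; apply: addrI. Qed.

Lemma unif_sub w (c : Zw w) f : (0 < w)%N ->
  ex (unif w) (fun a => f (c - a)) = ex (unif w) f.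
Proof.
by move=> w0; apply: (unif_inj _ w0 (g := fun a => c - a)) => a b /addrI/oppr_inj.
Qed.

Lemma exC3 (A B C D : Type) (m : dist A) (m1 : dist B) (m2 : dist C) (m3 : dist D)
    (f : A -> B -> C -> D -> rat) :
  ex m (fun a => ex m1 (fun b => ex m2 (fun c => ex m3 (fun d => f a b c d)))) =
  ex m1 (fun b => ex m2 (fun c => ex m3 (fun d => ex m (fun a => f a b c d)))).
Proof.
rewrite exC; apply: eq_ex => b; rewrite exC; apply: eq_ex => c; by rewrite exC.
Qed.

(** * Views *)

Definition filt (Q : party) (lg : log) : seq bits := [seq e.2 | e <- lg & e.1 == Q].

Lemma filt_cat Q l1 l2 : filt Q (l1 ++ l2) = filt Q l1 ++ filt Q l2.
Proof. by rewrite /filt filter_cat map_cat. Qed.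

(** A joint test of the result and of what [Q] sees; the lemmas below unfold a protocol into nested
    averages of such tests. *)
Definition ev (Q : party) (A : Type) (m : proto A) (G : A -> seq bits -> rat) : rat :=
  ex m (fun r => G r.1 (filt Q r.2)).

Section Ev.
Variable Q : party.

Lemma eq_ev (A : Type) (m : proto A) G G' :
  (forall a s, G a s = G' a s) -> ev Q m G = ev Q m G'.
Proof. by move=> h; apply: eq_ex. Qed.

Lemma ev_pret (A : Type) (a : A) G : ev Q (pret a) G = G a [::].
Proof. by []. Qed.

Lemma ev_pbind (A B : Type) (m : proto A) (f : A -> proto B) G :
  ev Q (pbind m f) G = ev Q m (fun a s => ev Q (f a) (fun b t => G b (s ++ t))).
Proof.
rewrite /ev /pbind ex_bind; apply: eq_ex => r; rewrite ex_bind /=.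
by apply: eq_ex => q; rewrite filt_cat.
Qed.

Lemma ev_dealer w G : ev Q (dealer w) G = ex (unif w) (fun a => G a [::]).
Proof. by rewrite /ev /dealer ex_bind. Qed.

Lemma ev_rand w P G : ev Q (rand w P) G =
  ex (unif w) (fun a => G a (if P == Q then [:: enc w a] else [::])).
Proof. by rewrite /ev /rand ex_bind /filt /=; apply: eq_ex => a; case: ifP. Qed.

Lemma ev_send w P a G : ev Q (send w P a) G =
  G tt (if P == Q then [:: enc w a] else [::]).
Proof. by rewrite /ev /filt /=; case: ifP. Qed.

Lemma ev_deal w (a : Zw w) G : ev Q (deal a) G =
  ex (unif w) (fun r => G (a - r, r)
     (if Server false == Q then [:: enc w (a - r)]
      else if Server true == Q then [:: enc w r] else [::])).
Proof.
rewrite /deal ev_pbind ev_dealer; apply: eq_ex => r.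
rewrite !ev_pbind !ev_send; case: Q => [||[]] //=.
Qed.

Lemma ev_mulsh w (a b : share w) G : ev Q (mulsh a b) G =
  ex (unif w) (fun v1 => ex (unif w) (fun v2 => ex (unif w) (fun r1 =>
  ex (unif w) (fun r2 => ex (unif w) (fun r3 =>
  let e := (a.1 - (v1 - r1) + (a.2 - r1)) in
  let f := (b.1 - (v2 - r2) + (b.2 - r2)) in
  G (0 * (e * f) + (v1 - r1) * f + (v2 - r2) * e + (v1 * v2 - r3),
     1 * (e * f) + r1 * f + r2 * e + r3)
    (if Server false == Q then
       [:: enc w (v1 - r1); enc w (v2 - r2); enc w (v1 * v2 - r3);
           enc w (a.2 - r1); enc w (b.2 - r2)]
     else if Server true == Q then
       [:: enc w r1; enc w r2; enc w r3;
           enc w (a.1 - (v1 - r1)); enc w (b.1 - (v2 - r2))]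
     else [::])))))).
Proof.
rewrite /mulsh ev_pbind ev_dealer; apply: eq_ex => v1.
rewrite ev_pbind ev_dealer; apply: eq_ex => v2.
rewrite ev_pbind ev_deal; apply: eq_ex => r1.
rewrite ev_pbind ev_deal; apply: eq_ex => r2.
rewrite ev_pbind ev_deal; apply: eq_ex => r3.
do 4 rewrite ev_pbind ev_send.
by rewrite ev_pret; case: Q => [||[]].
Qed.

End Ev.

(** * Protocols whose server view is uniform whatever the result *)

Definition hid (Q : party) (w n : nat) (A : Type) (P : proto A) : Prop :=
  forall g, ev Q P (fun _ s => g s) = ex (rep (coins w) n) g.

Lemma ex_vcat V W f :
  ex (vcat V W) f = ex V (fun s => ex W (fun t => f (s ++ t))).
Proof. by rewrite /vcat ex_bind; apply: eq_ex => s; rewrite ex_bind. Qed.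

Lemma ex_coins_rep w n f : (0 < w)%N -> ex (rep (coins w) n.+1) f =
  ex (unif w) (fun a => ex (rep (coins w) n) (fun t => f (enc w a :: t))).
Proof. by move=> w0; rewrite ex_vcat ex_coins. Qed.

Lemma rep_add V a b : deq (rep V (a + b)) (vcat (rep V a) (rep V b)).
Proof.
elim: a => [|a IH] f; first by rewrite /vcat /= ex_bind.
rewrite addSn /= /vcat !ex_bind; apply: eq_ex => s; rewrite ex_bind IH /vcat /=.
by rewrite !ex_bind; apply: eq_ex => t; rewrite ex_bind /= ex_bind; apply: eq_ex => u; rewrite /= catA.
Qed.

Lemma hid_pret Q w (A : Type) (a : A) : hid Q w 0 (pret a).
Proof. by []. Qed.

(** [R] records facts such as the length of an intermediate list, on which the number of later
    strings depends. *)
Lemma hid_bind Q w n1 n2 (A B : Type) (P : proto A) (f : A -> proto B) (R : A -> Prop) :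
  sure P (fun r => R r.1) -> hid Q w n1 P -> (forall a, R a -> hid Q w n2 (f a)) ->
  hid Q w (n1 + n2) (pbind P f).
Proof.
move=> hR h1 h2 g; rewrite ev_pbind.
transitivity (ev Q P (fun _ s => ex (rep (coins w) n2) (fun t => g (s ++ t)))).
  apply: eq_ex_sure; move: hR; apply: sure_imp => r /= /h2 h.
  exact: (h (fun t => g (_ ++ t))).
rewrite h1 rep_add /vcat ex_bind; apply: eq_ex => s.
by rewrite ex_bind.
Qed.

Lemma hid_bindT Q w n1 n2 (A B : Type) (P : proto A) (f : A -> proto B) :
  hid Q w n1 P -> (forall a, hid Q w n2 (f a)) -> hid Q w (n1 + n2) (pbind P f).
Proof. by move=> h1 h2; apply: (hid_bind (R := fun=> True)) => //; apply: sureT. Qed.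

Lemma sure_pbind (A B : Type) (P : proto A) (f : A -> proto B) (R : B -> Prop) :
  sure P (fun r => sure (f r.1) (fun q => R q.1)) -> sure (pbind P f) (fun q => R q.1).
Proof.
move=> h; apply/sure_bind; move: h; apply: sure_imp => r h; apply/sure_bind.
by move: h; apply: sure_imp.
Qed.

Lemma size_pmapM (A B : Type) (f : A -> proto B) (s : seq A) :
  sure (pmapM f s) (fun r => size r.1 = size s).
Proof.
elim: s => //= a s IH; apply: (@sure_pbind _ _ _ _ (fun r => size r = _)).
apply: sureT => r; apply: (@sure_pbind _ _ _ _ (fun r => size r = _)).
by move: IH; apply: sure_imp => q /= ->.
Qed.

Lemma hid_pmapM Q w n (A B : Type) (f : A -> proto B) (s : seq A) :
  (forall a, hid Q w n (f a)) -> hid Q w (size s * n) (pmapM f s).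
Proof.
move=> h; elim: s => [|a s IH] /=; first exact: hid_pret.
rewrite mulSn; apply: hid_bindT => // b; rewrite -[(size s * n)%N]addn0.
by apply: hid_bindT => // bs; apply: hid_pret.
Qed.

Lemma hid_mulsh m w (a b : share w) : (0 < w)%N -> hid (Server m) w 5 (mulsh a b).
Proof.
move=> w0 g; rewrite ev_mulsh.
transitivity (ex (unif w) (fun x1 => ex (unif w) (fun x2 => ex (unif w) (fun x3 =>
  ex (unif w) (fun x4 => ex (unif w) (fun x5 =>
    g [:: enc w x1; enc w x2; enc w x3; enc w x4; enc w x5])))))); last first.
  rewrite ex_coins_rep //; apply: eq_ex => x1; rewrite ex_coins_rep //; apply: eq_ex => x2.
  rewrite ex_coins_rep //; apply: eq_ex => x3; rewrite ex_coins_rep //; apply: eq_ex => x4.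
  by rewrite ex_coins_rep //; apply: eq_ex => x5.
case: m => /=.
(* For [C_1] the triple shares are the draws [r1], [r2], [r3] themselves, and [v1], [v2] pad the two
   openings. *)
- transitivity (ex (unif w) (fun v1 => ex (unif w) (fun r1 => ex (unif w) (fun r2 =>
    ex (unif w) (fun r3 => ex (unif w) (fun v2 => g [:: enc w r1; enc w r2; enc w r3;
      enc w (a.1 - (v1 - r1)); enc w (b.1 - (v2 - r2))])))))).
    by apply: eq_ex => v1; rewrite (exC3 _ _ _ _ (fun v2 r1 r2 r3 => g _)).
  rewrite (exC3 _ _ _ _ (fun v1 r1 r2 r3 => ex _ _)).
  apply: eq_ex => x1; apply: eq_ex => x2; apply: eq_ex => x3.
  rewrite -[RHS](unif_sub (a.1 + x1)) //; apply: eq_ex => v1.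
  rewrite -[RHS](unif_sub (b.1 + x2)) //; apply: eq_ex => v2.
  by rewrite !opprB !addrA.
(* For [C_0] the draw [r3] pads the third triple share, then [v2] the second and [v1] the first;
   this frees [r2] and [r1] to pad the openings. *)
- transitivity (ex (unif w) (fun v1 => ex (unif w) (fun r1 => ex (unif w) (fun r2 =>
    ex (unif w) (fun x2 => ex (unif w) (fun x3 => g [:: enc w (v1 - r1); enc w x2; enc w x3;
      enc w (a.2 - r1); enc w (b.2 - r2)])))))).
    apply: eq_ex => v1; rewrite exC; apply: eq_ex => r1; rewrite exC; apply: eq_ex => r2.
    rewrite -[RHS](unif_add (- r2)) //; apply: eq_ex => v2.
    by rewrite -[RHS](unif_sub (v1 * v2)).
  rewrite exC; transitivity (ex (unif w) (fun r1 => ex (unif w) (fun x1 =>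
    ex (unif w) (fun r2 => ex (unif w) (fun x2 => ex (unif w) (fun x3 =>
      g [:: enc w x1; enc w x2; enc w x3; enc w (a.2 - r1); enc w (b.2 - r2)])))))).
    by apply: eq_ex => r1; rewrite -[RHS](unif_add (- r1)).
  rewrite exC; apply: eq_ex => x1.
  transitivity (ex (unif w) (fun r1 => ex (unif w) (fun x2 => ex (unif w) (fun x3 =>
    ex (unif w) (fun x5 => g [:: enc w x1; enc w x2; enc w x3; enc w (a.2 - r1); enc w x5]))))).
    apply: eq_ex => r1; rewrite exC; apply: eq_ex => x2; rewrite exC; apply: eq_ex => x3.
    by rewrite -[RHS](unif_sub b.2).
  rewrite exC; apply: eq_ex => x2; rewrite exC; apply: eq_ex => x3.
  by rewrite -[RHS](unif_sub a.2).
Qed.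

(** * Server views of the individual phases *)

Section Phases.
Variable m : bool.

Lemma hid_diamond_G hi lo : hid (Server m) 1 5 (diamond_G hi lo).
Proof.
by apply: (@hid_bindT _ _ 5 0) => [|a]; [apply: hid_mulsh|apply: hid_pret].
Qed.

Lemma hid_diamond hi lo : hid (Server m) 1 10 (diamond hi lo).
Proof.
apply: (@hid_bindT _ _ 5 5) => [|g]; first exact: hid_diamond_G.
by apply: (@hid_bindT _ _ 5 0) => [|a]; [apply: hid_mulsh|apply: hid_pret].
Qed.

(** A round on [2 ^ n] pairs takes [2 ^ n] multiplications and the last round takes one:
    [2 ^ n + ... + 4 + 1 = 2 ^ n.+1 - 3]. For [n = 0] the truncated subtraction gives the correct
    0. *)
Lemma hid_carry n s : size s = (2 ^ n)%N ->
  hid (Server m) 1 (5 * (2 ^ n.+1 - 3))%N (carry_rounds n s).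
Proof.
elim: n s => [|n IH] s hs; first exact: hid_pret.
case: n IH hs => [|n] IH hs; first exact: hid_diamond_G.
have -> : (5 * (2 ^ n.+3 - 3) = size (iota 0 (size s)./2) * 10 + 5 * (2 ^ n.+2 - 3))%N.
  rewrite size_iota hs [in RHS]expnS mul2n doubleK !expnS.
  by have : (0 < 2 ^ n)%N by [rewrite expn_gt0]; lia.
rewrite [carry_rounds _ _]/=; apply: (hid_bind (R := fun s' => size s' = (2 ^ n.+1)%N)).
- move: (size_pmapM (fun k => diamond (nth gp0 s k.*2.+1) (nth gp0 s k.*2))
           (iota 0 (size s)./2)).
  by apply: sure_imp => r ->; rewrite size_iota hs expnS mul2n doubleK.
- by apply: hid_pmapM => k; apply: hid_diamond.
- exact: IH.
Qed.

Lemma hid_msb e (d : share (2 ^ e)) : (0 < e)%N ->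
  hid (Server m) 1 (5 * muls_msb (2 ^ e))%N (msb_share d).
Proof.
move=> e0; rewrite /msb_share /muls_msb.
have he : (2 ^ e = (2 ^ e.-1).*2)%N by rewrite -{1}(prednK e0) expnS mul2n.
have -> : (5 * (2 ^ e + (2 ^ e - 2 + (2 ^ e - 3))) =
    size (iota 0 (2 ^ e)) * 5 + (size (iota 1 (2 ^ e)./2.-1) * 10 +
    (5 * (2 ^ e.-1.+1 - 3) + 0)))%N.
  rewrite !size_iota prednK // he doubleK.
  by have : (0 < 2 ^ e.-1)%N by [rewrite expn_gt0]; lia.
apply: hid_bindT => [|s].
  apply: hid_pmapM => q; apply: (@hid_bindT _ _ 5 0) => [|g]; last exact: hid_pret.
  exact: hid_mulsh.
apply: (hid_bind (R := fun s1 => size s1 = (2 ^ e.-1).-1)).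
- move: (size_pmapM (fun k => diamond (nth gp0 s k.*2) (nth gp0 s k.*2.-1))
           (iota 1 (2 ^ e)./2.-1)).
  by apply: sure_imp => r ->; rewrite size_iota he doubleK.
- by apply: hid_pmapM => k; apply: hid_diamond.
- move=> s1 hs1; apply: hid_bindT => [|c]; last exact: hid_pret.
  by apply: hid_carry; rewrite /= hs1 prednK // expn_gt0.
Qed.

Lemma hid_lift w v : (0 < w)%N -> hid (Server m) w 5 (lift_share w v).
Proof.
by move=> w0; apply: (@hid_bindT _ _ 5 0) => [|a]; [apply: hid_mulsh|apply: hid_pret].
Qed.

Lemma hid_prodsh w (s : seq (share w)) : (0 < w)%N -> hid (Server m) w (5 * (size s - 1))%N (prodsh s).
Proof.
move=> w0; case: s => [|a s]; first exact: hid_pret.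
rewrite /= subn1 /=; elim: s a => [|b s IH] a; first exact: hid_pret.
by rewrite /= mulnS; apply: hid_bindT => [|c]; [apply: hid_mulsh|apply: IH].
Qed.

End Phases.

Lemma size_path_to d n : size (path_to d n) = d.
Proof. by elim: d n => //= d IH n; rewrite size_rcons IH. Qed.

Definition infer (p : params) (vs us : seq (share (plen p))) : proto (Zw (plen p)) :=
  let l := plen p in
  let* gs := pmapM (fun z => prodsh [seq edge vs e
                                    | e <- path_to (pdepth p) (pnode p + z)])
                   (iota 0 (pleaf p)) in
  let* gus := pmapM (fun a => mulsh a.1 a.2) (zip gs us) in
  let u := foldl (@addsh l) (0, 0) gus in
  let* _ := send l Client u.1 in
  let* _ := send l Client u.2 in
  pret (u.1 + u.2).

Definition evaluate (p : params) (sx ys us : seq (share (plen p))) : proto (Zw (plen p)) :=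
  let* bs := pmapM (fun a => msb_share (e := plog p) (subsh a.1 a.2)) (zip sx ys) in
  let* vs := pmapM (lift_share (plen p)) bs in
  infer vs us.

Lemma protocolE ot k p (T : dtree p) (x : features p) :
  protocol ot k T x =
  (let* xs := pmapM (give Client) (tval x) in
   let* ys := pmapM (give Provider) (tval (thr T)) in
   let* us := pmapM (give Provider) (tval (leafval T)) in
   let* ids := pmapM (fun i : 'I_(pfeat p) =>
                 give Provider ((i : nat)%:R : Zw (plen p))) (tval (sel T)) in
   let* sx := pmapM (select ot k (pfeat p) xs) ids in
   evaluate sx ys us).
Proof. by []. Qed.

Lemma plen_gt0 p : (0 < plen p)%N. Proof. by rewrite expn_gt0. Qed.

Lemma hid_infer m p (vs us : seq (share (plen p))) : size us = pleaf p ->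
  hid (Server m) (plen p) (5 * (pleaf p * (pdepth p - 1) + pleaf p))%N (infer vs us).
Proof.
move=> hus; rewrite mulnDr mulnCA -{1}(size_iota 0 (pleaf p)).
apply: (hid_bind (R := fun gs => size gs = pleaf p)).
- move: (size_pmapM (fun z => prodsh [seq edge vs e
          | e <- path_to (pdepth p) (pnode p + z)]) (iota 0 (pleaf p))).
  by apply: sure_imp => r ->; rewrite size_iota.
- apply: hid_pmapM => z.
  have := hid_prodsh m [seq edge vs e | e <- path_to (pdepth p) (pnode p + z)] (plen_gt0 p).
  by rewrite size_map size_path_to.
- move=> gs hgs; rewrite -[(5 * _)%N]addn0 mulnC.
  have -> : pleaf p = size (zip gs us) by rewrite size_zip hgs hus minnn.
  apply: hid_bindT => [|gus]; last by move=> g; rewrite !ev_pbind !ev_send.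
  by apply: hid_pmapM => a; apply: hid_mulsh; apply: plen_gt0.
Qed.

(** The comparisons are over [Z_2] and what follows is over [Z_(2^l)]; [hid] has a single width, so
    the two stretches are joined by hand. *)
Lemma evaluate_view m p (sx ys us : seq (share (plen p))) g : (0 < plog p)%N ->
  size sx = pnode p -> size ys = pnode p -> size us = pleaf p ->
  ev (Server m) (evaluate sx ys us) (fun _ s => g s) =
  ex (vcat (rep (coins 1) (count_bits p)) (rep (coins (plen p)) (count_out p))) g.
Proof.
move=> p0 hsx hys hus; rewrite /evaluate ev_pbind ex_vcat.
have hz : size (zip sx ys) = pnode p by rewrite size_zip hsx hys minnn.
have hb : hid (Server m) 1 (count_bits p)
    (pmapM (fun a => msb_share (e := plog p) (subsh a.1 a.2)) (zip sx ys)).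
  rewrite /count_bits mulnCA -hz; apply: hid_pmapM => a; exact: hid_msb.
rewrite -hb; apply: eq_ex_sure.
move: (size_pmapM (fun a => msb_share (e := plog p) (subsh a.1 a.2)) (zip sx ys)).
apply: sure_imp => r hr.
have : hid (Server m) (plen p) (count_out p)
    (let* vs := pmapM (lift_share (plen p)) r.1 in infer vs us).
  rewrite /count_out mulnDr; apply: hid_bindT => [|vs]; last exact: hid_infer.
  rewrite mulnC -hz -hr; apply: hid_pmapM => v; apply: hid_lift; exact: plen_gt0.
by move=> /(_ (fun t => g (filt (Server m) r.2 ++ t))).
Qed.

(** * The view of a server in one feature selection *)

Definition opened w (a : share w) : Zw w := a.1 + a.2.

Definition otR ot k w n (arr : seq (Zw w)) (i : nat) : dist (seq bits) :=
  bind (ot_exec ot k n arr i) (fun o => Ret (ot_inR w i ++ o.2.2)).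
Definition otS ot k w n (arr : seq (Zw w)) (i : nat) : dist (seq bits) :=
  bind (ot_exec ot k n arr i) (fun o => Ret (ot_inS arr ++ o.2.1)).

(* The view of C_m in a feature selection whose OT views are given by [VR] and
   [VS]; [c] is the masked index, [r''] the mask of the other server's array. *)
Definition select_gen w (VR VS : seq (Zw w) -> nat -> dist (seq bits)) (m : bool)
    (n : nat) (xs : seq (share w)) (idx : share w) : dist (seq bits) :=
  bind (unif w) (fun s => bind (unif w) (fun r => bind (unif w) (fun r' =>
  bind (unif w) (fun c => bind (unif w) (fun r'' => bind (unif w) (fun a =>
  bind (unif w) (fun p =>
  bind (VR (scatter n [seq part (~~ m) x | x <- xs] (c - opened idx) r'') (slot n c)) (fun zR =>
  bind (VS (scatter n [seq part m x | x <- xs] s r) (slot n (opened idx + s))) (fun zS =>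
  Ret (select_view n m s r r' c a p zR zS)))))))))).

Lemma size_set_nth_foldl w n (g : nat -> nat) (h : nat -> Zw w) s acc :
  size acc = n -> (forall i, g i < n)%N ->
  size (foldl (fun acc i => set_nth 0 acc (g i) (h i)) acc s) = n.
Proof.
move=> + hg; elim: s acc => //= i s IH acc hacc; apply: IH.
by rewrite size_set_nth hacc; apply/maxn_idPr.
Qed.

Lemma size_scatter w n (arr : seq (Zw w)) s r : (0 < n)%N -> size (scatter n arr s r) = n.
Proof.
move=> n0; apply: size_set_nth_foldl; first by rewrite size_nseq.
by move=> i; rewrite /slot ltn_mod.
Qed.

Lemma exC2 (A B C : Type) (m : dist A) (m1 : dist B) (m2 : dist C) (f : A -> B -> C -> rat) :
  ex m (fun a => ex m1 (fun b => ex m2 (fun c => f a b c))) =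
  ex m1 (fun b => ex m2 (fun c => ex m (fun a => f a b c))).
Proof. by rewrite exC; apply: eq_ex => b; rewrite exC. Qed.

Lemma ev_ot_step Q ot k w n m (arr : seq (Zw w)) i G :
  ev Q (ot_step ot k n m arr i) G = ex (ot_exec ot k n arr i) (fun o =>
    G o.1 ((if Server (~~ m) == Q then o.2.1 else [::]) ++
           (if Server m == Q then o.2.2 else [::]))).
Proof.
rewrite /ev /ot_step ex_bind; apply: eq_ex => o; cbn [ex fst snd].
have h R s : filt Q [seq (R, x) | x <- s] = if R == Q then s else [::].
  rewrite /filt filter_map -map_comp; case: (R =P Q) => [->|ne].
    rewrite (@eq_filter _ _ predT) ?filter_predT ?map_id // => x /=.
    by rewrite eqxx.
  by rewrite (@eq_filter _ _ pred0) ?filter_pred0 // => x /=; apply/eqP.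
by rewrite filt_cat !h.
Qed.

(** The mask cancels in the index given to the OT, so the index shares enter that index only through
    their sum, whichever server receives. *)
Lemma ev_fetch Q ot k w n m (idx : share w) arr s G :
  ev Q (fetch ot k n m idx arr s) G =
  ex (unif w) (fun r => ex (ot_exec ot k n arr (slot n (opened idx + s))) (fun o =>
    G o.1 ((if Server m == Q then
              [:: enc w r; enc w (opened idx + s + r)] ++ o.2.2
            else if Server (~~ m) == Q then enc w (part m idx + r) :: o.2.1
            else [::])))).
Proof.
rewrite /fetch ev_pbind ev_rand; apply: eq_ex => r.
do 2 rewrite ev_pbind ev_send; rewrite ev_ot_step.
have -> : part m idx + r + (part (~~ m) idx + s) - r = opened idx + s.
  by rewrite /opened; case: m; rewrite /=; ring.
have -> : part m idx + r + (part (~~ m) idx + s) = opened idx + s + r.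
  by rewrite /opened; case: m; rewrite /=; ring.
apply: eq_ex => o; congr G.
by case: Q m => [||[]] [] //=; rewrite ?cats0.
Qed.

Lemma ex_otR ot k w n (arr : seq (Zw w)) i F : ex (otR ot k n arr i) F =
  ex (ot_exec ot k n arr i) (fun o => F (ot_inR w i ++ o.2.2)).
Proof. by rewrite ex_bind. Qed.

Lemma ex_otS ot k w n (arr : seq (Zw w)) i F : ex (otS ot k n arr i) F =
  ex (ot_exec ot k n arr i) (fun o => F (ot_inS arr ++ o.2.1)).
Proof. by rewrite ex_bind. Qed.

Section SelectView.
Variables (ot : ot_protocol) (k w n : nat) (w_gt0 : (0 < w)%N) (n_gt0 : (0 < n)%N).

(* The OT outputs reach the servers' views only under fresh masks, so neither side
   mentions them and the correctness of OT is not needed. *)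
Lemma select_view_real m (xs : seq (share w)) idx g :
  ev (Server m) (select ot k n xs idx) (fun _ s => g s) =
  ex (select_gen (@otR ot k w n) (@otS ot k w n) m n xs idx) g.
Proof.
have addv (c : Zw w) : opened idx + c - opened idx = c by ring.
rewrite /select /select_gen /select_view /recv_part /sent_part.
case: m; cbn [negb].
- transitivity (ex (unif w) (fun s0 => ex (unif w) (fun r0 => ex (unif w) (fun s => ex (unif w) (fun r =>
   ex (unif w) (fun ra => ex (ot_exec ot k n (scatter n [seq part true x | x <- xs] s r) (slot n (opened idx + s)))
     (fun oS => ex (unif w) (fun r' => ex (ot_exec ot k n (scatter n [seq part false x | x <- xs] s0 r0)
        (slot n (opened idx + s0))) (fun oR => ex (unif w) (fun p =>
      g ([:: enc w s; enc w r] ++ ((enc w (part false idx + ra) :: oS.2.1) ++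
        [:: enc w r'; enc w (opened idx + s0 + r')] ++ oR.2.2) ++ [:: enc w p]))))))))))).
    rewrite ev_pbind ev_rand; apply: eq_ex => s0; rewrite ev_pbind ev_rand; apply: eq_ex => r0.
    rewrite ev_pbind ev_rand; apply: eq_ex => s; rewrite ev_pbind ev_rand; apply: eq_ex => r.
    rewrite ev_pbind ev_fetch; apply: eq_ex => ra; apply: eq_ex => oS.
    rewrite ev_pbind ev_fetch; apply: eq_ex => r'; apply: eq_ex => oR.
    rewrite ev_pbind ev_rand; apply: eq_ex => p; rewrite ev_pbind ev_send ev_pret /=.
    by rewrite -!catA.
  transitivity (ex (unif w) (fun s => ex (unif w) (fun r => ex (unif w) (fun s0 => ex (unif w) (fun r0 =>
   ex (unif w) (fun ra => ex (ot_exec ot k n (scatter n [seq part true x | x <- xs] s r) (slot n (opened idx + s)))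
     (fun oS => ex (unif w) (fun r' => ex (ot_exec ot k n (scatter n [seq part false x | x <- xs] s0 r0)
        (slot n (opened idx + s0))) (fun oR => ex (unif w) (fun p =>
      g ([:: enc w s; enc w r] ++ ((enc w (part false idx + ra) :: oS.2.1) ++
        [:: enc w r'; enc w (opened idx + s0 + r')] ++ oR.2.2) ++ [:: enc w p]))))))))))).
    by rewrite -exC2; apply: eq_ex => s0; rewrite -exC2.
  rewrite ex_bind; apply: eq_ex => s; rewrite ex_bind; apply: eq_ex => r.
  transitivity (ex (unif w) (fun r' => ex (unif w) (fun s0 => ex (unif w) (fun r0 =>
   ex (unif w) (fun ra => ex (ot_exec ot k n (scatter n [seq part true x | x <- xs] s r) (slot n (opened idx + s)))
     (fun oS => ex (ot_exec ot k n (scatter n [seq part false x | x <- xs] s0 r0)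
        (slot n (opened idx + s0))) (fun oR => ex (unif w) (fun p =>
      g ([:: enc w s; enc w r] ++ ((enc w (part false idx + ra) :: oS.2.1) ++
        [:: enc w r'; enc w (opened idx + s0 + r')] ++ oR.2.2) ++ [:: enc w p]))))))))).
    rewrite [RHS]exC3; apply: eq_ex => s0; apply: eq_ex => r0; apply: eq_ex => ra.
    by rewrite exC.
  (* Substituting [c = opened idx + s0]: the rotation of [C_0] pads the index. *)
  rewrite ex_bind; apply: eq_ex => r'; rewrite ex_bind -[RHS](unif_add' (opened idx)) //.
  apply: eq_ex => s0; rewrite addv ex_bind; apply: eq_ex => r0.
  rewrite ex_bind -[RHS](unif_add' (part false idx)) //; apply: eq_ex => ra.
  rewrite -exC2 ex_bind; apply: eq_ex => p.
  rewrite exC ex_bind ex_otR; apply: eq_ex => oR.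
  rewrite ex_bind ex_otS; apply: eq_ex => oS; cbn [ex].
  by rewrite (@drop_size_cat _ n (ot_inS _)) ?size_map ?size_scatter //= drop0.
- transitivity (ex (unif w) (fun s => ex (unif w) (fun r => ex (unif w) (fun s1 => ex (unif w) (fun r1 =>
   ex (unif w) (fun r' => ex (ot_exec ot k n (scatter n [seq part true x | x <- xs] s1 r1) (slot n (opened idx + s1)))
     (fun oR => ex (unif w) (fun ra => ex (ot_exec ot k n (scatter n [seq part false x | x <- xs] s r)
        (slot n (opened idx + s))) (fun oS => ex (unif w) (fun r2 =>
      g ([:: enc w s; enc w r] ++ (([:: enc w r'; enc w (opened idx + s1 + r')] ++ oR.2.2) ++
        enc w (part true idx + ra) :: oS.2.1) ++ [:: enc w (oS.1 - r1 - r2)]))))))))))).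
    rewrite ev_pbind ev_rand; apply: eq_ex => s; rewrite ev_pbind ev_rand; apply: eq_ex => r.
    rewrite ev_pbind ev_rand; apply: eq_ex => s1; rewrite ev_pbind ev_rand; apply: eq_ex => r1.
    rewrite ev_pbind ev_fetch; apply: eq_ex => r'; apply: eq_ex => oR.
    rewrite ev_pbind ev_fetch; apply: eq_ex => ra; apply: eq_ex => oS.
    rewrite ev_pbind ev_rand; apply: eq_ex => r2; rewrite ev_pbind ev_send ev_pret /=.
    by rewrite -!catA.
  rewrite ex_bind; apply: eq_ex => s; rewrite ex_bind; apply: eq_ex => r.
  rewrite -exC2 ex_bind; apply: eq_ex => r'.
  rewrite ex_bind -[RHS](unif_add' (opened idx)) //.
  apply: eq_ex => s1; rewrite addv ex_bind; apply: eq_ex => r1.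
  rewrite exC ex_bind -[RHS](unif_add' (part true idx)) //; apply: eq_ex => ra.
  rewrite ex_bind.
  (* Trading the coin [r2] for the last message removes the OT output from the view of [C_0]. *)
  transitivity (ex (unif w) (fun p =>
     ex (ot_exec ot k n (scatter n [seq part true x | x <- xs] s1 r1) (slot n (opened idx + s1)))
     (fun oR => ex (ot_exec ot k n (scatter n [seq part false x | x <- xs] s r)
        (slot n (opened idx + s))) (fun oS =>
      g ([:: enc w s; enc w r] ++ (([:: enc w r'; enc w (opened idx + s1 + r')] ++ oR.2.2) ++
        enc w (part true idx + ra) :: oS.2.1) ++ [:: enc w p]))))).
    rewrite [RHS]exC2; apply: eq_ex => oR; apply: eq_ex => oS.
    by rewrite -[RHS](unif_sub (oS.1 - r1)).
  apply: eq_ex => p; rewrite ex_bind ex_otR; apply: eq_ex => oR.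
  rewrite ex_bind ex_otS; apply: eq_ex => oS; cbn [ex].
  by rewrite (@drop_size_cat _ n (ot_inS _)) ?size_map ?size_scatter //= drop0.
Qed.

End SelectView.

(** * Negligible functions *)

Lemma neg_le (f g : nat -> rat) :
  (forall k, `|f k| <= `|g k|) -> negligible g -> negligible f.
Proof. by move=> h hg c; have [N hN] := hg c; exists N => k /hN; apply: le_lt_trans. Qed.

Lemma neg_add (f g : nat -> rat) :
  negligible f -> negligible g -> negligible (fun k => f k + g k).
Proof.
move=> hf hg c; have [N1 h1] := hf c.+1; have [N2 h2] := hg c.+1.
exists (N1 + N2 + 2)%N => k hk.
apply: le_lt_trans (ler_normD _ _) _.
have k0 : (0 : rat) < k%:R by rewrite ltr0n; lia.
apply: lt_le_trans (ltrD (h1 k _) (h2 k _)) _; [lia|lia|].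
rewrite exprS invfM -mulrDl -[leRHS]mul1r ler_wpM2r ?invr_ge0 ?exprn_ge0 ?ltW //.
have : (2 : rat) <= k%:R by rewrite ler_nat; lia.
move=> k2; rewrite -mulr2n -[_ *+ 2]mulr_natl ltr_pdivrMr ?mul1r // ltr_nat; lia.
Qed.

Lemma neg_mul (f : nat -> rat) (p : nat -> nat) :
  negligible f -> poly_bounded p -> negligible (fun k => (p k)%:R * f k).
Proof.
move=> hf [d hd] c; have [N hN] := hf (c + d.+1)%N.
exists (N + d + 2)%N => k hk.
have k0 : (0 : rat) < k%:R by rewrite ltr0n; lia.
have pk : (p k <= k ^ d.+1)%N.
  apply: leq_trans (hd k) _; rewrite expnS.
  have kd : (0 < k ^ d)%N by rewrite expn_gt0; lia.
  by nia.
rewrite normrM normr_nat.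
have := hN k _; rewrite exprD invfM => /(_ _) h.
have {}h : `|f k| < (k%:R ^+ c)^-1 / k%:R ^+ d.+1 by apply: h; lia.
apply: le_lt_trans (_ : k%:R ^+ d.+1 * `|f k| < _); last first.
  by rewrite mulrC -ltr_pdivlMr // exprn_gt0.
by rewrite ler_wpM2r // -natrX ler_nat.
Qed.

Lemma leq_exp2 a b c : (a <= b -> a ^ c <= b ^ c)%N.
Proof. by case: c => // c h; rewrite leq_exp2r. Qed.

(** With [q] the quotient of [k] by [c.+1], [k <= c.+1 * 2 ^ q]; hence
    [k ^ c <= c.+1 ^ c * 2 ^ (q * c)], and this is below [2 ^ (q * c.+1) <= 2 ^ k] as soon as
    [c.+1 ^ c <= q]. *)
Lemma exp_lt_pow2 c : exists N, forall k, (N < k)%N -> (k ^ c < 2 ^ k)%N.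
Proof.
exists (c.+1 * (c.+1 ^ c).+1)%N => k hk.
set q := (k %/ c.+1)%N.
have hq : (c.+1 ^ c <= q)%N.
  rewrite /q leq_divRL //; apply: leq_trans (ltnW hk); rewrite mulnC leq_mul2l; lia.
have k1 : (k <= c.+1 * 2 ^ q)%N.
  apply: leq_trans (_ : c.+1 * q.+1 <= _)%N.
    by rewrite mulnC; apply: ltnW; apply: ltn_ceil.
  by rewrite leq_mul2l ltn_expl ?orbT.
have k2 : (2 ^ (q * c.+1) <= 2 ^ k)%N by rewrite leq_exp2l // leq_divM.
apply: leq_trans k2; apply: leq_ltn_trans (_ : (c.+1 * 2 ^ q) ^ c < _)%N.
  exact: leq_exp2.
rewrite expnMn mulnS expnD -expnM ltn_pmul2r ?expn_gt0 //.
by apply: leq_ltn_trans hq _; apply: ltn_expl.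
Qed.

Lemma neg_pow2 : negligible (fun k => (2 ^+ k)^-1).
Proof.
move=> c; have [N hN] := exp_lt_pow2 c; exists (N + 1)%N => k hk.
rewrite ger0_norm ?invr_ge0 ?exprn_ge0 //.
have k0 : (0 : rat) < k%:R by rewrite ltr0n; lia.
rewrite ltf_pV2 ?posrE ?exprn_gt0 // -!natrX ltr_nat.
by apply: hN; lia.
Qed.

Lemma neg0 : negligible (fun=> 0).
Proof. by apply: neg_le neg_pow2 => k; rewrite normr0. Qed.

(** * Indistinguishability, uniformly over short advice *)

(** A supremum need not be attained or rational, hence the slack [e]. Were there no such point,
    values could climb by [e] again and again and pass 1. *)
Lemma approx_max (T : Type) (f : T -> rat) (t0 : T) (e : rat) : 0 < e ->
  (forall t, 0 <= f t <= 1) -> exists t, forall t', f t' <= f t + e.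
Proof.
move=> e0 f01; apply: NNPP => h.
have climb n : exists t, n%:R * e <= f t.
  elim: n => [|n [t ht]]; first by exists t0; rewrite mul0r; case/andP: (f01 t0).
  apply: NNPP => h'; apply: h; exists t => t'; rewrite leNgt; apply/negP => lt.
  apply: h'; exists t'; apply: le_trans (ltW lt).
  by rewrite -addn1 natrD mulrDl mul1r lerD2r.
have [n hn] : exists n : nat, 1 < n%:R * e.
  exists (Num.Def.archi_bound e^-1).
  by rewrite -ltr_pdivrMr // div1r; apply: archi_boundP; rewrite invr_ge0 ltW.
have [t ht] := climb n; have /andP[_] := f01 t.
by rewrite leNgt (lt_le_trans hn ht).
Qed.

Definition gap (V W : dist (seq bits)) (F : seq bits -> rat) : rat := `|ex V F - ex W F|.

(* Advice is non-uniform, so a nearly optimal one can be taken for every k: the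
   bound does not depend on the advice. *)
Lemma cind_unif (Inp : nat -> Type) (X Y : forall k, Inp k -> dist (seq bits)) D
    (b : nat -> nat) :
  cind X Y -> ppt D -> poly_bounded b ->
  exists2 mu, negligible mu & forall k (a : Inp k) adv, (vsize adv <= b k)%N ->
    gap (X k a) (Y k a) (fun s => pr (D (nseq k true :: adv ++ s)) accepts) <= mu k.
Proof.
move=> cXY pD pb.
pose delta k (a : Inp k) adv :=
  gap (X k a) (Y k a) (fun s => pr (D (nseq k true :: adv ++ s)) accepts).
have delta01 k a adv : 0 <= @delta k a adv <= 1.
  rewrite /delta /gap normr_ge0 /=.
  have h V : 0 <= ex V (fun s => pr (D (nseq k true :: adv ++ s)) accepts) <= 1.
    by apply: ex01 => s; apply: pr01.
  by have /andP[? ?] := h (X k a); have /andP[? ?] := h (Y k a); rewrite ler_norml; lra.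
(* The slack has to be positive for each [k] and negligible in [k]. An empty input type is treated
   apart, as there is no point to start from. *)
have best k : exists adv, (vsize adv <= b k)%N /\ forall a' adv', (vsize adv' <= b k)%N ->
    exists a, @delta k a' adv' <= delta k a adv + (2 ^+ k)^-1.
  have [[a0]|ne] := classic (inhabited (Inp k)); last first.
    by exists [::]; split => // a; case: ne.
  pose T := (Inp k * {v : seq bits | (vsize v <= b k)%N})%type.
  have e0 : (0 : rat) < (2 ^+ k)^-1 by rewrite invr_gt0 exprn_gt0.
  have [[a [adv hadv]] h] := @approx_max T (fun t => delta k t.1 (sval t.2))
     (a0, exist _ [::] (leq0n _)) _ e0 (fun t => delta01 _ _ _).
  exists adv; split => // a' adv' h'; exists a.
  exact: (h (a', exist _ adv' h')).
pose adv k := proj1_sig (constructive_indefinite_description _ (best k)).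
have hadv k : (vsize (adv k) <= b k)%N /\ forall a' adv', (vsize adv' <= b k)%N ->
    exists a, @delta k a' adv' <= delta k a (adv k) + (2 ^+ k)^-1.
  by rewrite /adv; case: constructive_indefinite_description.
have padv : poly_bounded (fun k => vsize (adv k)) by apply: pb_le pb => k; case: (hadv k).
have [mu nmu hmu] := cXY D adv pD padv.
exists (fun k => mu k + (2 ^+ k)^-1); first by apply: neg_add => //; apply: neg_pow2.
move=> k a adv' h'; have [_ /(_ a adv' h')[a' ha']] := hadv k.
apply: le_trans ha' _; rewrite lerD2r; apply: le_trans (hmu k a').
by rewrite /delta /gap !prE !ex_bind le_eqVlt; apply/orP; left; apply/eqP;
   congr `|_ - _|; apply: eq_ex => s; rewrite prE.
Qed.

(** * Hardwiring the rest of the view *)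

(* By averaging, all of a view except one OT transcript can be fixed and handed to
   a distinguisher for OT as advice. *)
Definition hardwire_prog (D : seq bits -> dist (seq bits)) : seq stmt :=
  [:: SLet 1 (hd (tl (EVar 0))); SLet 2 (hd (tl (tl (EVar 0))));
      SLet 3 (hd (tl (tl (tl (EVar 0))))); SLet 4 (tl (tl (tl (tl (EVar 0)))));
      SLet 5 (EApp2 ODropL (EVar 1) (EVar 4));
      SCall 0 D (hd (EVar 0) ;; EApp2 OTakeL (EVar 1) (EVar 4)
        ;; EApp2 ODropL (EVar 3) (EApp2 ODropL (EVar 2) (EVar 5))
        ;; EApp2 OTakeL (EVar 2) (EVar 5))].

(** The three numbers tell where to cut the concatenation of [A], [B] and the OT view, and how many
    leading strings of that view, the input of the OT, to discard. *)
Definition hardwired (n : nat) (A B : seq bits) : seq bits :=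
  bin (size A) ++ bin (size B) ++ bin n ++ A ++ B.

Lemma hardwireE D h n A B z :
  block_out (hardwire_prog D) (load (h :: hardwired n A B ++ z)) =
  D (h :: A ++ drop n z ++ B).
Proof.
rewrite /hardwired !bin_cat.
set nA := str _; set nB := str _; set nn := str _.
have eA : numv [:: nA] = size A by exact: num_bin.
have eB : numv [:: nB] = size B by exact: num_bin.
have en : numv [:: nn] = n by exact: num_bin.
do 5 rewrite block_out_let.
rewrite block_out_call; set e := (eval _ _).1.
have -> : e = h :: A ++ drop n z ++ B.
  rewrite /e [LHS]/= -!catA; congr cons.
  rewrite -!/(numv _) eA eB en.
  by rewrite take_size_cat // !drop_size_cat // take_size_cat.
by rewrite /block_out /= bind_ret.
Qed.

Lemma ppt_hardwire D : ppt D -> ppt (fun v => block_out (hardwire_prog D) (load v)).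
Proof. by move=> pD; apply: ppt_block; do ![split => //]. Qed.

(** One [mu] serves all contexts [A], [B], so it survives averaging over a random context and
    summing over the nodes. *)
Lemma cind_hardwired (Inp : nat -> Type) (X Y : forall k, Inp k -> dist (seq bits)) D
    (b : nat -> nat) :
  cind X Y -> ppt D -> poly_bounded b ->
  exists2 mu, negligible mu & forall k (a : Inp k) n A B, (vsize A + vsize B + n <= b k)%N ->
    gap (X k a) (Y k a) (fun z => pr (D (nseq k true :: A ++ drop n z ++ B)) accepts) <= mu k.
Proof.
move=> cXY /ppt_hardwire pD pb.
have pb' : poly_bounded (fun k => b k + b k + b k + b k + 6)%N.
  by do ![apply: pb_add|apply: pb_const|done].
have [mu nmu hmu] := cind_unif cXY pD pb'; exists mu => // k a n A B hAB.
have := hmu k a (hardwired n A B) _; rewrite /gap.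
rewrite (@eq_ex _ (X k a) _ (fun z => pr (D (nseq k true :: A ++ drop n z ++ B)) accepts)); last first.
  by move=> z; rewrite hardwireE.
rewrite (@eq_ex _ (Y k a) _ (fun z => pr (D (nseq k true :: A ++ drop n z ++ B)) accepts)); last first.
  by move=> z; rewrite hardwireE.
apply; rewrite /hardwired !vsize_cat.
have := vsize_bin_le (size A); have := vsize_bin_le (size B); have := vsize_bin_le n.
have := size_vsize A; have := size_vsize B; lia.
Qed.

(* Which entry is written last into a slot does not depend on the mask [r]; hence a
   uniform mask makes the value found there uniform. *)
Lemma nth_scatter_step w (g : nat -> nat) (h : nat -> Zw w) (s : seq nat) i : i \in s ->
  exists i', [/\ i' \in s, g i' = g i & forall r acc,
    nth 0 (foldl (fun acc i => set_nth 0 acc (g i) (h i + r)) acc s) (g i) = h i' + r].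
Proof.
elim/last_ind: s => // s j IH; rewrite mem_rcons inE => hi.
have [e|ne] := eqVneq (g i) (g j).
  exists j; split => //; first by rewrite mem_rcons mem_head.
  by move=> r acc; rewrite -cats1 foldl_cat /= nth_set_nth /= e eqxx.
have is_ : i \in s by case/orP: hi => // /eqP e; rewrite e eqxx in ne.
have [i' [i's e h']] := IH is_; exists i'; split => //.
  by rewrite mem_rcons inE i's orbT.
by move=> r acc; rewrite -cats1 foldl_cat /= nth_set_nth /= (negPf ne).
Qed.

Lemma nth_scatter w n (arr : seq (Zw w)) (s : Zw w) i : (i < n)%N ->
  exists i', [/\ (i' < n)%N, slot n (i'%:R + s) = slot n (i%:R + s) & forall r,
    nth 0 (scatter n arr s r) (slot n (i%:R + s)) = nth 0 arr i' + r].
Proof.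
move=> hi; have him : i \in iota 0 n by rewrite mem_iota.
have [i' [i's e h]] := nth_scatter_step (fun i => slot n (i%:R + s)) (fun i => nth 0 arr i) him.
move: i's; rewrite mem_iota /= add0n => i's; exists i'; split => // r.
exact: h.
Qed.

(** * Hybrid arguments *)

Lemma gap_bind (A : Type) (m : dist A) V W F e :
  sure m (fun a => gap (V a) (W a) F <= e) -> gap (bind m V) (bind m W) F <= e.
Proof. by rewrite /gap !ex_bind; apply: ex_dist_le. Qed.

(** The intermediate hybrid is [V'] with [W]. *)
Lemma gap_pair (V V' W W' : dist (seq bits)) (G : seq bits -> seq bits -> rat) d e :
  sure W (fun t => gap V V' (fun z => G z t) <= d) ->
  sure V' (fun z => gap W W' (fun t => G z t) <= e) ->
  `|ex V (fun z => ex W (fun t => G z t)) - ex V' (fun z => ex W' (fun t => G z t))| <= d + e.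
Proof.
move=> h1 h2.
apply: le_trans (ler_distD (ex V' (fun z => ex W (fun t => G z t))) _ _) _.
apply: lerD; last exact: ex_dist_le h2.
by rewrite [X in `|X - _|]exC [X in `|_ - X|]exC; apply: ex_dist_le h1.
Qed.

Lemma eq_gap V W F F' : F =1 F' -> gap V W F = gap V W F'.
Proof. by move=> e; rewrite /gap (eq_ex V e) (eq_ex W e). Qed.

Fixpoint vcats (Vs : seq (dist (seq bits))) : dist (seq bits) :=
  if Vs is V :: Vs' then vcat V (vcats Vs') else Ret [::].

Lemma sure_rep_size V N n : sure V (fun s => vsize s <= N)%N ->
  sure (rep V n) (fun s => vsize s <= n * N)%N.
Proof.
move=> h; elim: n => //= n IH; apply/sure_bind; move: h; apply: sure_imp => s hs.
apply/sure_bind; move: IH; apply: sure_imp => t ht /=.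
by rewrite vsize_cat mulSn leq_add.
Qed.

(** In the intermediate hybrid the head is real and the tail simulated. While the tail is exchanged,
    the head belongs to the left context; while the head is exchanged, the tail belongs to the right
    one. The budget [b] leaves room for both. *)
Lemma gap_vcats (F : seq bits -> rat) (b N : nat) (e : rat) (T : Type) (V : T -> dist (seq bits))
    (W : dist (seq bits)) (s : seq T) (R : T -> Prop) :
  (forall a, R a -> sure (V a) (fun s => vsize s <= N)%N) ->
  sure W (fun s => vsize s <= N)%N ->
  (forall a A B, R a -> (vsize A + vsize B <= b)%N ->
     gap (V a) W (fun z => F (A ++ z ++ B)) <= e) ->
  foldr (fun a P => R a /\ P) True s ->
  forall A B, (vsize A + vsize B + size s * N <= b)%N ->
  gap (vcats (map V s)) (rep W (size s)) (fun z => F (A ++ z ++ B)) <= (size s)%:R * e.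
Proof.
move=> hV hW hgap; elim: s => [|a s IH] /= hR A B hAB.
  by rewrite /gap /= subrr normr0 mul0r.
case: hR => Ra hR; rewrite /gap !ex_vcat.
rewrite -add1n natrD mulrDl mul1r [leRHS]addrC.
apply: le_trans (ler_distD (ex (V a) (fun z => ex (rep W (size s)) (fun t => F (A ++ (z ++ t) ++ B)))) _ _) _.
apply: lerD.
- apply: ex_dist_le; apply: sure_imp (hV a Ra) => z hz.
  have := IH hR (A ++ z) B; rewrite /gap vsize_cat => h.
  rewrite (@eq_ex _ (vcats _) _ (fun t => F ((A ++ z) ++ t ++ B))); last by move=> t; rewrite !catA.
  rewrite (@eq_ex _ (rep _ _) _ (fun t => F ((A ++ z) ++ t ++ B))); last by move=> t; rewrite !catA.
  by apply: h; lia.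
- rewrite [X in `|X - _|]exC [X in `|_ - X|]exC; apply: ex_dist_le.
  apply: sure_imp (sure_rep_size (size s) hW) => t ht.
  rewrite (@eq_ex _ (V a) _ (fun z => F (A ++ z ++ (t ++ B)))); last by move=> z; rewrite -!catA.
  rewrite (@eq_ex _ W _ (fun z => F (A ++ z ++ (t ++ B)))); last by move=> z; rewrite -!catA.
  by apply: hgap => //; rewrite vsize_cat; lia.
Qed.

Section SelectGap.
Variables (ot : ot_protocol) (k w n : nat) (m : bool).
Variables (SS SR : seq bits -> dist (seq bits)) (F : seq bits -> rat).
Variables (b N : nat) (dR dS : rat).
Hypotheses (w_gt0 : (0 < w)%N) (n_gt0 : (0 < n)%N).

Let simR (arr : seq (Zw w)) i := SR (ot_public k w n ++ ot_inR w i ++ [:: enc w (nth 0 arr i)]).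
Let simS (arr : seq (Zw w)) (i : nat) := SS (ot_public k w n ++ ot_inS arr).

Hypothesis gapR : forall (arr : seq (Zw w)) i A B, size arr = n -> (i < n)%N ->
  (vsize A + vsize B <= b)%N ->
  gap (otR ot k n arr i) (simR arr i) (fun z => F (A ++ drop 1 z ++ B)) <= dR.
Hypothesis gapS : forall (arr : seq (Zw w)) i A B, size arr = n -> (i < n)%N ->
  (vsize A + vsize B <= b)%N ->
  gap (otS ot k n arr i) (simS arr i) (fun z => F (A ++ drop n z ++ B)) <= dS.
Hypothesis sizeR : forall (arr : seq (Zw w)) i, size arr = n -> (i < n)%N ->
  sure (otR ot k n arr i) (fun z => vsize z <= N)%N /\ sure (simR arr i) (fun z => vsize z <= N)%N.
Hypothesis sizeS : forall (arr : seq (Zw w)) i, size arr = n -> (i < n)%N ->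
  sure (otS ot k n arr i) (fun z => vsize z <= N)%N /\ sure (simS arr i) (fun z => vsize z <= N)%N.

(** Six ring elements and two OT views make up a [select_view]. *)
Definition select_size : nat := (6 * w.+1 + (N + N))%N.

Lemma slot_lt (c : Zw w) : (slot n c < n)%N. Proof. by rewrite /slot ltn_mod. Qed.

Lemma vsize0 : vsize [::] = 0%N. Proof. by []. Qed.

Lemma vsize_cons s v : vsize (s :: v) = ((size s).+1 + vsize v)%N. Proof. by []. Qed.

(** With all uniform draws fixed, the two OT views are exchanged one after the other, each time with
    the other one as context. *)
Lemma select_gap xs idx A B : (vsize A + vsize B + select_size <= b)%N ->
  gap (select_gen (@otR ot k w n) (@otS ot k w n) m n xs idx) (select_gen simR simS m n xs idx)
    (fun s => F (A ++ s ++ B)) <= dR + dS.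
Proof.
rewrite /select_size => hAB; apply: gap_bind; apply: sureT => s; apply: gap_bind; apply: sureT => r; apply: gap_bind; apply: sureT => r'; apply: gap_bind; apply: sureT => c; apply: gap_bind; apply: sureT => r''; apply: gap_bind; apply: sureT => a; apply: gap_bind; apply: sureT => p.
rewrite /gap ex_bind [X in `|_ - X|]ex_bind.
set arrR := scatter _ _ _ _; set arrS := scatter _ _ _ _.
have sR : size arrR = n by apply: size_scatter.
have sS : size arrS = n by apply: size_scatter.
set iR := slot n _; set iS := slot n _.
have hR : (iR < n)%N := slot_lt _; have hS : (iS < n)%N := slot_lt _.
have szR : sure (simR arrR iR) (fun z => vsize z <= N)%N by case: (sizeR sR hR).
have szS : sure (otS ot k n arrS iS) (fun z => vsize z <= N)%N by case: (sizeS sS hS).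
under eq_ex => zR do rewrite ex_bind.
under [X in `|_ - X|]eq_ex => zR do rewrite ex_bind.
cbn [ex]; apply: gap_pair.
- move: szS; apply: sure_imp => zS hz; have hd := vsize_drop n zS.
  rewrite /select_view /recv_part /sent_part; case: m.
  + rewrite (@eq_gap _ _ _ (fun zR => F ((A ++ [:: enc w s; enc w r; enc w a] ++
      drop n zS ++ [:: enc w r'; enc w (c + r')]) ++ drop 1 zR ++ ([:: enc w p] ++ B)))).
      apply: gapR => //; rewrite !vsize_cat !vsize_cons !size_enc vsize0; lia.
    by move=> zR; rewrite /= -?catA /= -?catA.
  + rewrite (@eq_gap _ _ _ (fun zR => F ((A ++ [:: enc w s; enc w r; enc w r'; enc w (c + r')])
      ++ drop 1 zR ++ ([:: enc w a] ++ drop n zS ++ [:: enc w p] ++ B)))).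
      apply: gapR => //; rewrite !vsize_cat !vsize_cons !size_enc vsize0; lia.
    by move=> zR; rewrite /= -?catA /= -?catA.
- move: szR; apply: sure_imp => zR hz; have hd := vsize_drop 1 zR.
  rewrite /select_view /recv_part /sent_part; case: m.
  + rewrite (@eq_gap _ _ _ (fun zS => F ((A ++ [:: enc w s; enc w r; enc w a]) ++
      drop n zS ++ ([:: enc w r'; enc w (c + r')] ++ drop 1 zR ++ [:: enc w p] ++ B)))).
      apply: gapS => //; rewrite !vsize_cat !vsize_cons !size_enc vsize0; lia.
    by move=> zS; rewrite /= -?catA /= -?catA.
  + rewrite (@eq_gap _ _ _ (fun zS => F ((A ++ [:: enc w s; enc w r; enc w r'; enc w (c + r')]
      ++ drop 1 zR ++ [:: enc w a]) ++ drop n zS ++ ([:: enc w p] ++ B)))).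
      apply: gapS => //; rewrite !vsize_cat !vsize_cons !size_enc vsize0; lia.
    by move=> zS; rewrite /= -?catA /= -?catA.
Qed.

Lemma select_gen_size VR VS xs idx :
  (forall arr i, size arr = n -> (i < n)%N -> sure (VR arr i) (fun z => vsize z <= N)%N) ->
  (forall arr i, size arr = n -> (i < n)%N -> sure (VS arr i) (fun z => vsize z <= N)%N) ->
  sure (@select_gen w VR VS m n xs idx) (fun s => vsize s <= select_size)%N.
Proof.
move=> hR hS; rewrite /select_size.
do 7 ![apply/sure_bind; apply: sureT => ?].
apply/sure_bind; apply: sure_imp (hR _ _ (size_scatter _ _ _ n_gt0) (slot_lt _)) => zR hzR.
apply/sure_bind; apply: sure_imp (hS _ _ (size_scatter _ _ _ n_gt0) (slot_lt _)) => zS hzS.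
have := vsize_drop 1 zR; have := vsize_drop n zS.
rewrite /= /select_view /recv_part /sent_part; case: m;
  rewrite !vsize_cat !vsize_cons !size_enc ?vsize_cat ?vsize0; lia.
Qed.

(* The index is hidden by the other server's rotation, the entry by its mask. *)
Lemma select_gen_sim xs idx i : (i < n)%N -> opened idx = i%:R ->
  deq (select_gen simR simS m n xs idx) (select_sim SS SR m k n [seq part m x | x <- xs]).
Proof.
move=> hi hidx f; rewrite /select_gen /select_sim.
rewrite ex_bind [RHS]ex_bind; apply: eq_ex => s; rewrite ex_bind [RHS]ex_bind; apply: eq_ex => r.
rewrite ex_bind [RHS]ex_bind; apply: eq_ex => r'; rewrite ex_bind [RHS]ex_bind; apply: eq_ex => c.
have [i' [_ _ hn]] := nth_scatter [seq part (~~ m) x | x <- xs] (c - opened idx) hi.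
have hc : slot n (i%:R + (c - opened idx)) = slot n c by rewrite hidx; congr slot; ring.
rewrite hc in hn; rewrite ex_bind [RHS]ex_bind.
rewrite -[RHS](unif_add' (nth 0 [seq part (~~ m) x | x <- xs] i')) //.
apply: eq_ex => r''; rewrite ex_bind [RHS]ex_bind; apply: eq_ex => a.
rewrite ex_bind [RHS]ex_bind; apply: eq_ex => p.
by rewrite ex_bind [RHS]ex_bind /simR hn.
Qed.

End SelectGap.

(** * Views of the input sharing *)

Definition is_server (P : party) : bool := if P is Server _ then true else false.

Lemma ev_give Q w P (a : Zw w) G : ~~ is_server P -> ev Q (give P a) G =
  ex (unif w) (fun r => G (a - r, r)
    (match Q with
     | Server m => [:: enc w (part m (a - r, r))]
     | _ => if P == Q then [:: enc w r] else [::]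
     end)).
Proof.
move=> hP; rewrite /give ev_pbind ev_rand; apply: eq_ex => r.
do 2 rewrite ev_pbind ev_send; rewrite ev_pret /=.
by case: P hP => [||?] // _; case: Q => [||[]].
Qed.

Lemma hid_give m w P (a : Zw w) : (0 < w)%N -> ~~ is_server P -> hid (Server m) w 1 (give P a).
Proof.
move=> w0 hP g; rewrite ev_give // ex_coins_rep //; case: m => //.
by rewrite -[RHS](unif_sub a).
Qed.

Lemma sure_ev Q (A : Type) (m : proto A) (G : A -> seq bits -> Prop) :
  sure m (fun r => G r.1 (filt Q r.2)) <-> ev Q m (fun a v => ind (G a v)) = 1.
Proof. exact: sure_ex. Qed.

Lemma sure_view_pbind Q (A B : Type) (P : proto A) (f : A -> proto B)
    (G : B -> seq bits -> Prop) :
  sure P (fun r => sure (f r.1) (fun q => G q.1 (filt Q r.2 ++ filt Q q.2))) ->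
  sure (pbind P f) (fun q => G q.1 (filt Q q.2)).
Proof.
move=> h; apply/sure_bind; move: h; apply: sure_imp => r h; apply/sure_bind.
by move: h; apply: sure_imp => q; rewrite /= filt_cat.
Qed.

Lemma sure_give m w P (a : Zw w) : ~~ is_server P ->
  sure (give P a) (fun r => opened r.1 = a /\ filt (Server m) r.2 = [:: enc w (part m r.1)]).
Proof.
move=> hP; apply/(sure_ev (Server m) _ (fun r v => opened r = a /\ v = [:: enc w (part m r)])).
rewrite ev_give // -[RHS](ex_const (unif w)); apply: eq_ex => r; apply: indT; split => //.
by rewrite /opened /= subrK.
Qed.

(** A server's shares can be read off its view, so the arrays of the selections are determined by
    strings that the simulator knows. *)
Lemma sure_gives m w P (T : Type) (h : T -> Zw w) (s : seq T) : ~~ is_server P ->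
  sure (pmapM (fun i => give P (h i)) s) (fun r =>
    map (@opened w) r.1 = map h s /\
    filt (Server m) r.2 = [seq enc w a | a <- [seq part m a | a <- r.1]]).
Proof.
move=> hP; elim: s => [|a s IH]; first by [].
apply: (@sure_view_pbind (Server m) _ _ _ _ (fun r v => map (@opened w) r = map h (a :: s) /\
    v = [seq enc w a | a <- [seq part m a | a <- r]])).
move: (sure_give m (h a) hP); apply: sure_imp => r [hr ->].
apply: (@sure_view_pbind (Server m) _ _ _ _ (fun r' v => map (@opened w) r' = map h (a :: s) /\
    _ ++ v = [seq enc w a | a <- [seq part m a | a <- r']])).
by move: IH; apply: sure_imp => q [hq ->] /=; rewrite hr hq cats0.
Qed.

Lemma ev_pmapM_view Q (A B : Type) (f : A -> proto B) (V : A -> dist (seq bits)) (s : seq A) :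
  (forall a g, ev Q (f a) (fun _ v => g v) = ex (V a) g) ->
  forall g, ev Q (pmapM f s) (fun _ v => g v) = ex (vcats (map V s)) g.
Proof.
move=> h; elim: s => [|a s IH] g //.
rewrite [pmapM _ _]/= ev_pbind ex_vcat -h; apply: eq_ev => b v.
rewrite ev_pbind -IH; apply: eq_ev => c v'.
by rewrite ev_pret cats0.
Qed.

(** * The whole view of a server against its simulation *)

Section ServerGap.
Variables (ot : ot_protocol) (k : nat) (p : params) (m : bool).
Variables (SS SR : seq bits -> dist (seq bits)) (F : seq bits -> rat).
Variables (b N : nat) (dR dS : rat).
Hypothesis p_valid : valid_params p.

Let w := plen p.
Let n := pfeat p.
Let simR (arr : seq (Zw w)) i := SR (ot_public k w n ++ ot_inR w i ++ [:: enc w (nth 0 arr i)]).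
Let simS (arr : seq (Zw w)) (i : nat) := SS (ot_public k w n ++ ot_inS arr).

Hypothesis gapR : forall (arr : seq (Zw w)) i A B, size arr = n -> (i < n)%N ->
  (vsize A + vsize B <= b)%N ->
  gap (otR ot k n arr i) (simR arr i) (fun z => F (A ++ drop 1 z ++ B)) <= dR.
Hypothesis gapS : forall (arr : seq (Zw w)) i A B, size arr = n -> (i < n)%N ->
  (vsize A + vsize B <= b)%N ->
  gap (otS ot k n arr i) (simS arr i) (fun z => F (A ++ drop n z ++ B)) <= dS.
Hypothesis sizeR : forall (arr : seq (Zw w)) i, size arr = n -> (i < n)%N ->
  sure (otR ot k n arr i) (fun z => vsize z <= N)%N /\ sure (simR arr i) (fun z => vsize z <= N)%N.
Hypothesis sizeS : forall (arr : seq (Zw w)) i, size arr = n -> (i < n)%N ->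
  sure (otS ot k n arr i) (fun z => vsize z <= N)%N /\ sure (simS arr i) (fun z => vsize z <= N)%N.

Definition view_size : nat :=
  (count_in p * w.+1 + (count_bits p * 2 + count_out p * w.+1) + pnode p * select_size w N)%N.
Hypothesis le_b : (view_size + select_size w N <= b)%N.

Let w_gt0 : (0 < w)%N := plen_gt0 p.
Let n_gt0 : (0 < n)%N. Proof. by case/and3P: p_valid. Qed.

Lemma vsize_encs (s : seq (Zw w)) : vsize [seq enc w a | a <- s] = (size s * w.+1)%N.
Proof. by elim: s => //= a s IH; rewrite vsize_cons IH size_enc. Qed.

Lemma sure_coins_size v : sure (coins v) (fun s => vsize s <= v.+1)%N.
Proof.
apply/sure_bind; apply: sure_imp (size_tosses v) => s hs /=.
by rewrite vsize1 hs.
Qed.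

Lemma gap_rep_ext V W W' F' c : deq W W' -> gap V W F' <= c -> gap V W' F' <= c.
Proof. by move=> e; rewrite /gap e. Qed.

Let tail := vcat (rep (coins 1) (count_bits p)) (rep (coins w) (count_out p)).

Lemma sure_rep_count c v : sure (rep (coins v) c) (fun s => size s = c).
Proof.
elim: c => //= c IH; apply/sure_bind; apply/sure_bind; apply: sureT => s.
by apply/sure_bind; move: IH; apply: sure_imp => t /= ->.
Qed.

Lemma sure_tail : sure tail (fun t => vsize t <= count_bits p * 2 + count_out p * w.+1)%N.
Proof.
apply/sure_bind; apply: sure_imp (sure_rep_size (count_bits p) (sure_coins_size 1)) => s hs.
apply/sure_bind; apply: sure_imp (sure_rep_size (count_out p) (sure_coins_size w)) => t ht /=.
by rewrite vsize_cat leq_add.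
Qed.

Lemma selects_gap xs ids A :
  size xs = n ->
  foldr (fun a P => (exists2 i, (i < n)%N & opened a = i%:R) /\ P) True ids ->
  size ids = pnode p -> vsize A = (count_in p * w.+1)%N ->
  `|ex (vcats [seq select_gen (@otR ot k w n) (@otS ot k w n) m n xs a | a <- ids])
      (fun v => ex tail (fun t => F (A ++ v ++ t)))
    - ex (rep (select_fun SS SR m (ot_public k w n
         ++ [seq enc w a | a <- [seq part m a | a <- xs]])) (pnode p))
      (fun v => ex tail (fun t => F (A ++ v ++ t)))| <= (pnode p)%:R * (dR + dS).
Proof.
move=> hxs hids sids hA.
rewrite [X in `|X - _|]exC [X in `|_ - X|]exC; apply: ex_dist_le.
apply: sure_imp sure_tail => t ht.
have hsim i a : (i < n)%N -> opened a = i%:R ->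
    deq (select_gen simR simS m n xs a)
      (select_fun SS SR m (ot_public k w n ++ [seq enc w a | a <- [seq part m a | a <- xs]])).
  move=> hi ha f; rewrite (@select_funE SS SR m k w n) ?size_map //.
  exact: (select_gen_sim _ _ _ _ w_gt0 xs hi ha).
(* The budget for the contexts of a whole selection is smaller by [select_size]: around one OT view
   the rest of its selection is context too. *)
rewrite -sids; apply: (@gap_vcats F (b - select_size w N) (select_size w N) _ _ _ _ _ _ _ _ _ hids).
- move=> a [i hi ha]; apply: select_gen_size => // arr j h1 h2.
    by case: (sizeR h1 h2).
  by case: (sizeS h1 h2).
(* The size bound for the simulated selection is inherited from [select_gen] through [hsim],
   instantiated at the index 0. *)
- have hz : opened ((0, 0) : share w) = 0%:R by rewrite /opened addr0.
  apply: (sure_deq (hsim 0%N (0, 0) n_gt0 hz)).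
  apply: select_gen_size => // arr j h1 h2.
    by case: (sizeR h1 h2).
  by case: (sizeS h1 h2).
- move=> a A' B' [i hi ha] hAB; apply: gap_rep_ext (hsim i a hi ha) _.
  apply: (select_gap m w_gt0 n_gt0 gapR gapS sizeR sizeS xs a).
  by move: hAB; rewrite leq_subRL; [rewrite addnC|apply: leq_trans le_b; apply: leq_addl].
- rewrite leq_subRL; last by apply: leq_trans le_b; apply: leq_addl.
  by apply: leq_trans le_b; rewrite /view_size sids hA; lia.
Qed.

Lemma server_gap (T : dtree p) (x : features p) :
  `|ev (Server m) (protocol ot k T x) (fun _ v => F v)
    - ex (server_sim SS SR m k p) F| <= (pnode p)%:R * (dR + dS).
Proof.
pose selects u := rep (select_fun SS SR m (ot_public k w n ++ u)) (pnode p).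
pose H v1 v2 v3 v4 := ex (selects v1) (fun v => ex tail (fun t =>
  F ((v1 ++ (v2 ++ (v3 ++ v4))) ++ v ++ t))).
(* The initial random strings of the simulator are exchanged for the server's view of the real input
   sharing; from then on both experiments share the same strings, and the comparison is made for
   fixed shares. *)
have -> : ex (server_sim SS SR m k p) F =
    ev (Server m) (pmapM (give Client) (tval x)) (fun _ v1 =>
    ev (Server m) (pmapM (give Provider) (tval (thr T))) (fun _ v2 =>
    ev (Server m) (pmapM (give Provider) (tval (leafval T))) (fun _ v3 =>
    ev (Server m) (pmapM (fun i : 'I_(pfeat p) =>
                 give Provider ((i : nat)%:R : Zw w)) (tval (sel T)))
       (fun _ v4 => H v1 v2 v3 v4)))).
  have hg P (A : Type) (h : A -> Zw w) s : ~~ is_server P ->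
      hid (Server m) w (size s) (pmapM (fun a => give P (h a)) s).
    by move=> hP; rewrite -[size s]muln1; apply: hid_pmapM => a; apply: hid_give.
  rewrite (hg Client _ id) // /server_sim /count_in -/w -/n ex_bind rep_add ex_vcat.
  rewrite size_tuple; apply: eq_ex_sure; apply: sure_imp (sure_rep_count n w) => v1 hv1.
  rewrite (hg Provider _ id) // size_tuple rep_add ex_vcat; apply: eq_ex => v2.
  rewrite (hg Provider _ id) // size_tuple rep_add ex_vcat; apply: eq_ex => v3.
  rewrite (hg Provider _ (fun i : 'I_(pfeat p) => (i : nat)%:R)) // size_tuple; apply: eq_ex => v4.
  rewrite take_size_cat // ex_vcat; cbn [ex]; rewrite ex_vcat.
  by apply: eq_ex => v5; apply: eq_ex => t; rewrite !catA.
rewrite protocolE ev_pbind; apply: ex_dist_le.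
move: (sure_gives m id (tval x) (isT : ~~ is_server Client)); apply: sure_imp => -[xs l1] /= [hxs ->].
have {hxs} hxs : size xs = n by rewrite -(size_map (@opened w)) hxs size_map size_tuple.
rewrite ev_pbind; apply: ex_dist_le.
move: (sure_gives m id (tval (thr T)) (isT : ~~ is_server Provider)).
apply: sure_imp => -[ys l2] /= [hys ->].
have {hys} hys : size ys = pnode p by rewrite -(size_map (@opened w)) hys size_map size_tuple.
rewrite ev_pbind; apply: ex_dist_le.
move: (sure_gives m id (tval (leafval T)) (isT : ~~ is_server Provider)).
apply: sure_imp => -[us l3] /= [hus ->].
have {hus} hus : size us = pleaf p by rewrite -(size_map (@opened w)) hus size_map size_tuple.
rewrite ev_pbind; apply: ex_dist_le.
move: (sure_gives m (fun i : 'I_(pfeat p) => (i : nat)%:R : Zw w) (tval (sel T)) (isT : ~~ is_server Provider)).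
apply: sure_imp => -[ids l4] /= [hids ->].
have sids : size ids = pnode p by rewrite -(size_map (@opened w)) hids size_map size_tuple.
rewrite ev_pbind.
set e1 := map _ _; set e2 := map _ _; set e3 := map _ _; set e4 := map _ _.
have -> : ev (Server m) (pmapM (select ot k (pfeat p) xs) ids) (fun a s =>
     ev (Server m) (evaluate a ys us) (fun b t => F (e1 ++ (e2 ++ (e3 ++ (e4 ++ (s ++ t))))))) =
   ex (vcats [seq select_gen (@otR ot k w n) (@otS ot k w n) m n xs a | a <- ids])
      (fun v => ex tail (fun t => F ((e1 ++ (e2 ++ (e3 ++ e4))) ++ v ++ t))).
  rewrite -(ev_pmapM_view (Q := Server m) (f := select ot k (pfeat p) xs)); last first.
    by move=> a g; apply: select_view_real.
  apply: eq_ex_sure; move: (size_pmapM (select ot k (pfeat p) xs) ids).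
  apply: sure_imp => r hr; rewrite (@evaluate_view m p r.1 ys us (fun t => F (e1 ++ (e2 ++ (e3 ++ (e4 ++ (filt (Server m) r.2 ++ t))))))) //.
  - by apply: eq_ex => t; rewrite -!catA.
  - by case/and3P: p_valid.
  - by rewrite hr.
rewrite /H /selects /e1; apply: selects_gap => //.
- move: hids; clear; move: (tval (sel T)) => s.
  elim: s ids => [|i s IH] [|a ids] //= [ha /IH h]; split => //.
  by exists (i : nat) => //; apply: ltn_ord.
- rewrite !vsize_cat !vsize_encs !size_map hxs hys hus sids /count_in; lia.
Qed.

End ServerGap.

Lemma view_ex ot k p P (a : dtree p * features p) F :
  ex (view ot k P a) F =
  ev P (protocol ot k a.1 a.2) (fun _ v => F (party_input P a.1 a.2 ++ v)).
Proof. by rewrite /view /view_of ex_bind. Qed.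

Lemma pr_run (V : dist (seq bits)) (D : seq bits -> dist (seq bits)) h :
  pr (bind V (fun s => D (h ++ s))) accepts = ex V (fun s => pr (D (h ++ s)) accepts).
Proof. by rewrite prE ex_bind; apply: eq_ex => s; rewrite prE. Qed.

(** * Indistinguishability for a corrupted server *)

Section Security.
Variables (par : nat -> params) (ot : ot_protocol).
Hypothesis par_valid : forall k, valid_params (par k).
Hypothesis par_poly : poly_bounded
  (fun k => (plen (par k) + pfeat (par k) + pleaf (par k))%N).

Lemma pb_plen : poly_bounded (fun k => plen (par k)).
Proof. by apply: pb_le par_poly => k; lia. Qed.
Lemma pb_pfeat : poly_bounded (fun k => pfeat (par k)).
Proof. by apply: pb_le par_poly => k; lia. Qed.
Lemma pb_pleaf : poly_bounded (fun k => pleaf (par k)).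
Proof. by apply: pb_le par_poly => k; lia. Qed.
Lemma pb_pnode : poly_bounded (fun k => pnode (par k)).
Proof. by apply: pb_le pb_pleaf => k; rewrite /pnode /pleaf leq_pred. Qed.

Ltac pb := repeat first
  [ exact: pb_plen | exact: pb_pfeat | exact: pb_pleaf | exact: pb_pnode
  | assumption | apply: pb_add | apply: pb_mul | apply: pb_const | apply: pb_id ].

Lemma pb_count_out : poly_bounded (fun k => count_out (par k)).
Proof.
rewrite /count_out; apply: pb_le (_ : poly_bounded (fun k =>
  5 * (pnode (par k) + (pleaf (par k) * pleaf (par k) + pleaf (par k))))%N); last by pb.
move=> k; rewrite leq_mul2l /= leq_add2l leq_add2r leq_mul2l; apply/orP; right.
by apply: leq_trans (leq_subr _ _) _; apply: ltnW; apply: ltn_expl.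
Qed.

Lemma pb_count_bits : poly_bounded (fun k => count_bits (par k)).
Proof.
rewrite /count_bits /muls_msb; apply: pb_le (_ : poly_bounded (fun k =>
  5 * (pnode (par k) * (plen (par k) + (plen (par k) + plen (par k)))))%N); last by pb.
move=> k; rewrite leq_mul2l leq_mul2l; apply/orP; right; apply/orP; right; lia.
Qed.

Lemma server_secure (m : bool) : ot_secure ot par -> exists2 SimC, ppt SimC &
  cind (fun k (a : dtree (par k) * features (par k)) => view ot k (Server m) a)
       (fun k a => SimC (public k (par k))).
Proof.
case=> [[_ _ [c0 eff]] _ [SS pS simS] [SR pR simR]].
exists (fun v => block_out (server_prog SS SR m) (load v)); first exact: ppt_server.
move=> D adv pD padv.
have [qS [pbS mS hS]] := ppt_size pS; have [qR [pbR mR hR]] := ppt_size pR.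
pose l k := plen (par k); pose n k := pfeat (par k).
(* [inp] bounds the arguments of both OT simulators, [N] every OT view, real or simulated, and
   [bound] the context of an OT view. *)
pose inp k := (k + l k + n k + 3 + (n k + 2) * (l k + 1))%N.
pose N k := ((n k + 1) * (l k + 1) + (k ^ c0 + c0) + qS (inp k) + qR (inp k))%N.
pose bound k := (view_size (par k) (N k) + select_size (l k) (N k))%N.
have pinp : poly_bounded inp by rewrite /inp /l /n; pb.
have pN : poly_bounded N.
  have pc : poly_bounded (fun k => k ^ c0 + c0)%N by exists c0.
  have p1 : poly_bounded (fun k => qS (inp k)) by apply: pb_comp.
  have p2 : poly_bounded (fun k => qR (inp k)) by apply: pb_comp.
  by rewrite /N /l /n; do ![assumption|apply: pb_add|apply: pb_mul|apply: pb_const|exact: pb_plen|exact: pb_pfeat].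
have pl1 : poly_bounded (fun k => (plen (par k)).+1).
  by apply: (@pb_le _ (fun k => plen (par k) + 1)%N) => [k|]; [lia|pb].
have psel : poly_bounded (fun k => select_size (l k) (N k)).
  rewrite /select_size /l.
  by do ![assumption|apply: pb_add|apply: pb_mul|apply: pb_const].
have pbound : poly_bounded bound.
  rewrite /bound /view_size /count_in.
  have := pb_count_bits; have := pb_count_out => h1 h2.
  by do ![assumption|apply: pb_add|apply: pb_mul|apply: pb_const|exact: pb_pnode|exact: pb_pleaf|exact: pb_pfeat].
(* The hardwired advice includes the advice of the given distinguisher; the last two terms cover the
   number of dropped strings, [n] for a sender and 1 for a receiver. *)
have pctx : poly_bounded (fun k => vsize (adv k) + bound k + n k + 1)%N.
  by rewrite /n; do ![assumption|apply: pb_add|apply: pb_const|exact: pb_pfeat].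
have [dS nS gapS] := cind_hardwired simS pD pctx.
have [dR nR gapR] := cind_hardwired simR pD pctx.
exists (fun k => (pnode (par k))%:R * (dR k + dS k)).
  by apply: neg_mul; [apply: neg_add|exact: pb_pnode].
move=> k a; cbv zeta beta; rewrite !(pr_run _ _ (nseq k true :: adv k)).
rewrite server_progE view_ex.
have lastR (arr : seq (Zw (l k))) i (hs : size arr = n k) (hi : (i < n k)%N) :
    exists t : (n k).-tuple (Zw (l k)), exists j : 'I_(n k), [/\ tval t = arr, j = i :> nat &
      tnth t j = nth 0 arr i].
  have hs' : size arr == n k by apply/eqP.
  by exists (Tuple hs'), (Ordinal hi); split => //; rewrite (tnth_nth 0).
pose F s := pr (D (nseq k true :: adv k ++ s)) accepts.
apply: (@server_gap ot k (par k) m SS SR F (bound k) (N k) (dR k) (dS k)) => //.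
- move=> arr i A B hs hi hAB; have [t [j [<- <- <-]]] := lastR arr i hs hi.
  have := gapR k (t, j) 1%N (adv k ++ A) B _.
  rewrite (@eq_gap _ _ _ (fun z => F (A ++ drop 1 z ++ B))) => [|z]; last by rewrite /F !catA.
  by apply; rewrite vsize_cat; lia.
- move=> arr i A B hs hi hAB; have [t [j [<- <- _]]] := lastR arr i hs hi.
  have := gapS k (t, j) (n k) (adv k ++ A) B _.
  rewrite (@eq_gap _ _ _ (fun z => F (A ++ drop (n k) z ++ B))) => [|z]; last by rewrite /F !catA.
  by apply; rewrite vsize_cat; lia.
- move=> arr i hs hi; split.
    have [t [j [<- <- _]]] := lastR arr i hs hi.
    have := (sure_pr _ _).1 (eff k (t, j)).
    move=> h; apply/sure_bind; move: h; apply: sure_imp => o ho /=.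
    by rewrite vsize_cons size_encn /N /l; lia.
  apply: sure_imp (hR _) => z hz; apply: leq_trans hz _; rewrite /N.
  apply: leq_trans (leq_addl _ _); apply: mR.
  rewrite vsize_cat /ot_public /ot_inR /= !vsize_cons !size_nseq size_encn size_enc vsize0 /inp /l /n.
  by nia.
- move=> arr i hs hi; split.
    have [t [j [<- <- _]]] := lastR arr i hs hi.
    have := (sure_pr _ _).1 (eff k (t, j)).
    move=> h; apply/sure_bind; move: h; apply: sure_imp => o ho /=.
    rewrite vsize_cat /ot_inS vsize_encs size_tuple /N /l -/(n k); nia.
  apply: sure_imp (hS _) => z hz; apply: leq_trans hz _; rewrite /N.
  rewrite -addnA; apply: leq_trans (leq_addl _ _); apply: leq_trans (leq_addr _ _); apply: mS.
  rewrite vsize_cat /ot_public /ot_inS vsize_encs hs !vsize_cons !size_nseq vsize0 /inp /l /n.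
  by nia.
Qed.

End Security.

(** * Steps that leave no trace in the view of the provider or the client *)

Definition silent (Q : party) (A : Type) (P : proto A) : Prop :=
  sure P (fun r => filt Q r.2 = [::]).

Section Silent.
Variable Q : party.
Hypothesis Q_user : ~~ is_server Q.

Lemma silent_pret (A : Type) (a : A) : silent Q (pret a). Proof. by []. Qed.

Lemma silent_pbind (A B : Type) (P : proto A) (f : A -> proto B) :
  silent Q P -> (forall a, silent Q (f a)) -> silent Q (pbind P f).
Proof.
move=> h1 h2; apply/sure_bind; move: h1; apply: sure_imp => r h; apply/sure_bind.
by move: (h2 r.1); apply: sure_imp => q /= h'; rewrite filt_cat h h'.
Qed.

Lemma silent_dealer w : silent Q (dealer w).
Proof. by apply/sure_bind; apply: sureT. Qed.

Lemma silent_rand w P : P != Q -> silent Q (rand w P).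
Proof. by move=> h; apply/sure_bind; apply: sureT => a; rewrite /= /filt /= (negPf h). Qed.

Lemma silent_send w P a : P != Q -> silent Q (send w P a).
Proof. by move=> h; rewrite /silent /= /filt /= (negPf h). Qed.

Lemma server_neq m : Server m != Q.
Proof. by apply/eqP => e; move: Q_user; rewrite -e. Qed.

Lemma silent_pmapM (A B : Type) (f : A -> proto B) s :
  (forall a, silent Q (f a)) -> silent Q (pmapM f s).
Proof.
move=> h; elim: s => [|a s IH]; first exact: silent_pret.
by apply: silent_pbind => // b; apply: silent_pbind => // bs; apply: silent_pret.
Qed.

Lemma silent_ot ot k w n m (arr : seq (Zw w)) i : silent Q (ot_step ot k n m arr i).
Proof.
apply/sure_bind; apply: sureT => o; rewrite /= filt_cat /filt.
by rewrite !filter_map !(@eq_filter _ _ pred0) ?filter_pred0 // => s /=;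
   apply/negP; apply/negP; apply: server_neq.
Qed.

Ltac silent := repeat first
  [ apply: silent_pret | apply: silent_dealer | apply: silent_rand; exact: server_neq
  | apply: silent_send; exact: server_neq | apply: silent_ot
  | apply: silent_pbind; [|move=> ?] | apply: silent_pmapM => ? ].

Lemma silent_give w P (a : Zw w) : P != Q -> silent Q (give P a).
Proof. by move=> h; apply: silent_pbind => [|r]; [apply: silent_rand|silent]. Qed.

Lemma silent_mulsh w (a b : share w) : silent Q (mulsh a b).
Proof. by rewrite /mulsh /deal; silent. Qed.

Lemma silent_select ot k w n (xs : seq (share w)) idx : silent Q (select ot k n xs idx).
Proof. by rewrite /select /fetch; silent. Qed.

Lemma silent_diamond_G hi lo : silent Q (diamond_G hi lo).
Proof. by apply: silent_pbind => [|?]; [apply: silent_mulsh|silent]. Qed.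

Lemma silent_diamond hi lo : silent Q (diamond hi lo).
Proof.
apply: silent_pbind => [|?]; first exact: silent_diamond_G.
by apply: silent_pbind => [|?]; [apply: silent_mulsh|silent].
Qed.

Lemma silent_carry n s : silent Q (carry_rounds n s).
Proof.
elim: n s => [|[|n] IH] s; [silent|exact: silent_diamond_G|].
by apply: silent_pbind => [|?]; [apply: silent_pmapM => ?; apply: silent_diamond|exact: IH].
Qed.

Lemma silent_msb e (d : share (2 ^ e)) : silent Q (msb_share d).
Proof.
apply: silent_pbind => [|?].
  by apply: silent_pmapM => ?; apply: silent_pbind => [|?]; [apply: silent_mulsh|silent].
apply: silent_pbind => [|?]; first by apply: silent_pmapM => ?; apply: silent_diamond.
by apply: silent_pbind => [|?]; [apply: silent_carry|silent].
Qed.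

Lemma silent_lift w v : silent Q (lift_share w v).
Proof. by apply: silent_pbind => [|?]; [apply: silent_mulsh|silent]. Qed.

Lemma silent_prodsh w (s : seq (share w)) : silent Q (prodsh s).
Proof.
case: s => [|a s]; first by silent.
elim: s a => [|b s IH] a; first by silent.
by apply: silent_pbind => [|?]; [apply: silent_mulsh|exact: IH].
Qed.

Lemma silent_hid w (A : Type) (P : proto A) : silent Q P -> hid Q w 0 P.
Proof.
move=> h g; rewrite -[RHS](ex_const P); apply: eq_ex_sure.
by move: h; apply: sure_imp => r /= ->.
Qed.

Lemma hid_give_user w (a : Zw w) : (0 < w)%N -> hid Q w 1 (give Q a).
Proof.
move=> w0 g; rewrite ev_give // ex_coins_rep //; apply: eq_ex => r.
by case: Q Q_user => [||?].
Qed.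

End Silent.

Lemma silent_infer_provider p (vs us : seq (share (plen p))) : silent Provider (infer vs us).
Proof.
apply: silent_pbind => [|gs]; first by apply: silent_pmapM => z; apply: silent_prodsh.
apply: silent_pbind => [|gus]; first by apply: silent_pmapM => z; apply: silent_mulsh.
by do 2 (apply: silent_pbind => [|?]; first exact: silent_send).
Qed.

Lemma provider_view ot k p (a : dtree p * features p) F :
  ex (view ot k Provider a) F =
  ex (block_out provider_prog (load (public k p ++ enc_dtree a.1))) F.
Proof.
have w0 := plen_gt0 p; rewrite view_ex provider_progE ex_vcat; cbn [ex].
have hg (A : Type) (h : A -> Zw (plen p)) s :
    hid Provider (plen p) (size s) (pmapM (fun a => give Provider (h a)) s).
  by rewrite -[size s]muln1; apply: hid_pmapM => i; apply: hid_give_user.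
have : hid Provider (plen p) (0 + (size (thr a.1) + (size (leafval a.1) + (size (sel a.1) + (0 + 0)))))
    (protocol ot k a.1 a.2).
  rewrite protocolE; apply: hid_bindT => [|xs].
    by apply: silent_hid; apply: silent_pmapM => i; apply: silent_give.
  apply: hid_bindT => [|ys]; first exact: (hg _ id).
  apply: hid_bindT => [|us]; first exact: (hg _ id).
  apply: hid_bindT => [|ids]; first exact: hg.
  apply: hid_bindT => [|sx]; apply: silent_hid.
    by apply: silent_pmapM => i; apply: silent_select.
  apply: silent_pbind => [|bs]; first by apply: silent_pmapM => i; apply: silent_msb.
  apply: silent_pbind => [|vs]; last exact: silent_infer_provider.
  by apply: silent_pmapM => i; apply: silent_lift.
by rewrite !size_tuple !addn0 add0n => ->.
Qed.

Section Provider.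
Variables (par : nat -> params) (ot : ot_protocol).

Lemma provider_secure : exists2 SimP, ppt SimP &
  cind (fun k (a : dtree (par k) * features (par k)) => view ot k Provider a)
       (fun k a => SimP (public k (par k) ++ enc_dtree a.1)).
Proof.
exists (fun v => block_out provider_prog (load v)); first exact: ppt_provider.
move=> D adv pD padv; exists (fun=> 0); first exact: neg0.
move=> k a; cbv zeta beta; rewrite !(pr_run _ _ (nseq k true :: adv k)) provider_view.
by rewrite subrr normr0.
Qed.

End Provider.

(** * Correctness up to a failure probability *)

Definition fail (A : Type) (m : proto A) (E : A -> Prop) : rat :=
  ex m (fun r => ind (~ E r.1)).

Lemma fail_sure (A : Type) (m : proto A) (E : A -> Prop) :
  sure m (fun r => E r.1) -> fail m E <= 0.
Proof.
move=> h; rewrite -[leRHS](ex_const m); apply: ex_le_sure.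
by move: h; apply: sure_imp => r h; rewrite indF.
Qed.

(** Union bound: either the first stage misses [E], or the second misses [E'] from a value in
    [E]. *)
Lemma fail_bind (A B : Type) (P : proto A) (f : A -> proto B) E E' e1 e2 :
  0 <= e2 -> fail P E <= e1 -> (forall a, E a -> fail (f a) E' <= e2) ->
  fail (pbind P f) E' <= e1 + e2.
Proof.
move=> e20 h1 h2; apply: le_trans (lerD h1 (lexx e2)).
rewrite /fail /pbind ex_bind -{1}(ex_const P e2) -exD; apply: ex_le => r.
rewrite ex_bind; cbn [ex fst].
have [hE|hE] := classic (E r.1).
  by rewrite (indF (P := ~ E r.1)) ?add0r; [exact: h2|move/(_ hE)].
rewrite (indT hE); apply: le_trans (_ : 1 <= _); last by rewrite lerDl.
by case/andP: (ex01 (f r.1) (fun q => ind01 (~ E' q.1))).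
Qed.

Lemma fail_pmapM (A B C : Type) (f : A -> proto B) (v : B -> C) (h : A -> C) (R : A -> Prop)
    s e : 0 <= e -> (forall a, R a -> fail (f a) (fun b => v b = h a) <= e) ->
  foldr (fun a P => R a /\ P) True s ->
  fail (pmapM f s) (fun bs => map v bs = map h s) <= (size s)%:R * e.
Proof.
move=> e0 hf; elim: s => [|a s IH] /= hR; first by rewrite mul0r; apply: fail_sure.
case: hR => Ra hR; rewrite -add1n natrD mulrDl mul1r.
apply: fail_bind (hf a Ra) _; first by rewrite mulr_ge0.
move=> b hb; rewrite -[leRHS]addr0; apply: fail_bind (IH hR) _ => // bs hbs.
by apply: fail_sure; rewrite /= hb hbs.
Qed.

Lemma sure_pmapM (A B C : Type) (f : A -> proto B) (v : B -> C) (h : A -> C) s :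
  (forall a, sure (f a) (fun r => v r.1 = h a)) ->
  sure (pmapM f s) (fun r => map v r.1 = map h s).
Proof.
move=> hf; elim: s => //= a s IH; apply: (@sure_pbind _ _ _ _ (fun bs => map v bs = _)).
move: (hf a); apply: sure_imp => r hr; apply: (@sure_pbind _ _ _ _ (fun bs => map v bs = _)).
by move: IH; apply: sure_imp => q hq; rewrite /= hr hq.
Qed.

(** As [P] leaves no trace in the view, only the continuation is compared with the constant when [E]
    holds; when it fails the error is at most 1, both terms lying between 0 and 1. *)
Lemma ev_fail Q (A B : Type) (P : proto A) (f : A -> proto B) (E : A -> Prop)
    (g : seq bits -> rat) c e1 e2 :
  silent Q P -> (forall v, 0 <= g v <= 1) -> 0 <= c <= 1 -> 0 <= e2 ->
  fail P E <= e1 ->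
  (forall a, E a -> `|ev Q (f a) (fun _ v => g v) - c| <= e2) ->
  `|ev Q (pbind P f) (fun _ v => g v) - c| <= e1 + e2.
Proof.
move=> hP g01 c01 e20 h1 h2; rewrite ev_pbind -[X in `|_ - X|](ex_const P) exB.
apply: le_trans (ex_abs _ _) _; apply: le_trans (lerD h1 (lexx e2)).
rewrite /fail -{1}(ex_const P e2) -exD; apply: ex_le_sure; move: hP; apply: sure_imp => r ->.
have [hE|hE] := classic (E r.1).
  by rewrite (indF (P := ~ E r.1)) ?add0r; [exact: h2|move/(_ hE)].
rewrite (indT hE); apply: le_trans (_ : 1 <= _); last by rewrite lerDl.
have /andP[? ?] : 0 <= ev Q (f r.1) (fun _ v => g ([::] ++ v)) <= 1 by apply: ex01.
by move: c01 => /andP[? ?]; rewrite ler_norml; lra.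
Qed.

Lemma ex_fail (A B : Type) (m : dist A) (f : A -> proto B) E (G : A -> Prop) e1 e2 :
  0 <= e2 -> ex m (fun a => ind (~ G a)) <= e1 -> (forall a, G a -> fail (f a) E <= e2) ->
  ex m (fun a => fail (f a) E) <= e1 + e2.
Proof.
move=> e20 h1 h2; apply: le_trans (lerD h1 (lexx e2)).
rewrite -{1}(ex_const m e2) -exD; apply: ex_le => a.
have [hG|hG] := classic (G a).
  by rewrite (indF (P := ~ G a)) ?add0r; [exact: h2|move/(_ hG)].
rewrite (indT hG); apply: le_trans (_ : 1 <= _); last by rewrite lerDl.
by case/andP: (ex01 (f a) (fun q => ind01 (~ E q.1))).
Qed.

(** * Collisions of slots under a rotation *)

Section Slots.
Variables (w n : nat).
Hypotheses (w_gt0 : (0 < w)%N) (n_gt0 : (0 < n)%N).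

Definition no_clash (i : nat) (s : Zw w) : Prop := forall i', (i' < n)%N ->
  slot n ((i'%:R : Zw w) + s) = slot n ((i%:R : Zw w) + s) -> i' = i.

Lemma slot_nat i (s : Zw w) : slot n ((i%:R : Zw w) + s) = ((i + s) %% 2 ^ w %% n)%N.
Proof. by rewrite /slot Zw_add // Zw_natr // modnDml. Qed.

(** Without wrap-around modulo [2 ^ w] the shifted indices are [n] consecutive numbers, hence
    distinct modulo [n]. *)
Lemma no_clash_small i (s : Zw w) : (i < n)%N -> (s + n <= 2 ^ w)%N -> no_clash i s.
Proof.
move=> hi hs i' hi'; rewrite !slot_nat.
have small j : (j < n)%N -> ((j + s) %% 2 ^ w = j + s)%N.
  by move=> hj; rewrite modn_small //; apply: leq_trans hs; rewrite addnC ltn_add2l.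
rewrite !small // => /eqP; rewrite eqn_modDr !modn_small // => /eqP //.
Qed.

(** If [n] divides [2 ^ w], wrap-around is invisible modulo [n]. *)
Lemma no_clash_dvd i (s : Zw w) : (i < n)%N -> (n %| 2 ^ w)%N -> no_clash i s.
Proof.
move=> hi hn i' hi'; rewrite !slot_nat !modn_dvdm // => /eqP.
by rewrite eqn_modDr !modn_small // => /eqP.
Qed.

(** The factor [n] bounds the number of bad rotations; the other factor is the quantity assumed
    negligible in [par_wrap]. *)
Definition wrap_prob : rat := n%:R * (if (n %| 2 ^ w)%N then 0 else (2%:R ^+ w)^-1).

Lemma wrap_ge0 : 0 <= wrap_prob.
Proof. by rewrite mulr_ge0 //; case: ifP => // _; rewrite invr_ge0 exprn_ge0. Qed.

Lemma clash_prob i : (i < n)%N -> ex (unif w) (fun s => ind (~ no_clash i s)) <= wrap_prob.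
Proof.
move=> hi; rewrite /wrap_prob; case: ifP => hn.
  rewrite mulr0 -[leRHS](ex_const (unif w)); apply: ex_le => s.
  by rewrite indF //; apply; apply: no_clash_dvd.
rewrite ex_unif // natrX ler_wpM2r ?invr_ge0 ?exprn_ge0 //.
(* A bad rotation exceeds [2 ^ w - n], so it is [- j] for some [j < n]; this is a union bound over
   [j]. *)
apply: le_trans (_ : \sum_(s : Zw w) \sum_(j < n) ((s == - (j%:R))%:R : rat) <= _).
  apply: ler_sum => s _; have [h|h] := classic (no_clash i s).
    by rewrite indF; [apply: sumr_ge0 => j _|apply].
  rewrite (indT h); have hs : (2 ^ w < s + n)%N.
    by rewrite ltnNge; apply/negP => h'; apply: h; apply: no_clash_small.
  have s_lt := Zw_lt w_gt0 s.
  have jn : (2 ^ w - s < n)%N by rewrite ltn_subLR // ltnW.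
  rewrite (bigD1 (Ordinal jn)) //= natrB ?(ltnW s_lt) // natr_Zp.
  have -> : ((2 ^ w)%N%:R = 0 :> Zw w)%R by apply: val_inj; rewrite /= Zw_natr // modnn.
  by rewrite sub0r opprK eqxx lerDl sumr_ge0.
rewrite exchange_big /=.
rewrite (eq_bigr (fun=> 1)) ?sumr_const ?card_ord // => j _.
rewrite (bigD1 (- (j%:R) : Zw w)) //= eqxx big1 ?addr0 // => s /negPf ->.
by [].
Qed.

Lemma nth_scatter_good (arr : seq (Zw w)) i s r : (i < n)%N -> no_clash i s ->
  nth 0 (scatter n arr s r) (slot n (i%:R + s)) = nth 0 arr i + r.
Proof.
by move=> hi hs; have [i' [hi' /hs -> // ->]] := nth_scatter arr s hi.
Qed.

End Slots.

(** Passing through [ev] unfolds [mulsh] into its five draws; a polynomial identity remains. *)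
Lemma sure_mulsh w (a b : share w) : sure (mulsh a b) (fun r => opened r.1 = opened a * opened b).
Proof.
apply/(sure_ev Provider _ (fun r _ => opened r = opened a * opened b)).
rewrite ev_mulsh -[RHS](ex_const (unif w)); apply: eq_ex => v1.
rewrite -[RHS](ex_const (unif w)); apply: eq_ex => v2.
rewrite -[RHS](ex_const (unif w)); apply: eq_ex => r1.
rewrite -[RHS](ex_const (unif w)); apply: eq_ex => r2.
rewrite -[RHS](ex_const (unif w)); apply: eq_ex => r3.
by apply: indT; rewrite /opened /=; ring.
Qed.

Section SelectCorrect.
Variables (ot : ot_protocol) (k w n : nat) (mu : rat).
Hypotheses (w_gt0 : (0 < w)%N) (n_gt0 : (0 < n)%N) (mu_ge0 : 0 <= mu).
Hypothesis ot_ok : forall (arr : seq (Zw w)) i, size arr = n -> (i < n)%N ->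
  ex (ot_exec ot k n arr i) (fun o => ind (~ (o.1 = nth 0 arr i))) <= mu.

Lemma fail_fetch m (idx : share w) (arr : seq (Zw w)) (s : Zw w) : size arr = n ->
  fail (fetch ot k n m idx arr s) (fun q => q = nth 0 arr (slot n (opened idx + s))) <= mu.
Proof.
move=> harr; rewrite -[fail _ _]/(ev Provider _ (fun q _ => ind (~ q = _))).
rewrite ev_fetch -[leRHS](ex_const (unif w)); apply: ex_le => r.
by apply: ot_ok => //; rewrite /slot ltn_mod.
Qed.

Lemma fail_rand (A : Type) v P (f : Zw v -> proto A) E e :
  ex (unif v) (fun a => fail (f a) E) <= e -> fail (pbind (rand v P) f) E <= e.
Proof.
rewrite -[fail (pbind _ _) _]/(ev Provider _ (fun q _ => ind (~ E q))).
by rewrite ev_pbind ev_rand.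
Qed.

(** The four terms stand for an error in either OT and a clash under either rotation. Otherwise the
    masks [r0], [r1] and [r'] cancel. *)
Lemma fail_select (xs : seq (share w)) (idx : share w) i : (i < n)%N -> opened idx = i%:R ->
  fail (select ot k n xs idx) (fun r => opened r = nth 0 (map (@opened w) xs) i)
    <= (mu + mu) + (wrap_prob w n + wrap_prob w n).
Proof.
move=> hi hidx; have wr0 := wrap_ge0 w n.
have mu2 : 0 <= mu + mu by rewrite addr_ge0.
rewrite [leRHS]addrC -addrA.
apply: fail_rand. apply: (ex_fail _ (clash_prob w_gt0 hi)); first by rewrite addr_ge0.
move=> s0 g0; apply: fail_rand; rewrite -[leRHS](ex_const (unif w)); apply: ex_le => r0.
apply: fail_rand; apply: (ex_fail _ (clash_prob w_gt0 hi)) => //.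
move=> s1 g1; apply: fail_rand; rewrite -[leRHS](ex_const (unif w)); apply: ex_le => r1.
apply: (fail_bind _ (fail_fetch _ _ _ (size_scatter _ _ _ n_gt0))) => // q1 ->.
rewrite -[leRHS]addr0; apply: (fail_bind _ (fail_fetch _ _ _ (size_scatter _ _ _ n_gt0))) => // q0 ->.
apply: fail_rand; rewrite -[leRHS](ex_const (unif w)); apply: ex_le => r'.
apply: fail_sure; apply: (@sure_pbind _ _ _ _ (fun r => opened r = _)) => /=.
rewrite hidx !nth_scatter_good // /opened /=.
have nth_part m : nth 0 [seq part m a | a <- xs] i = part m (nth (0, 0) xs i).
  have [h|h] := ltnP i (size xs); first by rewrite (nth_map (0, 0)).
  by rewrite !nth_default ?size_map //; case: m.
have -> : nth 0 [seq opened a | a <- xs] i = opened (nth (0, 0) xs i).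
  have [h|h] := ltnP i (size xs); first by rewrite (nth_map (0, 0)).
  by rewrite !nth_default ?size_map // /opened addr0.
have h1 := nth_part false; have h2 := nth_part true; rewrite /= in h1 h2.
by rewrite h1 h2 /opened; ring.
Qed.

End SelectCorrect.

(** * Correctness of the comparison *)

Lemma modn_pow2S (a t : nat) : (a %% 2 ^ t.+1 = a %% 2 ^ t + 2 ^ t * odd (a %/ 2 ^ t))%N.
Proof.
set d := (2 ^ t)%N; have d0 : (0 < d)%N by rewrite expn_gt0.
have h : (a %% d < d)%N by rewrite ltn_mod.
have hq := odd_double_half (a %/ d).
rewrite {1}(divn_eq a d) -{1}hq expnS -/d.
have -> : ((odd (a %/ d) + (a %/ d)./2.*2) * d + a %% d =
   (a %/ d)./2 * (2 * d) + (a %% d + d * odd (a %/ d)))%N by rewrite -muln2; ring.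
by rewrite modnMDl modn_small //; case: (odd _); lia.
Qed.

Definition carry (a b t : nat) : bool := (2 ^ t <= a %% 2 ^ t + b %% 2 ^ t)%N.

(** Position [t] either generates a carry or propagates the incoming one. *)
Lemma carryS a b t : carry a b t.+1 =
  (odd (a %/ 2 ^ t) && odd (b %/ 2 ^ t)) ||
  (carry a b t && (odd (a %/ 2 ^ t) (+) odd (b %/ 2 ^ t))).
Proof.
rewrite /carry !modn_pow2S expnS.
have : (a %% 2 ^ t < 2 ^ t)%N by rewrite ltn_mod expn_gt0.
have : (b %% 2 ^ t < 2 ^ t)%N by rewrite ltn_mod expn_gt0.
by case: (odd (a %/ _)); case: (odd (b %/ _)) => /=; lia.
Qed.

Definition carry_op (lo hi : Zw 1 * Zw 1) : Zw 1 * Zw 1 :=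
  (hi.1 + lo.1 * hi.2, hi.2 * lo.2).

(* [carry_op] is the operator on pairs (G, P) with its operands swapped; it is
   associative, so the tree of rounds computes the ripple carry. *)
Definition tot (s : seq (Zw 1 * Zw 1)) : Zw 1 * Zw 1 := foldl carry_op (0, 1) s.

Lemma carry_opA x y z : carry_op x (carry_op y z) = carry_op (carry_op x y) z.
Proof. by rewrite /carry_op /=; congr (_, _); ring. Qed.

Lemma carry_op0 x : carry_op (0, 1) x = x.
Proof. by case: x => a b; rewrite /carry_op /=; congr (_, _); ring. Qed.

Lemma foldl_carry x s : foldl carry_op x s = carry_op x (tot s).
Proof.
rewrite /tot; elim: s x => [|y s IH] x /=.
  by case: x => a b; rewrite /carry_op /=; congr (_, _); ring.
by rewrite IH [in RHS]IH carry_op0 carry_opA.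
Qed.

Lemma tot_cons x s : tot (x :: s) = carry_op x (tot s).
Proof. by rewrite /tot /= carry_op0 foldl_carry. Qed.

Lemma tot_cat s t : tot (s ++ t) = carry_op (tot s) (tot t).
Proof. by rewrite /tot foldl_cat foldl_carry. Qed.

Lemma iota1 h : iota 1 h = [seq k.+1 | k <- iota 0 h].
Proof. by rewrite -[1%N]addn0 iotaDl. Qed.

(** Combining neighbours, as one round does, keeps the total by associativity. *)
Lemma tot_pairs d h s : (h.*2 <= size s)%N ->
  tot [seq carry_op (nth d s k.*2) (nth d s k.*2.+1) | k <- iota 0 h] = tot (take h.*2 s).
Proof.
elim: h s => [|h IH] s; first by rewrite take0.
case: s => [|x [|y s]] // hs.
rewrite -[iota 0 h.+1]/(0%N :: iota 1 h) iota1 map_cons -map_comp !tot_cons -IH; last by move: hs; rewrite /=; lia.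
by rewrite carry_opA.
Qed.

Definition gpv (a : gp) : Zw 1 * Zw 1 := (opened a.1, opened a.2).

Lemma opened_add w (a b : share w) : opened (addsh a b) = opened a + opened b.
Proof. by rewrite /opened /addsh /=; ring. Qed.

Lemma sure_diamond_G hi lo :
  sure (diamond_G hi lo) (fun r => opened r.1 = (carry_op (gpv lo) (gpv hi)).1).
Proof.
apply: (@sure_pbind _ _ _ _ (fun r => opened r = _)).
by move: (sure_mulsh lo.1 hi.2); apply: sure_imp => r hr /=; rewrite opened_add hr.
Qed.

Lemma sure_diamond hi lo : sure (diamond hi lo) (fun r => gpv r.1 = carry_op (gpv lo) (gpv hi)).
Proof.
apply: (@sure_pbind _ _ _ _ (fun r => gpv r = _)).
move: (sure_diamond_G hi lo); apply: sure_imp => g hg.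
apply: (@sure_pbind _ _ _ _ (fun r => gpv r = _)).
by move: (sure_mulsh hi.2 lo.2); apply: sure_imp => q hq /=; rewrite /gpv /= hq hg.
Qed.

Lemma nth_gpv s i : (i < size s)%N -> gpv (nth gp0 s i) = nth (0, 0) (map gpv s) i.
Proof. by move=> h; rewrite (nth_map gp0). Qed.

Lemma sure_carry n s : size s = (2 ^ n)%N ->
  sure (carry_rounds n s) (fun r => opened r.1 = (tot (map gpv s)).1).
Proof.
elim: n s => [|[|n] IH] s hs.
- case: s hs => [|x [|]] // _; cbn [carry_rounds sure pret fst nth map].
  by rewrite tot_cons /carry_op /gpv /=; ring.
- have [x [y ->]] : exists x y, s = [:: x; y].
    by case: s hs => [|x [|y [|z s]]] // _; exists x, y.
  move: (sure_diamond_G y x); apply: sure_imp => r ->.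
  by rewrite !tot_cons /carry_op /=; ring.
- have hs2 : (size s)./2 = (2 ^ n.+1)%N by rewrite hs expnS mul2n doubleK.
  apply: (@sure_pbind _ _ _ _ (fun r => opened r = _)).
  have hp := @sure_pmapM _ _ _ (fun k => diamond (nth gp0 s k.*2.+1) (nth gp0 s k.*2)) gpv
     (fun k => carry_op (gpv (nth gp0 s k.*2)) (gpv (nth gp0 s k.*2.+1)))
     (iota 0 (size s)./2) (fun k => sure_diamond _ _).
  move: hp => /sure_and /(_ (size_pmapM _ _)); apply: sure_imp => r [hr sr].
  rewrite size_iota hs2 in sr.
  move: (IH r.1 sr); apply: sure_imp => q ->; rewrite hr hs2.
  have hd : (2 ^ n.+1).*2 = size s by rewrite hs [in RHS]expnS mul2n.
  have <- : tot (take (2 ^ n.+1).*2 (map gpv s)) = tot (map gpv s).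
    by rewrite hd take_oversize ?size_map.
  rewrite -(@tot_pairs (0, 0)) ?size_map ?hd //; congr (tot _).1.
  apply/eq_in_map => k; rewrite mem_iota add0n => /andP[_ hk].
  by rewrite !nth_gpv //; rewrite -hd; lia.
Qed.

Lemma bitE w (a : Zw w) q : (q < w)%N -> bit a q = odd (a %/ 2 ^ q).
Proof. by move=> h; rewrite /bit /enc /encn nth_mkseq. Qed.

Definition gp_bits w (a b : Zw w) (q : nat) : Zw 1 * Zw 1 :=
  (bitZ2 (bit a q) * bitZ2 (bit b q), bitZ2 (bit a q) + bitZ2 (bit b q)).

Lemma iota_cat t : iota 0 t.+1 = iota 0 t ++ [:: t].
Proof. by rewrite -addn1 iotaD. Qed.

(** Generating and propagating exclude each other, so the sum over [Z_2] in [carry_op] is the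
    disjunction in [carryS]. *)
Lemma tot_carry w (a b : Zw w) t : (t <= w)%N ->
  (tot [seq gp_bits a b q | q <- iota 0 t]).1 = bitZ2 (carry a b t).
Proof.
elim: t => [|t IH] ht; first by rewrite /carry !modn1.
rewrite iota_cat map_cat tot_cat [map _ [:: t]]/= tot_cons [(carry_op _ _).1]/= IH ?(ltnW ht) //.
rewrite carryS /gp_bits !bitE // /tot /=.
by do 2 (case: (odd _)); case: (carry _ _ _); apply/eqP.
Qed.

Lemma msb_add w (a b : Zw w) : (0 < w)%N ->
  msb (a + b) = bit a w.-1 (+) bit b w.-1 (+) carry a b w.-1.
Proof.
move=> w0; have hw : (w.-1 < w)%N by rewrite prednK.
rewrite /msb /bit enc_add // /enc /encn !nth_mkseq // divnD ?expn_gt0 // !oddD.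
by rewrite /carry; case: (_ <= _)%N.
Qed.

Lemma sure_msb e (d : share (2 ^ e)) : (0 < e)%N ->
  sure (msb_share d) (fun r => opened r.1 = bitZ2 (msb (opened d))).
Proof.
move=> e0; set l := (2 ^ e)%N.
have l0 : (0 < l)%N by rewrite expn_gt0.
have he : (l = (2 ^ e.-1).*2)%N by rewrite /l -{1}(prednK e0) expnS mul2n.
have h0 : (0 < 2 ^ e.-1)%N by rewrite expn_gt0.
apply: (@sure_pbind _ _ _ _ (fun r => opened r = _)).
set f := (X in pmapM X _).
have hp := @sure_pmapM _ _ _ f gpv (gp_bits d.1 d.2) (iota 0 l).
have {hp} : sure (pmapM f (iota 0 l)) (fun r => map gpv r.1 = map (gp_bits d.1 d.2) (iota 0 l)).
  apply: hp => q; apply: (@sure_pbind _ _ _ _ (fun r => gpv r = _)).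
  move: (@sure_mulsh 1 (bitZ2 (bit d.1 q), 0) (0, bitZ2 (bit d.2 q))).
  apply: sure_imp => r hr; cbn [sure pret fst]; rewrite /gpv [_.1]/= hr /gp_bits opened_add.
  by rewrite /opened /= addr0 add0r.
apply: sure_imp => -[s lg] /= hs.
have ss : size s = l by rewrite -(size_map gpv) hs size_map size_iota.
apply: (@sure_pbind _ _ _ _ (fun r => opened r = _)).
have hp := @sure_pmapM _ _ _ (fun k => diamond (nth gp0 s k.*2) (nth gp0 s k.*2.-1)) gpv
     (fun k => carry_op (gpv (nth gp0 s k.*2.-1)) (gpv (nth gp0 s k.*2)))
     (iota 1 (l./2).-1) (fun k => sure_diamond _ _).
move: hp => /sure_and /(_ (size_pmapM _ _)); apply: sure_imp => -[s1 lg1] [hs1 ss1].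
rewrite [X in map gpv X]/= in hs1; rewrite [X in size X]/= size_iota he doubleK in ss1.
apply: (@sure_pbind _ _ _ _ (fun r => opened r = _)).
have sz : size (nth gp0 s 0 :: s1) = (2 ^ e.-1)%N by rewrite /= ss1 prednK.
move: (sure_carry sz); apply: sure_imp => c hcv.
cbn [sure pret fst]; rewrite opened_add hcv map_cons hs1 msb_add //.
have hl : (l./2.-1.*2.+1 = l.-1)%N by rewrite he doubleK; lia.
(* Bit 0 enters round 1 alone and pair [k] covers bits [2k - 1] and [2k]; together they are exactly
   the bits below the top one, whose total gives the carry into it. *)
have -> : tot (gpv (nth gp0 s 0) :: [seq carry_op (gpv (nth gp0 s k.*2.-1))
    (gpv (nth gp0 s k.*2)) | k <- iota 1 l./2.-1]) = tot (take l.-1 (map gpv s)).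
  move: ss; case: s {hs hs1 sz hcv s1 lg1 ss1} => [|x s] ss; first by rewrite -ss in l0.
  have ss' : size s = l./2.-1.*2.+1 by rewrite hl -ss.
  rewrite [map gpv _]/= -hl /= !tot_cons -(@tot_pairs (0, 0)); last first.
    by rewrite size_map ss'.
  congr (carry_op _ (tot _)); rewrite iota1 -map_comp; apply/eq_in_map => k.
  rewrite mem_iota add0n => /andP[_ hk].
  have hk2 : (k.*2.+1 < size s)%N by rewrite ss' ltnS ltn_double.
  by rewrite /= !nth_gpv // ltnW.
rewrite hs -map_take take_iota (minn_idPl _) ?leq_pred // tot_carry ?leq_pred //.
rewrite /opened [(_, _).1]/= [(_, _).2]/= -/l.
by case: (bit d.1 _); case: (bit d.2 _); case: (carry _ _ _); apply/eqP.
Qed.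

Lemma bitZ2_nat (b : bool) : (bitZ2 b : nat) = b.
Proof. by case: b. Qed.

Lemma Z2_bool (v : Zw 1) : exists b, v = bitZ2 b.
Proof.
have h := Zw_lt (ltn0Sn 0) v; exists (v == 1%N :> nat); apply/val_inj => /=.
by rewrite bitZ2_nat; case: (v : nat) h => [|[|]].
Qed.

(** The expression [t1 + t2 - 2 * t1 * t2] is exclusive or on bits embedded in a ring. *)
Lemma sure_lift w (v : share 1) b : opened v = bitZ2 b ->
  sure (lift_share w v) (fun r => opened r.1 = b%:R).
Proof.
move=> hv; apply: (@sure_pbind _ _ _ _ (fun r => opened r = _)).
move: (sure_mulsh (((v.1 : nat)%:R, 0) : share w) (0, (v.2 : nat)%:R)).
apply: sure_imp => t ht; cbn [sure pret fst].
move: ht; rewrite /opened /subsh /addsh /scalesh /= addr0 add0r => ht.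
transitivity ((v.1 : nat)%:R + (v.2 : nat)%:R - 2 * (t.1.1 + t.1.2)); first by ring.
rewrite ht; move: hv; rewrite /opened.
have [b1 ->] := Z2_bool v.1; have [b2 ->] := Z2_bool v.2; rewrite !bitZ2_nat.
by case: b1; case: b2; case: b => // _; rewrite /=; ring.
Qed.

(** * Correctness of the inference *)

Lemma sure_prodsh w (s : seq (share w)) :
  sure (prodsh s) (fun r => opened r.1 = \prod_(a <- s) opened a).
Proof.
case: s => [|a s]; first by cbn [prodsh sure pret fst]; rewrite big_nil /opened /= addr0.
rewrite /prodsh big_cons; elim: s a => [|b s IH] a.
  by cbn [prod_from sure pret fst]; rewrite big_nil mulr1.
apply: (@sure_pbind _ _ _ _ (fun r => opened r = _)).
move: (sure_mulsh a b); apply: sure_imp => c hc.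
by move: (IH c.1); apply: sure_imp => r ->; rewrite big_cons hc mulrA.
Qed.

Lemma descendS v d j :
  descend v d.+1 j = ((descend v d j).*2.+1 + v (descend v d j))%N.
Proof. by elim: d j => [|d IH] j //; rewrite -IH. Qed.

Lemma descend_range v d : (2 ^ d <= (descend v d 0).+1 < 2 ^ d.+1)%N.
Proof.
elim: d => [|d IH] //; rewrite descendS !expnS in IH *.
by case: (v _); lia.
Qed.

(** Each factor tests one turn of the descent. In heap order the parent of [n] is [n.-1./2], and [n]
    is a right child exactly when it is even. *)
Lemma path_prod (R : pzRingType) (v : nat -> bool) d n : (2 ^ d <= n.+1 < 2 ^ d.+1)%N ->
  \prod_(e <- path_to d n) (e.2 == v e.1)%:R = (descend v d 0 == n)%:R :> R.
Proof.
elim: d n => [|d IH] n hn.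
  by rewrite big_nil; case: n hn.
rewrite [path_to _ _]/= big_rcons IH; last by move: hn; rewrite !expnS; lia.
rewrite descendS; set D := descend v d 0; set j := (n.-1)./2.
have hnj : n = (j.*2.+1 + ~~ odd n)%N.
  have n1 : (0 < n)%N by move: hn; rewrite !expnS; have : (0 < 2 ^ d)%N by [rewrite expn_gt0]; lia.
  by rewrite /j; case: n n1 {IH hn j} => // n _ /=; have := odd_double_half n; case: (odd n) => /=; lia.
have -> : (D.*2.+1 + v D == n)%N = (D == j) && (v j == ~~ odd n).
  rewrite {1}hnj; apply/eqP/andP => [h|[/eqP -> /eqP ->] //].
  have e : D = j by move: h; case: (v D); case: (odd n) => /=; lia.
  by split; [apply/eqP|]; move: h; rewrite e; case: (v j); case: (odd n) => /=; lia.
by rewrite /= [v j == _]eq_sym; case: (D == j); rewrite ?mul1r ?mul0r.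
Qed.

Lemma path_lt d n e : (n.+1 < 2 ^ d.+1)%N -> e \in path_to d n -> (e.1 < (2 ^ d).-1)%N.
Proof.
elim: d n => [|d IH] n hn //; rewrite [path_to _ _]/= mem_rcons inE => /orP[/eqP ->|/IH h] /=.
  by move: hn; rewrite !expnS; lia.
by apply: leq_trans (h _) _; move: hn; rewrite !expnS; lia.
Qed.

Lemma opened_edge w (vs : seq (share w)) (v : nat -> bool) J e : (e.1 < J)%N ->
  map (@opened w) vs = [seq (v j)%:R | j <- iota 0 J] ->
  opened (edge vs e) = (e.2 == v e.1)%:R.
Proof.
move=> he hvs; have sv : size vs = J by rewrite -(size_map (@opened w)) hvs size_map size_iota.
have hv : opened (nth (0, 0) vs e.1) = (v e.1)%:R.
  rewrite -(nth_map _ 0) ?sv // hvs (nth_map 0%N) ?size_iota //.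
  by rewrite nth_iota.
rewrite /edge; case: (e.2); first by rewrite hv; case: (v e.1).
transitivity (1 - opened (nth (0, 0) vs e.1)); first by rewrite /opened /=; ring.
by rewrite hv; case: (v e.1); rewrite /=; ring.
Qed.

(** The third triple share enters the output additively, so its mask [r3] alone makes the result a
    fresh sharing, whatever the other draws. *)
Lemma ev_mulsh_client w (a b : share w) H : (0 < w)%N ->
  ev Client (mulsh a b) H = ex (unif w) (fun c => H (c, opened a * opened b - c) [::]).
Proof.
move=> w0; rewrite ev_mulsh -[RHS](ex_const (unif w)); apply: eq_ex => v1.
rewrite -[RHS](ex_const (unif w)); apply: eq_ex => v2.
rewrite -[RHS](ex_const (unif w)); apply: eq_ex => r1.
rewrite -[RHS](ex_const (unif w)); apply: eq_ex => r2.
set e := a.1 - _ + _; set f := b.1 - _ + _.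
rewrite -[RHS](unif_sub ((v1 - r1) * f + (v2 - r2) * e + v1 * v2)) //.
apply: eq_ex => r3; congr (H (_, _)); rewrite /e /f /opened; ring.
Qed.

(** One fresh sharing randomizes the whole sum: the draw of the last product is kept and the others
    are averaged away, so the list must be nonempty. *)
Lemma ev_muls_client w (zs : seq (share w * share w)) acc G : (0 < w)%N -> (0 < size zs)%N ->
  ev Client (pmapM (fun a => mulsh a.1 a.2) zs) (fun gus v => G (foldl (@addsh w) acc gus) v) =
  ex (unif w) (fun a => G (a, opened acc + \sum_(z <- zs) opened z.1 * opened z.2 - a) [::]).
Proof.
move=> w0; elim: zs acc => // z zs IH acc _.
rewrite [pmapM _ _]/= ev_pbind ev_mulsh_client //.
have body c : ev Client (let* bs := pmapM (fun a => mulsh a.1 a.2) zs in pret ((c : share w) :: bs))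
     (fun b t => G (foldl (@addsh w) acc b) ([::] ++ t)) =
   ev Client (pmapM (fun a => mulsh a.1 a.2) zs)
     (fun gus v => G (foldl (@addsh w) (addsh acc c) gus) v).
  by rewrite ev_pbind; apply: eq_ev => bs v; rewrite ev_pret cats0.
case: zs IH body => [|z' zs] IH body.
  rewrite -[RHS](unif_add' acc.1) //; apply: eq_ex => c; rewrite body ev_pret.
  by rewrite big_seq1 /addsh /opened /=; congr (G (_, _)); ring.
rewrite -[RHS](ex_const (unif w)); apply: eq_ex => c; rewrite body IH //.
apply: eq_ex => a; rewrite big_cons opened_add; congr (G (_, _)).
have -> : opened (c, opened z.1 * opened z.2 - c) = opened z.1 * opened z.2.
  by rewrite /opened [LHS]addrC subrK.
by rewrite !big_cons; ring.
Qed.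

Lemma ev_out_client w (zs : seq (share w * share w)) g : (0 < w)%N -> (0 < size zs)%N ->
  ev Client (let* gus := pmapM (fun a => mulsh a.1 a.2) zs in
             let u := foldl (@addsh w) (0, 0) gus in
             let* _ := send w Client u.1 in let* _ := send w Client u.2 in pret (u.1 + u.2))
    (fun _ v => g v) =
  ex (unif w) (fun a => g [:: enc w a; enc w (\sum_(z <- zs) opened z.1 * opened z.2 - a)]).
Proof.
move=> w0 hz; rewrite ev_pbind.
transitivity (ev Client (pmapM (fun a => mulsh a.1 a.2) zs) (fun gus v =>
   (fun u v => g (v ++ [:: enc w u.1; enc w u.2])) (foldl (@addsh w) (0, 0) gus) v)).
  by apply: eq_ev => gus v; do 2 rewrite ev_pbind ev_send; rewrite ev_pret.
rewrite (@ev_muls_client w zs (0, 0) (fun u v => g (v ++ [:: enc w u.1; enc w u.2]))) //.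
apply: eq_ex => a /=.
by rewrite {1}/opened /= addr0 add0r.
Qed.

(** * The view of the client *)

Section ClientGap.
Variables (ot : ot_protocol) (k : nat) (p : params) (mu : rat).
Variables (T : dtree p) (x : features p) (g : seq bits -> rat).
Hypothesis p_valid : valid_params p.
Hypothesis mu_ge0 : 0 <= mu.
Hypothesis g01 : forall v, 0 <= g v <= 1.
Hypothesis ot_ok : forall (arr : seq (Zw (plen p))) i, size arr = pfeat p -> (i < pfeat p)%N ->
  ex (ot_exec ot k (pfeat p) arr i) (fun o => ind (~ (o.1 = nth 0 arr i))) <= mu.

Let w := plen p.
Let n := pfeat p.
Let w_gt0 : (0 < w)%N := plen_gt0 p.
Let n_gt0 : (0 < n)%N. Proof. by case/and3P: p_valid. Qed.
Let nb := node_bit T x.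
Let ideal : rat := ex (unif w) (fun a => g [:: enc w a; enc w (dt_eval T x - a)]).

Let ideal01 : 0 <= ideal <= 1.
Proof. exact: ex01. Qed.

Lemma infer_client vs us : map (@opened w) vs = [seq (nb j)%:R | j <- iota 0 (pnode p)] ->
  map (@opened w) us = leafval T ->
  `|ev Client (infer vs us) (fun _ v => g v) - ideal| <= 0.
Proof.
move=> hvs hus; rewrite -[leRHS]addr0.
pose path z := path_to (pdepth p) (pnode p + z).
have su : size us = pleaf p by rewrite -(size_map (@opened w)) hus size_tuple.
apply: (ev_fail (E := fun gs => map (@opened w) gs =
   [seq \prod_(a <- [seq edge vs e | e <- path z]) opened a | z <- iota 0 (pleaf p)])) => //.
- by apply: silent_pmapM => z; apply: silent_prodsh.
- by apply: fail_sure; apply: sure_pmapM => z; apply: sure_prodsh.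
move=> gs hgs; have sg : size gs = pleaf p by rewrite -(size_map (@opened w)) hgs size_map size_iota.
have sz : size (zip gs us) = pleaf p by rewrite size_zip sg su minnn.
have Z0 : (0 < pleaf p)%N by rewrite expn_gt0.
rewrite ev_out_client // ?sz // /ideal.
have -> : \sum_(z <- zip gs us) opened z.1 * opened z.2 = dt_eval T x.
  have JZ : (pnode p).+1 = pleaf p by rewrite prednK.
  have leaf z : (z < pleaf p)%N ->
      opened (nth (0, 0) gs z) = (descend nb (pdepth p) 0 == (pnode p + z)%N)%:R :> Zw w.
    move=> hz; rewrite -(nth_map _ 0) ?sg // hgs (nth_map 0%N) ?size_iota // nth_iota // add0n.
    have hr : (2 ^ pdepth p <= (pnode p + z).+1 < 2 ^ (pdepth p).+1)%N.
      by rewrite -addSn JZ expnS /pleaf; move: hz; rewrite /pleaf; lia.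
    rewrite big_map -path_prod // !big_seq; apply: eq_bigr => e he.
    by apply: (opened_edge (J := pnode p)) => //; apply: path_lt he; case/andP: hr.
  have hd := descend_range nb (pdepth p).
  set D := descend nb (pdepth p) 0 in leaf hd *.
  have hD : (D - pnode p < pleaf p)%N by move: hd; rewrite expnS -JZ /pnode; lia.
  (* Only the leaf reached by the descent survives in the sum. *)
  rewrite (big_nth ((0, 0), (0, 0))) sz big_mkord (bigD1 (Ordinal hD)) //= nth_zip ?sg //=.
  rewrite leaf // subnKC ?eqxx ?mul1r; last by move: hd; rewrite /pnode; lia.
  rewrite big1 ?addr0 => [|i /eqP hi]; last first.
    rewrite nth_zip ?sg //= leaf //; case: eqP => [e|]; rewrite ?mul0r //.
    by case: hi; apply: val_inj; rewrite /= e addKn.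
  by rewrite /dt_eval -/nb -/D -hus (nth_map (0, 0)) // su.
by rewrite subrr normr0.
Qed.

Lemma evaluate_client sx ys us :
  map (@opened w) sx = [seq nth 0 x (nat_of_ord i) | i <- sel T] ->
  map (@opened w) ys = thr T -> map (@opened w) us = leafval T ->
  `|ev Client (evaluate sx ys us) (fun _ v => g v) - ideal| <= 0.
Proof.
move=> hsx hys hus; rewrite -[leRHS]addr0.
have p0 : (0 < plog p)%N by case/and3P: p_valid.
have ssx : size sx = pnode p by rewrite -(size_map (@opened w)) hsx size_map size_tuple.
have sys : size ys = pnode p by rewrite -(size_map (@opened w)) hys size_tuple.
have sz : size (zip sx ys) = pnode p by rewrite size_zip ssx sys minnn.
apply: (ev_fail (E := fun bs => map (@opened 1) bs = [seq bitZ2 (nb j) | j <- iota 0 (pnode p)])) => //.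
- by apply: silent_pmapM => a; apply: silent_msb.
- apply: fail_sure.
  have -> : [seq bitZ2 (nb j) | j <- iota 0 (pnode p)] =
     [seq bitZ2 (msb (opened (subsh a.1 a.2))) | a <- zip sx ys].
    apply: (@eq_from_nth _ 0); rewrite !size_map size_iota ?sz // => j hj.
    rewrite (nth_map 0%N) ?size_iota // nth_iota // add0n (nth_map ((0, 0), (0, 0))) ?sz //.
    rewrite nth_zip ?ssx //= /nb /node_bit; congr (bitZ2 (msb _)).
    transitivity (opened (nth (0, 0) sx j) - opened (nth (0, 0) ys j)); last first.
      by rewrite /opened /subsh /=; ring.
    have nth_opened (s : seq (share w)) : (j < size s)%N ->
        opened (nth (0, 0) s j) = nth 0 (map (@opened w) s) j.
      by move=> h; rewrite (nth_map (0, 0)).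
    rewrite !nth_opened ?ssx ?sys // hsx hys.
    have -> : [seq nth 0 x (nat_of_ord i) | i <- sel T] =
        [seq nth 0 x i | i <- [seq nat_of_ord i | i <- sel T]] by rewrite -map_comp.
    by rewrite (nth_map 0%N) // size_map size_tuple.
  by apply: sure_pmapM => a; apply: sure_msb.
move=> bs hbs; rewrite -[leRHS]addr0.
apply: (ev_fail (E := fun vs => map (@opened w) vs = [seq (nb j)%:R | j <- iota 0 (pnode p)])) => //.
- by apply: silent_pmapM => a; apply: silent_lift.
- apply: fail_sure.
  have -> : [seq (nb j)%:R | j <- iota 0 (pnode p)] =
     [seq (((opened b : Zw 1) : nat)%:R : Zw w) | b : share 1 <- bs].
    transitivity [seq (((b : Zw 1) : nat)%:R : Zw w) | b : Zw 1 <- map (@opened 1) bs]; last by rewrite -map_comp.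
    by rewrite hbs -map_comp; apply: eq_map => j /=; rewrite bitZ2_nat.
  apply: sure_pmapM => b; have [c hc] := Z2_bool (opened b).
  by rewrite hc bitZ2_nat; apply: sure_lift.
by move=> vs hvs; apply: infer_client.
Qed.

Lemma client_rest xs : map (@opened w) xs = x ->
  `|ev Client
     (let* ys := pmapM (give Provider) (tval (thr T)) in
      let* us := pmapM (give Provider) (tval (leafval T)) in
      let* ids := pmapM (fun i : 'I_(pfeat p) =>
                 give Provider ((i : nat)%:R : Zw w)) (tval (sel T)) in
      let* sx := pmapM (select ot k (pfeat p) xs) ids in
      evaluate sx ys us) (fun _ v => g v) - ideal|
  <= (pnode p)%:R * ((mu + mu) + (wrap_prob w n + wrap_prob w n)).
Proof.
move=> hxs; set eps := _ + (_ + _).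
have eps0 : 0 <= eps by rewrite !addr_ge0 ?wrap_ge0.
have Je0 : 0 <= (pnode p)%:R * eps by rewrite mulr_ge0.
have gives (A : Type) (h : A -> Zw w) s : silent Client (pmapM (fun i => give Provider (h i)) s) /\
    fail (pmapM (fun i => give Provider (h i)) s) (fun ys => map (@opened w) ys = map h s) <= 0.
  split; first by apply: silent_pmapM => i; apply: silent_give.
  apply: fail_sure; move: (sure_gives true h s (isT : ~~ is_server Provider)).
  by apply: sure_imp => r [].
rewrite -[leRHS]add0r; have [s1 f1] := gives _ id (tval (thr T)).
apply: (ev_fail s1 g01 ideal01 Je0 f1) => ys; rewrite map_id => hys.
rewrite -[leRHS]add0r; have [s2 f2] := gives _ id (tval (leafval T)).
apply: (ev_fail s2 g01 ideal01 Je0 f2) => us; rewrite map_id => hus.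
rewrite -[leRHS]add0r; have [s3 f3] := gives _ (fun i : 'I_(pfeat p) => (i : nat)%:R : Zw w) (tval (sel T)).
apply: (ev_fail s3 g01 ideal01 Je0 f3) => ids hids.
have sids : size ids = pnode p by rewrite -(size_map (@opened w)) hids size_map size_tuple.
rewrite -[leRHS]addr0 -sids.
(* The opened index is read back as a natural number; nothing is lost, as there are at most [2 ^ l]
   features. *)
pose h (a : share w) := nth 0 x (slot (2 ^ w) (opened a)).
apply: (ev_fail (E := fun sx => map (@opened w) sx = map h ids)) => //.
- by apply: silent_pmapM => a; apply: silent_select.
- have fs a : (exists2 i, (i < n)%N & opened a = i%:R) ->
      fail (select ot k (pfeat p) xs a) (fun r => opened r = h a) <= eps.
    move=> [i hi ha].
    have := @fail_select ot k w n mu w_gt0 n_gt0 mu_ge0 ot_ok xs a i hi ha.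
    rewrite hxs /h ha /slot Zw_natr // modn_mod modn_small //.
    by apply: leq_trans hi _; case/and3P: p_valid.
  apply: (fail_pmapM (v := @opened w) (h := h) eps0 fs).
  move: hids; clear; move: (tval (sel T)) => s.
  elim: s ids => [|i s IH] [|a ids] //= [ha /IH hs]; split => //.
  by exists (i : nat) => //; apply: ltn_ord.
move=> sx hsx; apply: evaluate_client => //.
rewrite hsx; have -> : map h ids = [seq nth 0 x (slot (2 ^ w) a) | a <- map (@opened w) ids].
  by rewrite -map_comp.
rewrite hids -map_comp; apply: eq_map => i /=; rewrite /slot Zw_natr // modn_mod modn_small //.
by apply: leq_trans (ltn_ord i) _; case/and3P: p_valid.
Qed.

End ClientGap.

Lemma client_gap ot k p mu (a : dtree p * features p) F :
  valid_params p -> 0 <= mu -> (forall v, 0 <= F v <= 1) ->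
  (forall (arr : seq (Zw (plen p))) i, size arr = pfeat p -> (i < pfeat p)%N ->
     ex (ot_exec ot k (pfeat p) arr i) (fun o => ind (~ (o.1 = nth 0 arr i))) <= mu) ->
  gap (view ot k Client a) (block_out client_prog (load (public k p
        ++ enc_features a.2 ++ [:: enc (plen p) (dt_eval a.1 a.2)]))) F
  <= (pnode p)%:R * ((mu + mu) + (wrap_prob (plen p) (pfeat p) + wrap_prob (plen p) (pfeat p))).
Proof.
case: a => T x pv mu0 F01 ot_ok; have w0 := plen_gt0 p.
rewrite /gap view_ex (client_progE _ _ _ w0) ex_bind [fst _]/= [snd _]/= [party_input _ _ _]/=.
have hg : hid Client (plen p) (pfeat p) (pmapM (give Client) (tval x)).
  have hs s : hid Client (plen p) (size s * 1) (pmapM (@give (plen p) Client) s).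
    by apply: hid_pmapM => i; apply: hid_give_user.
  by have := hs (tval x); rewrite muln1 size_tuple.
(* The coins of the simulated sharing of the features are identified with the real ones and become a
   fixed prefix of the test. *)
rewrite -hg protocolE ev_pbind; apply: ex_dist_le.
move: (sure_gives true id (tval x) (isT : ~~ is_server Client)); apply: sure_imp => r [hr _].
rewrite map_id in hr; rewrite ex_bind; cbn [ex].
have := client_rest T (g := fun v => F (enc_features x ++ filt Client r.2 ++ v)) pv mu0 _ ot_ok hr.
by apply.
Qed.

Lemma client_secure par ot : (forall k, valid_params (par k)) ->
  poly_bounded (fun k => (plen (par k) + pfeat (par k) + pleaf (par k))%N) ->
  negligible (fun k => if (pfeat (par k) %| 2 ^ plen (par k))%N then 0
                       else (2%:R ^+ plen (par k))^-1) ->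
  ot_secure ot par -> exists2 SimU, ppt SimU &
  cind (fun k (a : dtree (par k) * features (par k)) => view ot k Client a)
       (fun k a => SimU (public k (par k) ++ enc_features a.2
                            ++ [:: enc (plen (par k)) (dt_eval a.1 a.2)])).
Proof.
move=> pv pp wrap [_ [mu nmu hmu] _ _].
exists (fun v => block_out client_prog (load v)); first exact: ppt_client.
move=> D adv pD padv.
have nW : negligible (fun k => wrap_prob (plen (par k)) (pfeat (par k))).
  exact: neg_mul wrap (pb_pfeat pp).
(* [client_gap] takes a nonnegative error, and the absolute value ensures that. *)
have nm : negligible (fun k => `|mu k|) by apply: neg_le nmu => k; rewrite normr_id.
eexists; last first.
  move=> k a; cbv zeta beta; rewrite !(pr_run _ _ (nseq k true :: adv k)).
  apply: (client_gap a (pv k) (normr_ge0 (mu k))) => [v|arr i hs hi]; first exact: pr01.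
  have hs' : size arr == pfeat (par k) by apply/eqP.
  have := hmu k (Tuple hs', Ordinal hi); rewrite prE => h.
  apply: le_trans (le_trans h (ler_norm _)); apply: ex_le => o.
  rewrite (tnth_nth 0) /=; case: eqP => e; first by rewrite indF.
  by rewrite indT.
apply: neg_mul; last exact: pb_pnode pp.
by apply: neg_add; apply: neg_add.
Qed.

Theorem theorem1 (par : nat -> params) (ot : ot_protocol)
  (par_valid : forall k, valid_params (par k))
  (par_poly : poly_bounded
     (fun k => (plen (par k) + pfeat (par k) + pleaf (par k))%N))
  (par_wrap : negligible (fun k =>
     if (pfeat (par k) %| 2 ^ plen (par k))%N then 0
     else (2%:R ^+ plen (par k))^-1))
  (ot_sec : ot_secure ot par) :
  (exists2 SimP, ppt SimP &
     cind (fun k (a : dtree (par k) * features (par k)) => view ot k Provider a)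
          (fun k a => SimP (public k (par k) ++ enc_dtree a.1)))
  /\ (forall m : bool, exists2 SimC, ppt SimC &
     cind (fun k (a : dtree (par k) * features (par k)) => view ot k (Server m) a)
          (fun k a => SimC (public k (par k))))
  /\ (exists2 SimU, ppt SimU &
     cind (fun k (a : dtree (par k) * features (par k)) => view ot k Client a)
          (fun k a => SimU (public k (par k) ++ enc_features a.2
                            ++ [:: enc (plen (par k)) (dt_eval a.1 a.2)]))).
Proof.
split; first exact: provider_secure.
split; last exact: client_secure.
by move=> m; apply: server_secure.
Qed.
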